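(* Let $K$ be a locally compact Hausdorff topological space and let $\mathcal{A}$ be a compact C$^*$-algebra. The following assertions are equivalent: (i) $C_0(K,\mathcal{A})$ has property $\mathrm{(P1)}$; (ii) $C_0(K,\mathcal{A})$ has property $(\overline{\mathrm{P1}})$; (iii) $K$ is scattered and $\mathcal{A}$ is the $c_0$-sum of finite-dimensional C$^*$-algebras.
   Context: For a Banach space $X$ (real or complex), $B_X$ is the closed unit ball. For $f\in B_{X^*}$ and $\varepsilon>0$, the slice of $B_X$ is $S(B_X,f,\varepsilon)=\{x\in B_X:\ \mathrm{Re}\, f(x)>\sup_{c\in B_X}|f(c)|-\varepsilon\}$. A convex combination of slices of $B_X$ is a set $\sum_{i=1}^n\lambda_i S_i=\{\sum_{i=1}^n \lambda_i x_i: x_i\in S_i\}$ with $n\in\mathbb{N}$, $\lambda_i>0$, $\sum_{i=1}^n\lambda_i=1$ and each $S_i$ a slice of $B_X$. $X$ has property $\mathrm{(P1)}$ (respectively $(\overline{\mathrm{P1}})$) if for every convex combination of slices $C$ of $B_X$ and every $x\in C$ there exists a relatively weakly open subset $W$ of $B_X$ with $x\in W\subseteq C$ (respectively $x\in W\subseteq\overline{C}$, norm closure). A topological space is scattered if each of its nonempty closed subsets has an isolated point (in the relative topology). $C_0(K,\mathcal{A})$ is the C$^*$-algebra of continuous functions $K\to\mathcal{A}$ vanishing at infinity, with the sup norm. A compact C$^*$-algebra is a C$^*$-algebra that is the $c_0$-sum of a family of algebras of compact operators on Hilbert spaces. The $c_0$-sum of a family of Banach spaces $\{X_\gamma\}_{\gamma\in\Gamma}$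 consists of all $(x_\gamma)$, $x_\gamma\in X_\gamma$, such that $\{\gamma:\|x_\gamma\|\ge\eta\}$ is finite for every $\eta>0$, with the sup norm.
   Formalization: K is assumed nonempty and the algebra A nonzero; otherwise C_0(K,A)={0} trivially has (P1) while (iii) can fail (K empty with A the compact operators on l^2, or A=0 with K=[0,1]). *)

(* Defs.v *)
From HB Require Import structures.
From mathcomp Require Import all_boot all_order all_algebra.
From mathcomp Require Import all_classical all_reals all_analysis.
From mathcomp Require Import complex.
From mathcomp Require Import lra.

Set Implicit Arguments.
Unset Strict Implicit.
Unset Printing Implicit Defensive.

Import Order.TTheory GRing.Theory Num.Theory.
Import numFieldNormedType.Exports.

Local Open Scope classical_set_scope.
Local Open Scope ring_scope.
Local Open Scope complex_scope.

(** Complex Banach spaces are [X : completeNormedModType R[i]].  Their norm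
    [`|x|] takes its values in [R[i]] (where [<=] is the partial order forcing
    equal imaginary parts); [rnorm] is the same norm as an element of [R], which
    is needed to take suprema. *)

Section RealNorm.
Context {R : realType}.

Lemma realCD (a b : R) : (a + b)%:C = a%:C + b%:C.
Proof. exact: rmorphD. Qed.

Lemma realCM (a b : R) : (a * b)%:C = a%:C * b%:C.
Proof. exact: rmorphM. Qed.

Lemma Re_normE (l : R[i]) : (complex.Re `|l|)%:C = `|l|.
Proof. by rewrite RRe_real// ger0_real. Qed.

Lemma Re_norm_ge0 (l : R[i]) : 0 <= complex.Re `|l|.
Proof. by rewrite -lecR Re_normE normr_ge0. Qed.

Variable V : normedModType R[i].
Implicit Types x y : V.

Definition rnorm (x : V) : R := complex.Re `|x|.

Lemma rnormE x : (rnorm x)%:C = `|x|.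
Proof. by rewrite /rnorm RRe_real// ger0_real. Qed.

Lemma rnorm_ge0 x : 0 <= rnorm x.
Proof. by rewrite -lecR rnormE normr_ge0. Qed.

Lemma ler_rnormD x y : rnorm (x + y) <= rnorm x + rnorm y.
Proof. by rewrite -lecR realCD !rnormE ler_normD. Qed.

Lemma rnormZ (l : R[i]) x : rnorm (l *: x) = complex.Re `|l| * rnorm x.
Proof.
apply: (@complexI R).
by rewrite realCM !rnormE normrZ Re_normE.
Qed.

Lemma rnormN x : rnorm (- x) = rnorm x.
Proof. by rewrite /rnorm normrN. Qed.

Lemma rnorm0_eq0 x : rnorm x = 0 -> x = 0.
Proof. by move=> x0; apply/eqP; rewrite -normr_eq0 -rnormE x0. Qed.

Lemma rnorm_continuous : continuous rnorm.
Proof.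
move=> x; apply/cvgrPdist_lt => e e0.
have e0C : 0 < e%:C by rewrite ltcR.
near=> y.
have xy : rnorm (x - y) < e.
  rewrite -ltcR rnormE; near: y; exact: (cvgr_dist_lt id x cvg_id _ e0C).
have h1 := ler_rnormD (x - y) y; have h2 := ler_rnormD (y - x) x.
move: h1 h2; rewrite !subrK -(opprB x y) rnormN => h1 h2.
rewrite ltr_norml; apply/andP; split; lra.
Unshelve. all: by end_near. Qed.

End RealNorm.

Section WeakTopology.
Variables (R : realType) (X : completeNormedModType R[i]).

Definition closed_unit_ball : set X := [set x | `|x| <= 1].

Record dual := Dual {
  dual_fun :> {linear X -> R[i]^o} ;
  dual_continuous : continuous dual_fun }.

Definition dual_norm (f : dual) : R :=
  sup [set rnorm (f x) | x in closed_unit_ball].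

(** The coarsest topology making all continuous functionals continuous. *)
Definition weak_topology : Type :=
  sup_topology (fun f : dual => Topological.on (initial_topology f)).
HB.instance Definition _ := Topological.on weak_topology.

Definition rel_weakly_open (W : set X) : Prop :=
  exists U : set weak_topology, open U /\ W = closed_unit_ball `&` U.

End WeakTopology.

Section P1.
Variables (R : realType) (X : completeNormedModType R[i]).

Definition slice (f : dual X) (e : R) : set X :=
  [set x | closed_unit_ball x /\ complex.Re (f x) > dual_norm f - e].

Definition convex_combination_of_slices (C : set X) : Prop :=
  exists (n : nat) (lam : 'I_n -> R) (f : 'I_n -> dual X) (e : 'I_n -> R),
    [/\ forall i, 0 < lam i,
        \sum_i lam i = 1,
        forall i, dual_norm (f i) <= 1,
        forall i, 0 < e i &
        C = [set \sum_i (lam i)%:C *: x i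
              | x in [set x : 'I_n -> X | forall i, slice (f i) (e i) (x i)]]].

Definition P1 : Prop :=
  forall C : set X, convex_combination_of_slices C -> forall x, C x ->
  exists W : set X, [/\ rel_weakly_open W, W x & W `<=` C].

Definition P1bar : Prop :=
  forall C : set X, convex_combination_of_slices C -> forall x, C x ->
  exists W : set X, [/\ rel_weakly_open W, W x & W `<=` closure C].

End P1.
Arguments P1 {R} X.
Arguments P1bar {R} X.

Definition scattered (T : topologicalType) : Prop :=
  forall F : set T, closed F -> F !=set0 -> isolated F !=set0.

Section C0.
Variables (R : realType) (K : topologicalType) (A : completeNormedModType R[i]).

Definition vanishing_at_infinity (f : K -> A) : Prop :=
  forall e : R, 0 < e -> compact [set k | e <= rnorm (f k)].

Definition C0_pred : {pred K -> A} :=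
  mem [set f : K -> A | continuous f /\ vanishing_at_infinity f].

Lemma C0_predP (f : K -> A) :
  reflect (continuous f /\ vanishing_at_infinity f) (f \in C0_pred).
Proof. exact: asboolP. Qed.

Lemma closed_rnorm_ge (f : K -> A) (e : R) : continuous f ->
  closed [set k | e <= rnorm (f k)].
Proof.
move=> cf; have c : continuous (@rnorm R A \o f).
  by move=> x; apply: continuous_comp; [exact: cf|exact: rnorm_continuous].
exact: (preimage_closed (fun x _ => c x) (@closed_ge _ e)).
Qed.

Lemma C0_submod_closed : submod_closed C0_pred.
Proof.
split.
  apply/C0_predP; split; first by move=> x; exact: cvg_cst.
  move=> e e0; rewrite (_ : [set _ | _] = set0); first exact: compact0.
  apply/seteqP; split => // k /=.
  by rewrite /rnorm normr0/= leNgt e0.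
move=> l f g /C0_predP[cf vf] /C0_predP[cg vg]; apply/C0_predP.
have cfg : continuous (l *: f + g).
  by move=> x; apply: cvgD; [apply: cvgZr; exact: cf|exact: cg].
split => // e e0.
pose c := complex.Re `|l| + 1.
have l0 : 0 <= complex.Re `|l|.
  exact: Re_norm_ge0.
have c0 : 0 < c by rewrite /c; lra.
have ec0 : 0 < e / 2 / c by rewrite !divr_gt0.
have e20 : 0 < e / 2 by rewrite divr_gt0.
apply: subclosed_compact (closed_rnorm_ge cfg) (compactU (vf _ ec0) (vg _ e20)) _.
move=> k /= ek.
have [|hf] := leP (e / 2 / c) (rnorm (f k)); first by left.
right; rewrite leNgt; apply/negP => hg.
have := ler_rnormD (l *: f k) (g k); rewrite rnormZ.
have : complex.Re `|l| * rnorm (f k) <= e / 2.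
  have : c * rnorm (f k) <= e / 2.
    by rewrite mulrC -ler_pdivlMr// ltW.
  have := rnorm_ge0 (f k); rewrite /c => ? ?; lra.
have {}ek : e <= rnorm (l *: f k + g k) by [].
lra.
Qed.

HB.instance Definition _ :=
  GRing.isSubmodClosed.Build R[i] (K -> A) C0_pred C0_submod_closed.

Record C0 := MkC0 { C0_fun :> K -> A ; C0_funP : C0_fun \in C0_pred }.

HB.instance Definition _ := [isSub for C0_fun].
HB.instance Definition _ := [Choice of C0 by <:].
HB.instance Definition _ := [SubChoice_isSubLmodule of C0 by <:].

Implicit Types f g : C0.

Lemma C0_continuous f : continuous f.
Proof. by have /C0_predP[] := C0_funP f. Qed.

Lemma C0_vanishing f : vanishing_at_infinity f.
Proof. by have /C0_predP[] := C0_funP f. Qed.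

Lemma C0_bounded f : exists M, forall k, rnorm (f k) <= M.
Proof.
have c : continuous (fun k => rnorm (f k)).
  move=> x; apply: (@continuous_comp _ _ _ f (@rnorm R A)).
    exact: C0_continuous.
  exact: rnorm_continuous.
have := continuous_compact (continuous_subspaceT c) (@C0_vanishing f _ ltr01).
move=> /compact_bounded[M [_ /(_ (M + 1))]].
rewrite ltrDl ltr01 => /(_ isT) hM.
exists (Num.max 1 (M + 1)) => k; rewrite le_max.
have [k1|k1] := leP 1 (rnorm (f k)); last by rewrite ltW.
apply/orP; right.
have /= := hM (rnorm (f k)); rewrite ger0_norm ?rnorm_ge0//; apply.
by exists k.
Qed.

Definition C0_sup_norm f : R := sup (range (fun k => rnorm (f k))).

Lemma C0_sup_norm_ub f k : rnorm (f k) <= C0_sup_norm f.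
Proof.
have [M hM] := C0_bounded f.
by apply: ub_le_sup; [exists M => _ [x _ <-]|exists k].
Qed.

Lemma C0_sup_norm_ge0 f : 0 <= C0_sup_norm f.
Proof.
have [e|/set0P[_ [k _ _]]] := eqVneq (range (fun k => rnorm (f k))) set0.
  by rewrite /C0_sup_norm e sup0.
exact: le_trans (rnorm_ge0 _) (C0_sup_norm_ub f k).
Qed.

Lemma C0_sup_norm_le f M : 0 <= M -> (forall k, rnorm (f k) <= M) ->
  C0_sup_norm f <= M.
Proof.
move=> M0 hM; have [e|/set0P ne] := eqVneq (range (fun k => rnorm (f k))) set0.
  by rewrite /C0_sup_norm e sup0.
by apply: ge_sup => // _ [k _ <-].
Qed.

Definition C0_norm f : R[i] := (C0_sup_norm f)%:C.

Lemma C0_ler_normD f g : C0_norm (f + g) <= C0_norm f + C0_norm g.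
Proof.
rewrite /C0_norm -realCD lecR; apply: C0_sup_norm_le.
  by rewrite addr_ge0 ?C0_sup_norm_ge0.
by move=> k; apply: le_trans (ler_rnormD _ _) _; rewrite lerD ?C0_sup_norm_ub.
Qed.

Lemma C0_normrZ (l : R[i]) f : C0_norm (l *: f) = `|l| * C0_norm f.
Proof.
have le_normZ (a : R[i]) (h : C0) :
    C0_sup_norm (a *: h) <= complex.Re `|a| * C0_sup_norm h.
  have a0 := Re_norm_ge0 a.
  apply: C0_sup_norm_le; first by rewrite mulr_ge0 ?C0_sup_norm_ge0.
  by move=> k; rewrite [leLHS]rnormZ ler_wpM2l ?C0_sup_norm_ub.
rewrite /C0_norm -Re_normE -realCM; congr (_%:C).
have [->|l0] := eqVneq l 0.
  rewrite scale0r normr0/= mul0r; apply/eqP; rewrite eq_le C0_sup_norm_ge0 andbT.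
  by apply: C0_sup_norm_le => // k; rewrite [leLHS]/rnorm [X in `|X|](_ : _ = 0)// normr0.
apply/eqP; rewrite eq_le le_normZ/=.
have := le_normZ l^-1 (l *: f); rewrite scalerA mulVf// scale1r.
have l0' : 0 < complex.Re `|l|.
  by rewrite -ltcR Re_normE normr_gt0.
rewrite -(ler_pM2l l0') mulrA.
suff -> : complex.Re `|l| * complex.Re `|l^-1| = 1 by rewrite mul1r.
apply: (@complexI R); rewrite realCM !Re_normE.
by rewrite -normrM mulfV// normr1.
Qed.

Lemma C0_normr0_eq0 f : C0_norm f = 0 -> f = 0.
Proof.
move=> /(@complexI R) f0; apply/val_inj/funext => k; apply: rnorm0_eq0.
by apply/eqP; rewrite eq_le rnorm_ge0 andbT -[leRHS]f0 C0_sup_norm_ub.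
Qed.

HB.instance Definition _ :=
  Lmodule_isNormed.Build R[i] C0 C0_ler_normD C0_normrZ C0_normr0_eq0.

Lemma C0_normE f : `|f| = (sup (range (fun k => rnorm (f k))))%:C.
Proof. by []. Qed.

Lemma C0_norm_ub f k : `|f k| <= `|f|.
Proof. by rewrite -rnormE C0_normE lecR C0_sup_norm_ub. Qed.

Lemma C0_complete (F : set_system C0) : ProperFilter F -> cauchy F -> cvg F.
Proof.
move=> FF /cauchy_ballP Fc.
have Fk (k : K) : cvg ((fun f : C0 => f k) @ F).
  apply/cauchy_cvgP/cauchy_ballP => e e0.
  rewrite near_map2.
  apply: filterS (Fc e e0) => -[f g] /=.
  rewrite -!ball_normE/= => fg; apply: le_lt_trans fg.
  exact: (C0_norm_ub (f - g) k).
pose g (k : K) : A := lim ((fun f : C0 => f k) @ F).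
have Fg (e : R) : 0 < e -> \forall f \near F, forall k, rnorm ((f : C0) k - g k) <= e.
  move=> e0.
  have e20 : 0 < (e / 2)%:C by rewrite ltcR divr_gt0.
  have Fe := nearP_dep (Fc _ e20).
  near=> f => k; near F => h.
  have fh : rnorm (f k - h k) <= e / 2.
    rewrite -lecR rnormE; apply: le_trans (C0_norm_ub (f - h) k) _; apply: ltW.
    have : ball f (e / 2)%:C h by near: h; near: f; exact: Fe.
    by rewrite -ball_normE.
  have hg : rnorm (h k - g k) <= e / 2.
    rewrite -rnormN opprB -lecR rnormE; apply: ltW; near: h.
    exact: (cvgr_dist_lt _ _ (Fk k) _ e20).
  have := ler_rnormD (f k - h k) (h k - g k).
  rewrite addrA subrK; lra.
have cg : continuous g.
  move=> k; apply/cvgrPdist_le => e e0.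
  have [er re] : complex.Re e = complex.Re e /\ (complex.Re e)%:C = e.
    by split => //; rewrite RRe_real// gtr0_real.
  set d := complex.Re e in re; have d0 : 0 < d by rewrite -ltcR re.
  have d30 : 0 < d / 3 by rewrite divr_gt0.
  have [f Ff] := filter_ex (Fg _ d30).
  have d3C : 0 < (d / 3)%:C by rewrite ltcR.
  near=> z.
  have fz : rnorm (f k - f z) <= d / 3.
    rewrite -lecR rnormE; near: z.
    exact: (cvgr_dist_le _ _ (@C0_continuous f k) _ d3C).
  rewrite -rnormE -re lecR.
  have h1 := Ff k; have h2 := Ff z.
  have h3 := ler_rnormD (g k - f k) (f k - f z).
  have h4 := ler_rnormD (g k - f z) (f z - g z).
  rewrite -(rnormN (f k - g k)) opprB in h1.
  move: h3 h4; rewrite !addrA !subrK; lra.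
have vg : vanishing_at_infinity g.
  move=> e e0; have e20 : 0 < e / 2 by rewrite divr_gt0.
  have [f Ff] := filter_ex (Fg _ e20).
  apply: subclosed_compact (closed_rnorm_ge cg) (@C0_vanishing f _ e20) _.
  move=> k /= ek; have h1 := Ff k.
  have := ler_rnormD (g k - f k) (f k).
  rewrite subrK -(rnormN (g k - f k)) opprB; lra.
have gP : g \in C0_pred by apply/C0_predP.
apply/cvg_ex; exists (MkC0 gP); apply/cvgrPdist_le => e e0.
have re : (complex.Re e)%:C = e by rewrite RRe_real// gtr0_real.
have d0 : 0 < complex.Re e by rewrite -ltcR re.
have := Fg _ d0; apply: filterS => f hf.
rewrite -re C0_normE lecR; apply: (@C0_sup_norm_le (MkC0 gP - f)); first exact: ltW.
by move=> k; rewrite -rnormN opprB.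
Unshelve. all: by end_near. Qed.

HB.instance Definition _ := Uniform_isComplete.Build C0 C0_complete.

End C0.
Arguments C0 {R} K A.


(** Not necessarily unital C*-algebras. *)
HB.mixin Record isCStarAlgebra (R : realType) A
    of CompleteNormedModule R[i] A := {
  cmul : A -> A -> A ;
  cstar : A -> A ;
  cmulA : associative cmul ;
  cmulDl : left_distributive cmul +%R ;
  cmulDr : right_distributive cmul +%R ;
  cmulZl : forall (l : R[i]) (a b : A), cmul (l *: a) b = l *: cmul a b ;
  cmulZr : forall (l : R[i]) (a b : A), cmul a (l *: b) = l *: cmul a b ;
  ler_norm_cmul : forall a b : A, `|cmul a b| <= `|a| * `|b| ;
  cstarK : involutive cstar ;
  cstarD : {morph cstar : a b / a + b} ;
  cstarZ : forall (l : R[i]) (a : A), cstar (l *: a) = l^* *: cstar a ;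
  cstarM : forall a b : A, cstar (cmul a b) = cmul (cstar b) (cstar a) ;
  norm_cstar_cmul : forall a : A, `|cmul (cstar a) a| = `|a| ^+ 2
}.

#[short(type="cstarAlgType")]
HB.structure Definition CStarAlgebra (R : realType) :=
  {A of isCStarAlgebra R A & CompleteNormedModule R[i] A}.

HB.mixin Record isHilbert (R : realType) H of CompleteNormedModule R[i] H := {
  hdot : {dot H for (@conjc R)} ;
  hdotE : forall x : H, `|x| ^+ 2 = hdot x x
}.

#[short(type="hilbertType")]
HB.structure Definition Hilbert (R : realType) :=
  {H of isHilbert R H & CompleteNormedModule R[i] H}.

Section CompactOperators.
Variables (R : realType) (H : hilbertType R).

Definition compact_operator (T : {linear H -> H}) : Prop :=
  precompact (T @` @closed_unit_ball R H).

Definition operator_norm (T : {linear H -> H}) : R :=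
  sup [set rnorm (T x) | x in @closed_unit_ball R H].

(** [A] is, up to isometric *-isomorphism, the algebra of compact operators
    on [H], with composition, Hilbert adjoint and operator norm. *)
Definition is_compact_operator_algebra (A : cstarAlgType R) : Prop :=
  exists pi : A -> {linear H -> H},
    [/\ [/\ forall (l : R[i]) (a b : A) (x : H),
              pi (l *: a + b) x = l *: pi a x + pi b x,
            forall (a b : A) (x : H), pi (cmul a b) x = pi a (pi b x) &
            forall (a : A) (x y : H),
              hdot (pi a x) y = hdot x (pi (cstar a) y)],
        forall a : A, rnorm a = operator_norm (pi a),
        forall a : A, compact_operator (pi a) &
        forall T : {linear H -> H}, compact_operator T ->
          exists a : A, forall x : H, pi a x = T x].

End CompactOperators.

(** [A] is, up to isometric *-isomorphism, the c_0-sum of the family [X], with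
    coordinatewise operations and sup norm. *)
Definition is_c0_sum (R : realType) (A : cstarAlgType R)
    (I : Type) (X : I -> cstarAlgType R) : Prop :=
  exists pi : A -> forall i, X i,
    [/\ [/\ forall (l : R[i]) (a b : A) i,
              pi (l *: a + b) i = l *: pi a i + pi b i,
            forall (a b : A) i, pi (cmul a b) i = cmul (pi a i) (pi b i) &
            forall (a : A) i, pi (cstar a) i = cstar (pi a i)],
        forall a : A, rnorm a = sup (range (fun i => rnorm (pi a i))) &
        forall x : forall i, X i,
          (exists a : A, forall i, pi a i = x i) <->
          (forall e : R, 0 < e -> finite_set [set i | e <= rnorm (x i)])].

Definition compact_cstar_algebra (R : realType) (A : cstarAlgType R) : Prop :=
  exists (I : Type) (H : I -> hilbertType R) (X : I -> cstarAlgType R),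
    (forall i, is_compact_operator_algebra (H i) (X i)) /\ is_c0_sum A X.

Definition finite_dimensional (F : fieldType) (V : lmodType F) : Prop :=
  exists (n : nat) (v : 'I_n -> V), forall x : V,
    exists c : 'I_n -> F, x = \sum_i c i *: v i.

Definition c0_sum_of_finite_dimensional (R : realType) (A : cstarAlgType R)
    : Prop :=
  exists (I : Type) (X : I -> cstarAlgType R),
    (forall i, finite_dimensional (X i)) /\ is_c0_sum A X.

(* Main.v *)
(**
Idea. For sufficiency, a functional on [C0 K A] ([K] scattered, [A] a c_0-sum)
is concentrated, up to [e], on finitely many points [k] and summands [j]: it
cannot be large on infinitely many disjointly supported vectors, and isolated
points let one exhaust [K]. As the summands are finite dimensional, a weak
neighbourhood of [x0 = \sum_l lam_l x_l] controls [X k - x0 k] in norm on these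
summands, and it remains to split a nearby ball element [X] as
[\sum_l lam_l y_l] with [y_l] close to [x_l]. This works for contractions on any
Hilbert space: put [d_l = (1 - s) (x_l - x0)] and
[y_l = X + (1 - (X X^* )^m) d_l (1 - (X^* X)^m)], with [s] small, [m] large and
then [X] close to [x0]. These [y_l] are contractions, and strict convexity,
[lam_l (x_l - x0)^* (x_l - x0) <= 1 - x0^* x0], makes the cut-offs harmless. The
formula is continuous in [X], so the splitting extends from the points [k] to
their neighbourhoods by bump functions.

For necessity, take [C = 1/2 S(f, e) + 1/2 S(-f, e)] and [0] in [C], where [f] is
an average of vector states: elements of [C] are small in the associated
seminorm. If [K] contains a perfect set, [f] is built from a diffuse mean on
it; if some Hilbert space is infinite dimensional, [f] is a vector state at an
isolated point. In both cases every weak neighbourhood of [0] contains elements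
of the ball on which the seminorm is large.
*)

Require Import Defs.
From HB Require Import structures.
From mathcomp Require Import all_boot all_order all_algebra.
From mathcomp Require Import all_classical all_reals all_analysis.
From mathcomp Require Import complex.
From mathcomp Require Import ring lra.
Import Order.TTheory GRing.Theory Num.Theory.
Import numFieldNormedType.Exports.
Local Open Scope classical_set_scope.
Local Open Scope ring_scope.

Set Implicit Arguments.
Unset Strict Implicit.
Unset Printing Implicit Defensive.

(** The splitting must be exact, [\sum_l lam_l y_l = X], with each [y_l] in the ball. The translates
    [X + (x_l - x0)] satisfy the first demand but may leave the ball where [X] is nearly isometric.
    The correction is linear in [d_l], so it still averages to zero, and its two cut-offs switch it
    off where [1 - X^* X] or [1 - X X^*] is small. The factor [1 - s] pays for [X] being only close
    to [x0]. Powers of [X^* X] make sense without a unit and need no functional calculus: the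
    spectral inequalities used all follow from the moments [<(X^* X)^j u, u>] being nonincreasing
    and convex in [j].

    In the necessity a weak neighbourhood of [0] enters only through the common kernel of finitely
    many functionals. In infinite dimension, linear dependence puts a large element there. Over a
    perfect set the element must moreover be unimodular on most cells, which is obtained by counting
    coordinates. [K] nonempty and [A] nonzero are needed: otherwise [C0 K A] is zero and has [P1]
    whatever the other factor is. *)

Lemma linear_at0 (F : nzRingType) (U V : lmodType F) (f : U -> V) :
  (forall (l : F) u v, f (l *: u + v) = l *: f u + f v) -> f 0 = 0.
Proof. by move=> lf; have /(canLR (addrK _)) := lf 1 0 0; rewrite !scale1r addr0 subrr. Qed.

(** * Moduli, real-valued norms and bounded functionals *)

Section ComplexFacts.
Variable R : realType.
Implicit Types (z w : R[i]) (r : R).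
Local Open Scope complex_scope.

Lemma ReD z w : complex.Re (z + w) = complex.Re z + complex.Re w.
Proof. by case: z; case: w. Qed.

Lemma ReN z : complex.Re (- z) = - complex.Re z.
Proof. by case: z. Qed.

Lemma ReB z w : complex.Re (z - w) = complex.Re z - complex.Re w.
Proof. by rewrite ReD ReN. Qed.

Lemma ReMr r z : complex.Re (r%:C * z) = r * complex.Re z.
Proof. by case: z => a b /=; rewrite mul0r subr0. Qed.

Lemma Re_conj z : complex.Re z^* = complex.Re z.
Proof. by case: z. Qed.

Lemma Re_sum (I : Type) (s : seq I) (P : pred I) (F : I -> R[i]) :
  complex.Re (\sum_(i <- s | P i) F i) = \sum_(i <- s | P i) complex.Re (F i).
Proof. by apply: (big_morph _ ReD); rewrite ?raddf0. Qed.

Definition cabs z : R := complex.Re `|z|.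

Lemma cabsE z : (cabs z)%:C = `|z|.
Proof. exact: Re_normE. Qed.

Lemma cabs_ge0 z : 0 <= cabs z.
Proof. exact: Re_norm_ge0. Qed.

Lemma cabs_rnorm z : cabs z = rnorm (z : R[i]^o).
Proof. by []. Qed.

Lemma ler_cabsD z w : cabs (z + w) <= cabs z + cabs w.
Proof. by rewrite -lecR realCD !cabsE ler_normD. Qed.

Lemma cabsN z : cabs (- z) = cabs z.
Proof. by rewrite /cabs normrN. Qed.

Lemma cabsM z w : cabs (z * w) = cabs z * cabs w.
Proof. by apply: (@complexI R); rewrite realCM !cabsE normrM. Qed.

Lemma cabs_real r : cabs r%:C = `|r|.
Proof. by rewrite /cabs normc_def/= expr0n/= addr0 sqrtr_sqr. Qed.

Lemma cabs_ge0_real r : 0 <= r -> cabs r%:C = r.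
Proof. by move=> r0; rewrite cabs_real ger0_norm. Qed.

Lemma cabs1 : cabs 1 = 1.
Proof. by rewrite /cabs normr1. Qed.

Lemma cabs0 : cabs 0 = 0.
Proof. by rewrite /cabs normr0. Qed.

Lemma cabs0_eq0 z : cabs z = 0 -> z = 0.
Proof. by move=> z0; apply/eqP; rewrite -normr_eq0 -cabsE z0. Qed.

Lemma cabs_gt0 z : (0 < cabs z) = (z != 0).
Proof.
rewrite lt_neqAle cabs_ge0 andbT eq_sym; congr (~~ _).
apply/eqP/eqP => [|->]; [exact: cabs0_eq0|exact: cabs0].
Qed.

Lemma sqr_cabs z : cabs z ^+ 2 = complex.Re z ^+ 2 + complex.Im z ^+ 2.
Proof. by apply: (@complexI R); rewrite rmorphXn/= cabsE add_Re2_Im2. Qed.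

Lemma Re_le_cabs z : complex.Re z <= cabs z.
Proof.
rewrite -lecR cabsE; apply: le_trans (normc_ge_Re z).
by rewrite lecR ler_norm.
Qed.

Lemma normRe_le_cabs z : `|complex.Re z| <= cabs z.
Proof. by rewrite -lecR cabsE normc_ge_Re. Qed.

Lemma normIm_le_cabs z : `|complex.Im z| <= cabs z.
Proof.
rewrite -(@ler_pXn2r _ 2) ?nnegrE ?cabs_ge0//.
by rewrite sqr_cabs real_normK ?num_real// lerDr sqr_ge0.
Qed.

Lemma cabs_le_ReIm z : cabs z <= `|complex.Re z| + `|complex.Im z|.
Proof.
rewrite -(@ler_pXn2r _ 2) ?nnegrE ?cabs_ge0// ?addr_ge0//.
rewrite sqr_cabs sqrrD !real_normK ?num_real// -addrA lerD2l lerDr.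
by rewrite mulrn_wge0// mulr_ge0.
Qed.

Lemma rotate_cabs z : exists2 w, cabs w = 1 & w * z = (cabs z)%:C.
Proof.
have [->|z0] := eqVneq z 0; first by exists 1; rewrite ?cabs1// mulr0 cabs0.
exists (z^-1 * (cabs z)%:C); last by rewrite mulrAC mulVf// mul1r.
rewrite cabsM cabs_ge0_real ?cabs_ge0//.
apply: (@complexI R); rewrite realCM !cabsE normrV ?unitfE// mulVf//.
by rewrite normr_eq0.
Qed.

End ComplexFacts.

Section NormFacts.
Variables (R : realType) (V : normedModType R[i]).
Implicit Types x y : V.
Local Open Scope complex_scope.

Lemma rnorm0 : rnorm (0 : V) = 0.
Proof. by rewrite /rnorm normr0. Qed.

Lemma rnormZE (l : R[i]) x : rnorm (l *: x) = cabs l * rnorm x.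
Proof. exact: rnormZ. Qed.

Lemma ler_rnormB x y : rnorm (x - y) <= rnorm x + rnorm y.
Proof. by rewrite -[rnorm y]rnormN ler_rnormD. Qed.

Lemma rdistC x y : rnorm (x - y) = rnorm (y - x).
Proof. by rewrite -rnormN opprB. Qed.

Lemma ler_rnorm_sub x y : rnorm x <= rnorm y + rnorm (x - y).
Proof. by apply: le_trans (ler_rnormD _ _); rewrite addrC subrK. Qed.

Lemma rnorm_gt0 x : (0 < rnorm x) = (x != 0).
Proof.
rewrite lt_neqAle rnorm_ge0 andbT eq_sym; congr (~~ _).
apply/eqP/eqP => [|->]; [exact: rnorm0_eq0|exact: rnorm0].
Qed.

Lemma ler_rnorm_sum (I : Type) (s : seq I) (P : pred I) (F : I -> V) :
  rnorm (\sum_(i <- s | P i) F i) <= \sum_(i <- s | P i) rnorm (F i).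
Proof.
elim/big_rec2: _ => [|i a b _ ab]; first by rewrite rnorm0.
by apply: le_trans (ler_rnormD _ _) _; rewrite lerD2l.
Qed.

Lemma rnorm_le1 x : (rnorm x <= 1) = (`|x| <= 1).
Proof. by rewrite -lecR rnormE. Qed.

Lemma near_rdist (T : topologicalType) (f : T -> V) (t : T) :
  (forall e : R, 0 < e -> \forall u \near t, rnorm (f t - f u) < e) <->
  f @ t --> f t.
Proof.
split=> [H|ft e e0]; last first.
  have eC : 0 < e%:C by rewrite ltcR.
  have H : \forall u \near t, `|f t - f u| < e%:C by exact: cvgr_dist_lt.
  by apply: filterS H => u; rewrite -rnormE ltcR.
apply/cvgrPdist_lt => e e0.
have er : (complex.Re e)%:C = e by rewrite RRe_real// gtr0_real.
have := H (complex.Re e); rewrite -ltcR er => /(_ e0).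
by apply: filterS => u; rewrite -ltcR rnormE er.
Qed.

End NormFacts.

Section Dual.
Variables (R : realType) (X : completeNormedModType R[i]).
Implicit Types f : dual X.
Local Open Scope complex_scope.

Lemma ball_rnorm (x : X) : closed_unit_ball x <-> rnorm x <= 1.
Proof. by rewrite rnorm_le1. Qed.

Lemma dualD f x y : f (x + y) = f x + f y.
Proof. exact: linearD. Qed.

Lemma dualB f x y : f (x - y) = f x - f y.
Proof. exact: linearB. Qed.

Lemma dualZ f (a : R[i]) x : f (a *: x) = a * f x.
Proof. exact: linearZ. Qed.

Lemma dual_bounded f : exists2 M, 0 < M & forall x, cabs (f x) <= M * rnorm x.
Proof.
have /near_rdist/(_ 1 ltr01) := @dual_continuous _ _ f (0 : X).
move=> /nbhs_ballP[e /= e0 he].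
have er : (complex.Re e)%:C = e by rewrite RRe_real// gtr0_real.
have r0 : 0 < complex.Re e by rewrite -ltcR er.
set r := complex.Re e in er r0.
have r20 : 0 < r / 2 by rewrite divr_gt0.
exists (r / 2)^-1; first by rewrite invr_gt0.
move=> x; have [->|x0] := eqVneq x 0.
  by rewrite linear0 cabs0 mulr_ge0 ?rnorm_ge0// invr_ge0 ltW.
have nx : 0 < rnorm x by rewrite rnorm_gt0.
have /he : ball (0 : X) e ((r / 2 / rnorm x)%:C *: x).
  rewrite -ball_normE/= sub0r normrN -er -rnormE ltcR rnormZE.
  rewrite cabs_ge0_real; last by rewrite divr_ge0 // ltW.
  by rewrite divfK ?gt_eqF// -/r; lra.
rewrite /= linear0 sub0r rnormN linearZ -[rnorm _]/(cabs (_ * _)) cabsM.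
rewrite cabs_ge0_real; last by rewrite divr_ge0 // ltW.
rewrite mulrAC ltr_pdivrMr// mul1r -ltr_pdivlMl// => /ltW.
by [].
Qed.

Lemma dual_norm_ub f x : rnorm x <= 1 -> cabs (f x) <= dual_norm f.
Proof.
move=> x1; have [M M0 hM] := dual_bounded f.
apply: ub_le_sup; last by exists x => //; apply/ball_rnorm.
exists M => _ [y /ball_rnorm y1 <-]; apply: le_trans (hM y) _.
by rewrite -[leRHS]mulr1 ler_wpM2l// ltW.
Qed.

Lemma dual_norm_le f M : (forall x, rnorm x <= 1 -> cabs (f x) <= M) ->
  dual_norm f <= M.
Proof.
move=> hM; apply: ge_sup.
  by exists (rnorm (f 0)); exists 0 => //; apply/ball_rnorm; rewrite rnorm0.
by move=> _ [y /ball_rnorm y1 <-]; exact: hM.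
Qed.

Lemma dual_norm_bound f x : cabs (f x) <= dual_norm f * rnorm x.
Proof.
have [->|x0] := eqVneq x 0; first by rewrite linear0 cabs0 rnorm0 mulr0.
have nx : 0 < rnorm x by rewrite rnorm_gt0.
have i0 : 0 <= (rnorm x)^-1 by rewrite invr_ge0 ltW.
have := @dual_norm_ub f (((rnorm x)^-1)%:C *: x).
rewrite rnormZE cabs_ge0_real// mulVf ?gt_eqF// lexx => /(_ isT).
by rewrite dualZ cabsM cabs_ge0_real// ler_pdivrMl// mulrC.
Qed.

Lemma dual_of (f : X -> R[i]) (M : R) :
  (forall a x y, f (a *: x + y) = a * f x + f y) ->
  (forall x, cabs (f x) <= M * rnorm x) -> exists g : dual X, g =1 f.
Proof.
move=> lf bf.
pose F : {linear X -> R[i]^o} := HB.pack (f : X -> R[i]^o)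
  (GRing.isLinear.Build _ _ _ _ (f : X -> R[i]^o) lf).
have cF : continuous F.
  apply: bounded_linear_continuous; apply/linear_boundedP.
  near=> r => x; rewrite -rnormE.
  apply: (@le_trans _ _ ((M%:C) * `|x|)).
    by rewrite -rnormE -realCM lecR; exact: bf.
  rewrite ler_wpM2r//; near: r; apply: nbhs_pinfty_ge.
  by rewrite complex_real.
by exists (Dual cF).
Unshelve. all: by end_near. Qed.

End Dual.

(** * Weak neighbourhoods and the failure of P1bar *)

Section Weak.
Variables (R : realType) (X : completeNormedModType R[i]).
Local Open Scope complex_scope.

Lemma dualN (f : dual X) x : f (- x) = - f x.
Proof. by rewrite -[- x]sub0r dualB linear0 sub0r. Qed.

Lemma weak_continuous (g : dual X) :
  continuous (g : weak_topology X -> R[i]^o).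
Proof.
move=> x; have /cvg_sup/(_ g) gx : nbhs (x : weak_topology X) --> (x : weak_topology X) by [].
apply: cvg_trans; first exact: (cvg_app g gx).
exact: (@initial_continuous _ _ g x).
Qed.

(** The sets containing a fibre of finitely many functionals form a filter, so it is enough to
    compare it with each generating initial topology. The size of the neighbourhood can be
    forgotten, as the counterexamples lie in the fibre itself. *)
Lemma weak_nbhs_fiber (x : X) (P : set X) : nbhs (x : weak_topology X) P ->
  exists n (g : 'I_n -> dual X), forall y, (forall l, g l y = g l x) -> P y.
Proof.
pose F : set_system X := [set Q | exists n (g : 'I_n -> dual X),
  forall y, (forall l, g l y = g l x) -> Q y].
have FF : Filter F.
  split.
  - by exists 0%N, (fun i : 'I_0 => False_rect _ (Bool.diff_false_true (ltn_ord i))).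
  - move=> A B [n [g hg]] [m [h hh]]; exists (n + m)%N.
    exists (fun i => match fintype.split i with inl j => g j | inr j => h j end).
    move=> y hy; split; [apply: hg => l|apply: hh => l].
      by have := hy (unsplit (inl l)); rewrite unsplitK.
    by have := hy (unsplit (inr l)); rewrite unsplitK.
  - by move=> A B AB [n [g hg]]; exists n, g => y hy; exact/AB/hg.
suff Fx : F --> (x : weak_topology X) by exact: Fx.
apply/cvg_sup => g A.
rewrite nbhs_filterE (@nbhsE (initial_topology g)) => -[B [[U oU <-] Ux] UA].
exists 1%N, (fun=> g) => y hy.
by apply: UA; rewrite /= (hy ord0).
Qed.

Lemma near_weak (x : X) (I : finType) (g : I -> dual X) (e : R) : 0 < e ->
  nbhs (x : weak_topology X) [set y | forall i, cabs (g i (y - x)) < e].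
Proof.
move=> e0; have : \forall y \near (x : weak_topology X),
    forall i, i \in enum I -> cabs (g i (y - x)) < e.
  elim: (enum I) => [|i s IH]; first by near=> y.
  have gi : \forall y \near (x : weak_topology X), cabs (g i (y - x)) < e.
    have := proj2 (near_rdist (g i : weak_topology X -> R[i]^o) x)
      (@weak_continuous (g i) x) e e0.
    by apply: filterS => y; rewrite dualB -cabsN opprB.
  near=> y => j; rewrite inE => /predU1P[->|]; first by near: y.
  by move: j; near: y.
by apply: filterS => y hy i; apply: hy; rewrite mem_enum.
Unshelve. all: by end_near. Qed.

Lemma P1_of_weak_nbhs : (forall C : set X, convex_combination_of_slices C ->
    forall x, C x -> nbhs (x : weak_topology X) [set y | rnorm y <= 1 -> C y]) ->
  P1 X.
Proof.
move=> H C ccC x Cx; have := H C ccC x Cx.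
rewrite nbhsE => -[U [oU Ux] UC].
have bx : rnorm x <= 1.
  case: ccC => n [lam [f [e [lam0 lam1 _ _ eC]]]]; move: Cx; rewrite eC => -[z hz <-].
  apply: (le_trans (ler_rnorm_sum _ _ _)); rewrite -[leRHS]lam1.
  apply: ler_sum => i _; rewrite rnormZE cabs_ge0_real; last exact: ltW.
  rewrite -[leRHS]mulr1.
  by apply: ler_wpM2l; [exact: ltW|case: (hz i) => /ball_rnorm].
exists (@closed_unit_ball R X `&` U); split.
- by exists U.
- by split => //; apply/ball_rnorm.
- by move=> y [/ball_rnorm y1 /UC]; exact.
Qed.

End Weak.

Section NotP1bar.
Variables (R : realType) (X : completeNormedModType R[i]).
Local Open Scope complex_scope.

(** [p] attains the norm of [f], so [0 = (p - p) / 2] lies in the combination of two opposite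
    slices. Measured by [N], points of these slices are close to [p] and [- p], which cancel, so
    [N <= 1/4] on [C]. A weak neighbourhood of [0] contains some [y] with [N y > 1/4], out of reach
    of the norm closure since [N] is dominated by the norm. *)
Lemma not_P1bar (f : dual X) (p : X) (N : X -> R) :
  dual_norm f <= 1 -> rnorm p <= 1 -> f p = 1 ->
  (forall x y, N (x + y) <= N x + N y) ->
  (forall (r : R) x, N (r%:C *: x) = `|r| * N x) ->
  (forall x, N x <= rnorm x) ->
  (forall u, rnorm u <= 1 -> N (u - p) <= 1 / 8 + 4 * (1 - complex.Re (f u))) ->
  (forall n (g : 'I_n -> dual X), exists y,
    [/\ rnorm y <= 1, forall l, g l y = 0 & 1 / 4 < N y]) ->
  ~ P1bar X.
Proof.
move=> f1 p1 fp ND NZ Nle Nf Hg H.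
have NN x : N (- x) = N x.
  have := NZ (-1) x; rewrite normrN1 mul1r => <-; congr N.
  by rewrite rmorphN1 scaleN1r.
have lN a (x y : X) : - f (a *: x + y) = a * (- f x) + (- f y).
  by rewrite dualD dualZ opprD mulrN.
have [|F FE] := @dual_of R X (fun x => - f x) 1 lN.
  move=> x; rewrite cabsN; apply: le_trans (dual_norm_bound f x) _.
  by rewrite ler_wpM2r// rnorm_ge0.
have fE : dual_norm f = 1.
  apply/eqP; rewrite eq_le f1/=; have := @dual_norm_ub _ _ f p p1.
  by rewrite fp cabs1.
have FE1 : dual_norm F = 1.
  apply/eqP; rewrite eq_le; apply/andP; split; last first.
    have := @dual_norm_ub _ _ F p p1; by rewrite FE fp cabsN cabs1.
  apply: dual_norm_le => x x1; rewrite FE cabsN -fE.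
  exact: dual_norm_ub.
pose fs (i : 'I_2) := if i == ord0 then f else F.
(* With width [1/32] the hypothesis gives [N (u - p) <= 1/8 + 4/32 = 1/4] on a slice. *)
pose C : set X := [set \sum_(i < 2) (1/2)%:C *: x i
  | x in [set x : 'I_2 -> X | forall i, slice (fs i) (1/32) (x i)]].
have ccC : convex_combination_of_slices C.
  exists 2%N, (fun=> 1/2), fs, (fun=> 1/32); split => //.
  - by rewrite !big_ord_recl big_ord0; lra.
  - by move=> i; rewrite /fs; case: ifP => _; rewrite ?fE ?FE1.
have C0 : C 0.
  exists (fun i => if i == ord0 then p else - p).
    move=> i; rewrite /fs /=; case: ifP => _; split.
    - exact/ball_rnorm.
    - rewrite /= fp fE /=; lra.
    - by apply/ball_rnorm; rewrite rnormN.
    - rewrite /= FE dualN fp FE1 opprK/=; lra.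
  by rewrite !big_ord_recl big_ord0 /= addr0 -scalerDr subrr scaler0.
have [W [[U [oU WE]] W0 WC]] := H C ccC 0 C0.
have U0 : nbhs (0 : weak_topology X) U.
  by apply: open_nbhs_nbhs; split => //; move: W0; rewrite WE => -[].
have [n [g hg]] := weak_nbhs_fiber U0.
have [y [y1 gy Ny]] := Hg n g.
have /WC Cy : W y.
  rewrite WE; split; first exact/ball_rnorm.
  by apply: hg => l; rewrite gy linear0.
have NC c : C c -> N c <= 1/4.
  move=> [x hx <-]; rewrite !big_ord_recl big_ord0 addr0.
  set u := x ord0; set v := x _.
  have [/ball_rnorm u1] := hx ord0; rewrite -/u /fs/= fE => fu.
  have [/ball_rnorm v1] := hx (lift ord0 ord0); rewrite -/v /fs/= FE1 FE ReN => fv.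
  rewrite -scalerDr NZ.
  have -> : u + v = (u - p) + (v + p) by rewrite addrACA addNr addr0.
  have h1 := ND (u - p) (v + p).
  have h2 := Nf u u1.
  have := Nf (- v); rewrite rnormN => /(_ v1); rewrite -opprD NN dualN ReN => h3.
  rewrite ger0_norm; last lra.
  lra.
have d0 : 0 < N y - 1/4 by lra.
have [c [Cc yc]] : exists c, C c /\ rnorm (y - c) < N y - 1/4.
  have : nbhs y [set c | rnorm (y - c) < N y - 1/4].
    by have /near_rdist/(_ _ d0) : (fun z : X => z) @ y --> y by exact: cvg_id.
  by move=> /Cy[c [Cc yc]]; exists c.
have := ND (y - c) c; rewrite subrK => h.
have := Nle (y - c); have := NC c Cc; lra.
Qed.

End NotP1bar.

(** * Contractions on a Hilbert space *)

Section HilbertFacts.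
Variables (R : realType) (H : hilbertType R).
Implicit Types x y z : H.
Local Open Scope complex_scope.

Lemma hdotDl x y z : hdot (x + y) z = hdot x z + hdot y z.
Proof. exact: linearDl. Qed.

Lemma hdotZl (a : R[i]) x y : hdot (a *: x) y = a * hdot x y.
Proof. exact: linearZl_LR. Qed.

Lemma hdot_conj x y : hdot x y = (hdot y x)^*.
Proof. by rewrite (hermitian_subproof x y) expr0 mul1r. Qed.

Lemma hdotNl x y : hdot (- x) y = - hdot x y.
Proof. by rewrite -scaleN1r hdotZl mulN1r. Qed.

Lemma hdotBl x y z : hdot (x - y) z = hdot x z - hdot y z.
Proof. by rewrite hdotDl hdotNl. Qed.

Lemma hdot0l x : hdot 0 x = 0.
Proof. by rewrite -(scale0r (0 : H)) hdotZl mul0r. Qed.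

Lemma hdot0r x : hdot x 0 = 0.
Proof. exact: linear0r. Qed.

Lemma hdot_suml (I : Type) (s : seq I) (P : pred I) (F : I -> H) x :
  hdot (\sum_(i <- s | P i) F i) x = \sum_(i <- s | P i) hdot (F i) x.
Proof.
by apply: (big_morph (fun z => hdot z x)) => [y z|]; [exact: hdotDl|exact: hdot0l].
Qed.

Lemma hdotxx x : hdot x x = ((rnorm x) ^+ 2)%:C.
Proof. by rewrite -hdotE rmorphXn/= rnormE. Qed.

Definition rdot x y : R := complex.Re (hdot x y).

Lemma rdotC x y : rdot x y = rdot y x.
Proof. by rewrite /rdot hdot_conj Re_conj. Qed.

Lemma rdotDl x y z : rdot (x + y) z = rdot x z + rdot y z.
Proof. by rewrite /rdot hdotDl ReD. Qed.

Lemma rdotNl x y : rdot (- x) y = - rdot x y.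
Proof. by rewrite /rdot hdotNl ReN. Qed.

Lemma rdotDr x y z : rdot z (x + y) = rdot z x + rdot z y.
Proof. by rewrite rdotC rdotDl !(rdotC z). Qed.

Lemma rdotNr x y : rdot x (- y) = - rdot x y.
Proof. by rewrite rdotC rdotNl rdotC. Qed.

Lemma rdotZl (r : R) x y : rdot (r%:C *: x) y = r * rdot x y.
Proof. by rewrite /rdot hdotZl ReMr. Qed.

Lemma rdotZr (r : R) x y : rdot x (r%:C *: y) = r * rdot x y.
Proof. by rewrite rdotC rdotZl rdotC. Qed.

Lemma rdotxx x : rdot x x = rnorm x ^+ 2.
Proof. by rewrite /rdot hdotxx. Qed.

Definition rdotE := (rdotDl, rdotDr, rdotNl, rdotNr, rdotZl, rdotZr).

Lemma sqr_rnormD x y :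
  rnorm (x + y) ^+ 2 = rnorm x ^+ 2 + 2 * rdot x y + rnorm y ^+ 2.
Proof. by rewrite -!rdotxx !rdotE (rdotC y x); ring. Qed.

Lemma sqr_rnormB x y :
  rnorm (x - y) ^+ 2 = rnorm x ^+ 2 - 2 * rdot x y + rnorm y ^+ 2.
Proof. by rewrite -!rdotxx !rdotE (rdotC y x); ring. Qed.

Lemma rdot_le x y : rdot x y <= rnorm x * rnorm y.
Proof.
have [->|x0] := eqVneq x 0; first by rewrite /rdot hdot0l rnorm0 mul0r.
have [->|y0] := eqVneq y 0; first by rewrite /rdot hdot0r rnorm0 mulr0.
have nx : 0 < rnorm x by rewrite rnorm_gt0.
have ny : 0 < rnorm y by rewrite rnorm_gt0.
have : 0 <= rnorm ((rnorm y)%:C *: x - (rnorm x)%:C *: y) ^+ 2 by exact: sqr_ge0.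
rewrite sqr_rnormB !rnormZE !cabs_ge0_real ?rnorm_ge0// !rdotE => h.
have : 0 <= 2 * (rnorm x * rnorm y) * (rnorm x * rnorm y - rdot x y) by nra.
by rewrite pmulr_rge0 ?mulr_gt0// subr_ge0.
Qed.

Lemma CauchySchwarz x y : cabs (hdot x y) <= rnorm x * rnorm y.
Proof.
have [w w1 wz] := rotate_cabs (hdot x y).
have := rdot_le (w *: x) y; rewrite /rdot hdotZl wz rnormZE w1 mul1r; exact.
Qed.

Lemma sqr_rnorm_convex (s : R) x y : 0 <= s -> s <= 1 ->
  rnorm ((1 - s)%:C *: x + s%:C *: y) ^+ 2
  <= (1 - s) * rnorm x ^+ 2 + s * rnorm y ^+ 2.
Proof.
move=> s0 s1; rewrite sqr_rnormD !rnormZE !cabs_ge0_real ?subr_ge0// !rdotE.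
have : 0 <= s * (1 - s) * rnorm (x - y) ^+ 2.
  by rewrite mulr_ge0 ?sqr_ge0// mulr_ge0// subr_ge0.
by rewrite sqr_rnormB; nra.
Qed.

End HilbertFacts.

Section Contraction.
Variables (R : realType) (H : hilbertType R) (x xs : {linear H -> H}).
Hypothesis adj : forall u v, rdot (x u) v = rdot u (xs v).
Hypothesis cx : forall u, rnorm (x u) <= rnorm u.
Hypothesis cxs : forall u, rnorm (xs u) <= rnorm u.
Local Open Scope complex_scope.

Let t u := xs (x u).
(** The [j]-th moment of the spectral measure of [t] at [u], carried by [[0, 1]]. Nonnegativity,
    decrease and convexity of this sequence stand in for the functional calculus of [t]. *)
Let A j u := rdot (iter j t u) u.

Lemma adjC u v : rdot (xs u) v = rdot u (x v).
Proof. by rewrite rdotC -adj rdotC. Qed.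

Lemma iter_tB j u v : iter j t (u - v) = iter j t u - iter j t v.
Proof. by elim: j => //= j ->; rewrite /t !linearB. Qed.

Let t_adj u v : rdot (t u) v = rdot u (t v).
Proof. by rewrite /t adjC adj. Qed.

Lemma iter_t_adj j u v : rdot (iter j t u) v = rdot u (iter j t v).
Proof. by elim: j u v => //= j IH u v; rewrite t_adj IH -iterSr. Qed.

Let A_even i u : A (i + i) u = rnorm (iter i t u) ^+ 2.
Proof. by rewrite /A iterD iter_t_adj rdotxx. Qed.

Let A_odd i u : A (i + i).+1 u = rnorm (x (iter i t u)) ^+ 2.
Proof. by rewrite /A iterS iterD -iterS iterSr iter_t_adj adjC rdotxx. Qed.

Let parity j : (exists i, j = (i + i)%N) \/ (exists i, j = (i + i).+1).
Proof.
rewrite -(odd_double_half j) -addnn; case: (odd j); [right|left].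
  by exists j./2.
by exists j./2.
Qed.

Let A_ge0 j u : 0 <= A j u.
Proof. by case: (parity j) => -[i ->]; rewrite ?A_even ?A_odd sqr_ge0. Qed.

Let A_noninc j u : A j.+1 u <= A j u.
Proof.
case: (parity j) => -[i ->]; rewrite ?A_odd ?A_even.
  by rewrite ler_pXn2r ?nnegrE ?rnorm_ge0.
have -> : (i + i).+2 = (i.+1 + i.+1)%N by rewrite addSn addnS.
by rewrite A_even/= ler_pXn2r ?nnegrE ?rnorm_ge0//; exact: cxs.
Qed.

(** The second difference is [<t^j (1 - t)^2 u, u>], that is, [A j] at [u - t u]. *)
Let A_convex j u : 0 <= A j u - 2 * A j.+1 u + A j.+2 u.
Proof.
have := A_ge0 j (u - t u).
rewrite {1}/A iter_tB !rdotE -iterSr.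
rewrite -[rdot (iter j t u) (t u)]t_adj -[rdot (iter j.+1 t u) (t u)]t_adj.
rewrite -!iterS -!/(A _ _); lra.
Qed.

Let b j u := A j u - A j.+1 u.

Let b_ge0 j u : 0 <= b j u.
Proof. by rewrite subr_ge0. Qed.

Let b_noninc j k u : (j <= k)%N -> b k u <= b j u.
Proof.
elim: k => [|k IH]; first by rewrite leqn0 => /eqP ->.
rewrite leq_eqVlt => /predU1P[->//|]; rewrite ltnS => /IH; apply: le_trans.
by have := A_convex k u; rewrite /b; lra.
Qed.

Let A_le j k u : (j <= k)%N -> A k u <= A j u.
Proof.
elim: k => [|k IH]; first by rewrite leqn0 => /eqP ->.
rewrite leq_eqVlt => /predU1P[->//|]; rewrite ltnS => /IH; apply: le_trans.
exact: A_noninc.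
Qed.

Let A_sum m u : A 0 u - A m u = \sum_(j < m) b j u.
Proof.
elim: m => [|m IH]; first by rewrite big_ord0 subrr.
by rewrite big_ord_recr/= -IH /b; ring.
Qed.

Let A0E u : A 0 u = rnorm u ^+ 2.
Proof. by rewrite /A/= rdotxx. Qed.

(** The operator [1 - t^m]: close to the identity except where [t] is so near [1] that [t^m] is not
    small. *)
Definition near_unit_cut m u := u - iter m t u.

Let sqr_cut m u :
  rnorm (near_unit_cut m u) ^+ 2 = A 0 u - 2 * A m u + A (m + m) u.
Proof. by rewrite /near_unit_cut sqr_rnormB A_even A0E rdotC -/(A m u). Qed.

Lemma near_unit_cut_le m u : rnorm (near_unit_cut m u) <= rnorm u.
Proof.
rewrite -(@ler_pXn2r _ 2) ?nnegrE ?rnorm_ge0// sqr_cut -A0E.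
have := A_le u (leq_addr m m); have := A_ge0 m u; lra.
Qed.

Lemma near_unit_cut_adj m u v :
  rdot (near_unit_cut m u) v = rdot u (near_unit_cut m v).
Proof. by rewrite /near_unit_cut !rdotE iter_t_adj. Qed.

(** On the spectrum [(1 - t^m)^2 <= 1 - t^m <= m (1 - t)]; the second inequality sums the
    nonincreasing differences [b j]. *)
Lemma sqr_cut_le m u :
  rnorm (near_unit_cut m u) ^+ 2 <= m%:R * (rnorm u ^+ 2 - rnorm (x u) ^+ 2).
Proof.
rewrite sqr_cut; apply: (@le_trans _ _ (A 0 u - A m u)).
  by have := A_le u (leq_addr m m); have := A_ge0 m u; lra.
rewrite A_sum -A0E -(A_odd 0) -/(b 0 u) mulr_natl -[X in _ *+ X]card_ord -sumr_const.
by apply: ler_sum => j _; exact: b_noninc.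
Qed.

(** This is [(1 - t) (1 - t^m)^2 <= 1 - t], which in moments reads
    [b 0 - 2 b m + b (m + m) <= b 0]. *)
Lemma sqr_cut_defect m u :
  rnorm (near_unit_cut m u) ^+ 2 - rnorm (x (near_unit_cut m u)) ^+ 2
  <= rnorm u ^+ 2 - rnorm (x u) ^+ 2.
Proof.
have -> : rnorm (x (near_unit_cut m u)) ^+ 2 = A 1 u - 2 * A m.+1 u + A (m + m).+1 u.
  rewrite /near_unit_cut linearB sqr_rnormB -A_odd -(A_odd 0)/=.
  by congr (_ - _ * _ + _); rewrite adj rdotC.
have := @b_noninc m (m + m)%N u (leq_addr _ _); have := b_ge0 m u.
rewrite sqr_cut /b A0E -(A_odd 0) addn0; lra.
Qed.

(* [t = x^* x] is close to [1] only where [d] is negligible, since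
   [lam d^* d <= 1 - t] and [(2m+1) t^(2m) (1 - t) <= 1]. *)
Lemma defect_iter (d : H -> H) (lam : R) m u : 0 <= lam ->
  (forall v, lam * rnorm (d v) ^+ 2 <= rnorm v ^+ 2 - rnorm (x v) ^+ 2) ->
  lam * (m + m).+1%:R * rnorm (d (iter m t u)) ^+ 2 <= rnorm u ^+ 2.
Proof.
move=> lam0 hd; have := hd (iter m t u).
rewrite -A_even -A_odd -/(b _ _) => h.
rewrite mulrAC mulrC; apply: (@le_trans _ _ ((m + m).+1%:R * b (m + m) u)).
  by rewrite ler_wpM2l// ler0n.
rewrite -A0E; apply: (@le_trans _ _ (A 0 u - A (m + m).+1 u)); last first.
  by rewrite gerBl.
rewrite A_sum mulr_natl -[X in _ *+ X]card_ord -sumr_const.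
by apply: ler_sum => j _; apply: b_noninc; rewrite -ltnS.
Qed.

End Contraction.

Section Perturbation.
Variables (R : realType) (H : hilbertType R) (x xs : {linear H -> H}).
Hypothesis adj : forall u v, rdot (x u) v = rdot u (xs v).
Hypothesis cx : forall u, rnorm (x u) <= rnorm u.
Hypothesis cxs : forall u, rnorm (xs u) <= rnorm u.
Local Open Scope complex_scope.

Let x_iter m u : x (iter m (fun v => xs (x v)) u) = iter m (fun v => x (xs v)) (x u).
Proof. by elim: m => //= m ->. Qed.

(* With [t = x^* x], [h = 1 - t^m] and [eta = h u], the left-hand side squared
   is at most [|x u|^2 + |x eta + d eta|^2 - |x eta|^2]; as [x0 + d] shrinks the
   defect [|eta|^2 - |x0 eta|^2] by the factor [1 - s], the bounds
   [h (1 - t) h <= 1 - t] and [h^2 <= m (1 - t)] conclude. *)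
Lemma cut_perturbation_contraction (x0 xl d : H -> H) (s delta : R) m u :
  0 <= s -> s <= 1 -> 0 <= delta -> delta <= 1 -> 6 * delta * m%:R <= s ->
  (forall v, rnorm (x0 v) <= rnorm v) -> (forall v, rnorm (xl v) <= rnorm v) ->
  (forall v, rnorm (x v - x0 v) <= delta * rnorm v) ->
  (forall v, d v = (1 - s)%:C *: (xl v - x0 v)) ->
  rnorm (x u + near_unit_cut xs x m (d (near_unit_cut x xs m u))) <= rnorm u.
Proof.
move=> s0 s1 del0 del1 hm c0 cl x_x0 dE.
set eta := near_unit_cut x xs m u.
have adj' v w : rdot (xs v) w = rdot v (x w) by exact: adjC.
(* [x_iter] moves the outer cut-off across [x], so that the cross term of the square involves only
   [eta]. *)
have gx : rdot (x u) (near_unit_cut xs x m (d eta)) = rdot (x eta) (d eta).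
  rewrite -(near_unit_cut_adj adj'); congr rdot.
  by rewrite /eta /near_unit_cut linearB x_iter.
have gd : rnorm (near_unit_cut xs x m (d eta)) ^+ 2 <= rnorm (d eta) ^+ 2.
  by rewrite ler_pXn2r ?nnegrE ?rnorm_ge0//; exact: near_unit_cut_le.
have h1 := sqr_cut_le adj cx cxs m u; rewrite -/eta in h1.
have h2 := sqr_cut_defect adj cx cxs m u; rewrite -/eta in h2.
set e := rnorm eta in h1 h2.
have e0 : 0 <= e by exact: rnorm_ge0.
pose v := (1 - s)%:C *: xl eta + s%:C *: x0 eta.
have vE : x0 eta + d eta = v.
  have sC : s%:C = 1 - (1 - s)%:C :> R[i].
    by rewrite rmorphB rmorph1 opprB addrCA subrr addr0.
  by rewrite dE /v [in RHS]sC scalerBl scale1r scalerBr addrCA.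
have clv := cl eta; have c0v := c0 eta; rewrite -/e in clv c0v.
have v2 : rnorm v ^+ 2 <= (1 - s) * e ^+ 2 + s * rnorm (x0 eta) ^+ 2.
  apply: (le_trans (sqr_rnorm_convex _ _ s0 s1)); rewrite lerD2r.
  by rewrite ler_wpM2l ?subr_ge0// ler_pXn2r ?nnegrE ?rnorm_ge0.
have x0e : rnorm (x0 eta) ^+ 2 <= e ^+ 2 by rewrite ler_pXn2r ?nnegrE ?rnorm_ge0.
have ve : rnorm v <= e.
  rewrite -(@ler_pXn2r _ 2) ?nnegrE ?rnorm_ge0//; apply: (le_trans v2); nra.
have hx := x_x0 eta; rewrite -/e in hx.
have a1 : rnorm (x eta + d eta) <= rnorm v + delta * e.
  have -> : x eta + d eta = v + (x eta - x0 eta).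
    by rewrite -vE [RHS]addrC addrA subrK.
  by apply: (le_trans (ler_rnormD _ _)); rewrite lerD2l.
have a2 : rnorm (x0 eta) <= rnorm (x eta) + delta * e.
  by apply: (le_trans (ler_rnorm_sub _ (x eta))); rewrite lerD2l rdistC.
have cxe := cx eta; rewrite -/e in cxe.
have nd : delta ^+ 2 * e ^+ 2 <= delta * e ^+ 2.
  by rewrite ler_wpM2r ?sqr_ge0// expr2 ler_piMl.
(* Each passage between [x] and [x0] at [eta] costs [3 delta e^2]; there are two, hence the constant
   [6] in the hypothesis. *)
have sq (a c : R) : 0 <= a -> 0 <= c -> a <= c + delta * e -> c <= e ->
    a ^+ 2 <= c ^+ 2 + 3 * delta * e ^+ 2.
  move=> a0 c0' ac ce; apply: (@le_trans _ _ ((c + delta * e) ^+ 2)).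
    by rewrite ler_pXn2r ?nnegrE ?addr_ge0 ?mulr_ge0.
  rewrite sqrrD exprMn -mulr_natl.
  have : c * (delta * e) <= e * (delta * e) by rewrite ler_wpM2r ?mulr_ge0.
  nra.
have b1 := sq _ _ (rnorm_ge0 _) (rnorm_ge0 _) a1 ve.
have b2 := sq _ _ (rnorm_ge0 _) (rnorm_ge0 _) a2 cxe.
rewrite -(@ler_pXn2r _ 2) ?nnegrE ?rnorm_ge0// sqr_rnormD gx.
move: b1; rewrite sqr_rnormD.
set p := rnorm u ^+ 2 in h1 h2 *; set q := rnorm (x u) ^+ 2 in h1 h2 *.
set xe := rnorm (x eta) ^+ 2 in h2 b2 *; set e2 := e ^+ 2 in h1 h2 v2 x0e b2 nd *.
move=> b1.
have e20 : 0 <= e2 by exact: sqr_ge0.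
have pq : 0 <= p - q.
  by rewrite subr_ge0 /p /q ler_pXn2r ?nnegrE ?rnorm_ge0.
have c1 : 6 * delta * e2 <= s * (p - q).
  apply: (@le_trans _ _ (6 * delta * (m%:R * (p - q)))).
    by rewrite ler_wpM2l// mulr_ge0.
  by rewrite mulrA ler_wpM2r.
have c2 : (1 - s) * (e2 - xe) <= (1 - s) * (p - q).
  by rewrite ler_wpM2l// subr_ge0.
have c3 : s * rnorm (x0 eta) ^+ 2 <= s * (xe + 3 * delta * e2) by rewrite ler_wpM2l.
have c4 : s * (3 * delta * e2) <= 3 * delta * e2.
  by rewrite ler_piMl// mulr_ge0// mulr_ge0.
move: b1 c1 c2 c3 c4 v2 gd; rewrite /xe; lra.
Qed.

End Perturbation.

(** * Compact C*-algebras and their irreducible representations *)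

Section RankOne.
Variables (R : realType) (H : hilbertType R).
Local Open Scope complex_scope.

Lemma rank_one_operator (u v : H) :
  exists2 T : {linear H -> H}, compact_operator T & forall w, T w = hdot w v *: u.
Proof.
have lT (a : R[i]) (x y : H) :
    hdot (a *: x + y) v *: u = a *: (hdot x v *: u) + hdot y v *: u.
  by rewrite hdotDl hdotZl scalerDl scalerA.
pose T : {linear H -> H} := HB.pack (fun w => hdot w v *: u)
  (GRing.isLinear.Build _ _ _ _ (fun w => hdot w v *: u) lT).
exists T => //; pose M := rnorm v.
(* The image of the ball lies in the image under [g] of a compact square, [a + i b] being the scalar
   [hdot w v]. *)
pose g (ab : R * R) : H := (ab.1%:C + 'i%C * ab.2%:C) *: u.
have cg : continuous g.
  move=> [a b]; apply/near_rdist => e e0; pose c := rnorm u + 1.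
  have c0 : 0 < c by have := rnorm_ge0 u; rewrite /c; lra.
  have e2 : 0 < e / 2 / c by rewrite !divr_gt0.
  exists ((ball a (e / 2 / c)), (ball b (e / 2 / c))) => /=.
    by split; exact: nbhsx_ballx.
  move=> [a' b'] [/= ha hb]; rewrite /g/= -scalerBl rnormZE.
  have -> : a%:C + 'i%C * b%:C - (a'%:C + 'i%C * b'%:C) = (a - a')%:C + 'i%C * (b - b')%:C :> R[i].
    by rewrite !rmorphB/=; ring.
  have : cabs ((a - a')%:C + 'i%C * (b - b')%:C) < e / c.
    apply: (le_lt_trans (cabs_le_ReIm _)).
    rewrite /= !mul0r !mul1r !subr0 !addr0 !add0r.
    have -> : e / c = e / 2 / c + e / 2 / c by field; rewrite gt_eqF.
    by apply: ltrD; move: ha hb; rewrite -!ball_normE.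
  rewrite ltr_pdivlMr// => h; apply: le_lt_trans h.
  by rewrite ler_wpM2l ?cabs_ge0// /c lerDl.
apply: (@precompact_subset _ _ (g @` (`[- M, M] `*` `[- M, M]))).
  move=> _ [w /ball_rnorm w1 <-].
  have hM : cabs (hdot w v) <= M.
    by apply: (le_trans (CauchySchwarz w v)); rewrite ler_piMl ?rnorm_ge0.
  exists (complex.Re (hdot w v), complex.Im (hdot w v)).
    by split; rewrite /= in_itv/= -ler_norml; apply: le_trans hM;
      [exact: normRe_le_cabs|exact: normIm_le_cabs].
  by rewrite /g/= -complexE.
have cK : compact (g @` (`[- M, M] `*` `[- M, M])).
  apply: continuous_compact; first exact: continuous_subspaceT.
  by apply: compact_setX; exact: segment_compact.
rewrite precompact_closed//; exact: compact_closed.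
Qed.

(** [operator_norm] is a real supremum, meaningful only for a bounded set; the compactness of [T]
    supplies the bound. *)
Lemma compact_operator_bound (T : {linear H -> H}) : compact_operator T ->
  forall w, rnorm (T w) <= operator_norm T * rnorm w.
Proof.
move=> cT; have ub : has_ubound [set rnorm (T x) | x in @closed_unit_ball R H].
  have [K TK [cK _]] := cT.
  have cn : continuous (@rnorm R H : H -> R) by exact: rnorm_continuous.
  have := continuous_compact (continuous_subspaceT cn) cK.
  move=> /compact_bounded[M [_ /(_ (M + 1))]].
  rewrite ltrDl ltr01 => /(_ isT) hM.
  exists (M + 1) => _ [x x1 <-]; apply: le_trans (ler_norm _) _; apply: hM.
  by exists (T x) => //; apply: TK; exists x.
move=> w; have [->|w0] := eqVneq w 0; first by rewrite linear0 !rnorm0 mulr0.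
have nw : 0 < rnorm w by rewrite rnorm_gt0.
have i0 : 0 <= (rnorm w)^-1 by rewrite invr_ge0 ltW.
rewrite -ler_pdivrMr// mulrC -[(rnorm w)^-1]cabs_ge0_real// -rnormZE -linearZ.
apply: ub_le_sup => //; exists ((rnorm w)^-1%:C *: w) => //.
by apply/ball_rnorm; rewrite rnormZE cabs_ge0_real// mulVf// gt_eqF.
Qed.

Lemma operator_norm_le (T : {linear H -> H}) M :
  (forall w, rnorm (T w) <= M * rnorm w) -> 0 <= M -> operator_norm T <= M.
Proof.
move=> hM M0; apply: ge_sup.
  by exists (rnorm (T 0)); exists 0 => //; apply/ball_rnorm; rewrite rnorm0.
move=> _ [x /ball_rnorm x1 <-]; apply: (le_trans (hM x)).
by rewrite ler_piMr.
Qed.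

End RankOne.

(* The representations of a compact C*-algebra on the Hilbert spaces of its
   summands; [spatial_trunc] and [spatial_c0] replace the c_0-sum. *)
Record spatial (R : realType) (A : cstarAlgType R) (I : choiceType)
    (H : I -> hilbertType R) (rho : forall i, A -> {linear H i -> H i}) : Prop :=
  Spatial {
  spatialL : forall i (l : R[i]) a b w, rho i (l *: a + b) w = l *: rho i a w + rho i b w;
  spatialM : forall i a b w, rho i (cmul a b) w = rho i a (rho i b w);
  spatial_adj : forall i a v w, hdot (rho i a v) w = hdot v (rho i (cstar a) w);
  spatial_bound : forall i a w, rnorm (rho i a w) <= rnorm a * rnorm w;
  spatial_norm : forall a (M : R), 0 <= M ->
    (forall i w, rnorm (rho i a w) <= M * rnorm w) -> rnorm a <= M;
  spatial_rank1 : forall i (u v : H i), exists a,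
    (forall w, rho i a w = hdot w v *: u) /\
    (forall j, j != i -> forall w, rho j a w = 0);
  spatial_trunc : forall a (J : set I), exists a',
    (forall i, J i -> forall w, rho i a' w = rho i a w) /\
    (forall i, ~ J i -> forall w, rho i a' w = 0);
  spatial_c0 : forall a (e : R), 0 < e -> exists2 J : set I, finite_set J &
    forall i, ~ J i -> forall w, rnorm (rho i a w) <= e * rnorm w }.

Section C0Sum.
Variables (R : realType) (A : cstarAlgType R) (I : choiceType).
Variables (X : I -> cstarAlgType R) (pi : A -> forall i, X i).
Hypothesis piL : forall (l : R[i]) (a b : A) i, pi (l *: a + b) i = l *: pi a i + pi b i.
Hypothesis pi_norm : forall a, rnorm a = sup (range (fun i => rnorm (pi a i))).
Hypothesis pi_range : forall x : forall i, X i,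
  (exists a, forall i, pi a i = x i) <->
  (forall e : R, 0 < e -> finite_set [set i | e <= rnorm (x i)]).

Lemma c0_sum_finite a (e : R) : 0 < e -> finite_set [set i | e <= rnorm (pi a i)].
Proof. exact: (proj1 (pi_range (pi a)) (ex_intro _ a (fun=> erefl))). Qed.

(** The supremum is over a bounded family: the finitely many coordinates of norm at least [1] are
    dominated by their sum. *)
Lemma c0_sum_ub a i : rnorm (pi a i) <= rnorm a.
Proof.
rewrite pi_norm; apply: ub_le_sup; last by exists i.
have /finite_seqP[s sE] := c0_sum_finite a ltr01.
exists (1 + \sum_(j <- s) rnorm (pi a j)) => _ [j _ <-].
have s0 : 0 <= \sum_(j <- s) rnorm (pi a j) by apply: sumr_ge0 => *; exact: rnorm_ge0.
have [j1|/ltW j1] := leP 1 (rnorm (pi a j)); last first.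
  by apply: (le_trans j1); rewrite lerDl.
have js : j \in s by have : [set` s] j by rewrite -sE.
apply: (@le_trans _ _ (\sum_(j <- s) rnorm (pi a j))); last by rewrite lerDr.
rewrite (big_rem j)//= lerDl; apply: sumr_ge0 => *; exact: rnorm_ge0.
Qed.

Lemma c0_sum_le a M : 0 <= M -> (forall i, rnorm (pi a i) <= M) -> rnorm a <= M.
Proof.
move=> M0 hM; rewrite pi_norm.
have [e|/set0P ne] := eqVneq (range (fun i => rnorm (pi a i))) set0.
  by rewrite e sup0.
by apply: ge_sup => // _ [k _ <-].
Qed.

End C0Sum.

Section CompactRep.
Variables (R : realType) (A : cstarAlgType R) (I : choiceType).
Variables (H : I -> hilbertType R) (X : I -> cstarAlgType R).
Hypothesis XH : forall i, is_compact_operator_algebra (H i) (X i).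
Hypothesis AX : is_c0_sum A X.
Local Open Scope complex_scope.

Lemma compact_spatial : exists rho : forall i, A -> {linear H i -> H i}, spatial rho.
Proof.
case: AX => pi [[piL piM piS] pi_norm pi_range].
pose th i := projT1 (cid (XH i)).
have thP i := projT2 (cid (XH i)).
have thL i l a b x : th i (l *: a + b) x = l *: th i a x + th i b x.
  by rewrite /th; case: (thP i) => -[h _ _] _ _ _; exact: h.
have thM i a b x : th i (cmul a b) x = th i a (th i b x).
  by rewrite /th; case: (thP i) => -[_ h _] _ _ _; exact: h.
have thS i a x y : hdot (th i a x) y = hdot x (th i (cstar a) y).
  by rewrite /th; case: (thP i) => -[_ _ h] _ _ _; exact: h.
have thN i a : rnorm a = operator_norm (th i a).
  by rewrite /th; case: (thP i) => _ h _ _; exact: h.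
have thC i a : compact_operator (th i a).
  by rewrite /th; case: (thP i) => _ _ h _; exact: h.
have thE i T : compact_operator T -> exists a, forall x, th i a x = T x.
  by rewrite /th; case: (thP i) => _ _ _ h; exact: h.
have th0 i x : th i 0 x = 0.
  by apply: (linear_at0 (f := fun a => th i a x)) => l a b; exact: thL.
have thB i a w : rnorm (th i a w) <= rnorm a * rnorm w.
  by rewrite thN; exact: compact_operator_bound.
exists (fun i a => th i (pi a i)); split.
- by move=> i l a b w; rewrite piL thL.
- by move=> i a b w; rewrite piM thM.
- by move=> i a v w; rewrite piS thS.
- move=> i a w; apply: (le_trans (thB _ _ _)); rewrite ler_wpM2r ?rnorm_ge0//.
  exact: (c0_sum_ub pi_norm pi_range).
- move=> a M M0 hM; apply: (c0_sum_le pi_norm M0) => i.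
  by rewrite (thN i); exact: operator_norm_le.
- move=> i u v; have [T cT TE] := rank_one_operator u v.
  have [b bE] := thE i T cT.
  pose x := dfwith (fun j => 0 : X j) i b.
  have [|a aE] := proj2 (pi_range x).
    move=> e e0; apply: (@sub_finite_set _ _ [set i]); last exact: finite_set1.
    move=> j /=; have [->//|ji] := eqVneq j i.
    by rewrite /x dfwithout ?rnorm0; [move/(lt_le_trans e0); rewrite ltxx|rewrite eq_sym].
  exists a; split=> [w|j ji w]; rewrite aE /x.
    by rewrite dfwithin bE TE.
  by rewrite dfwithout 1?eq_sym.
- move=> a J; pose x j := if asbool (J j) then pi a j else 0.
  have [|a' aE] := proj2 (pi_range x).
    move=> e e0; apply: sub_finite_set (c0_sum_finite pi_range a e0) => j /=.
    rewrite /x; case: asboolP => // _.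
    by rewrite rnorm0; move/(lt_le_trans e0); rewrite ltxx.
  exists a'; split => i Ji w; rewrite aE /x; case: asboolP => //.
- move=> a e e0; exists [set i | e <= rnorm (pi a i)]; first exact: c0_sum_finite.
  move=> i /= /negP; rewrite -ltNge => /ltW h w; apply: (le_trans (thB _ _ _)).
  by rewrite ler_wpM2r ?rnorm_ge0.
Qed.

End CompactRep.

(** More vectors than coordinates give a nonzero left kernel. The support is confined to [P] because
    [almost_unimodular_kernel] may move only the coordinates that are not yet unimodular. *)
Lemma linear_dependence (F : fieldType) (T : finType) (P : {set T}) (r : nat)
    (V : T -> 'I_r -> F) : (r < #|P|)%N ->
  exists c : T -> F, [/\ exists s, c s != 0, forall s, s \notin P -> c s = 0 &
    forall l, \sum_s c s * V s l = 0].
Proof.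
move=> rP; pose M : 'M[F]_(#|P|, r) := \matrix_(i, l) V (enum_val i) l.
have : kermx M != 0.
  rewrite -mxrank_eq0 mxrank_ker subn_eq0 -ltnNge.
  exact: leq_ltn_trans (rank_leq_col M) rP.
move=> /rowV0Pn[v /sub_kermxP vM v0].
pose c s := \sum_(i | enum_val i == s) v 0 i.
have cE i : c (enum_val i) = v 0 i.
  rewrite /c (bigD1 i)//= big1 ?addr0// => j /andP[/eqP/enum_val_inj -> ].
  by rewrite eqxx.
exists c; split.
- have [i vi] : exists i, v 0 i != 0.
    apply/existsP; apply: contraNT v0; rewrite negb_exists => /forallP h.
    by apply/eqP/rowP => i; rewrite mxE; apply/eqP; have := h i; rewrite negbK.
  by exists (enum_val i); rewrite cE.
- move=> s sP; rewrite /c big1// => i /eqP is_.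
  by move: sP; rewrite -is_ enum_valP.
- move=> l; have /rowP/(_ l) := vM; rewrite !mxE => vMl; rewrite -[RHS]vMl.
  rewrite (bigID (mem P))/= [X in _ + X]big1 ?addr0; last first.
    move=> s sP; rewrite /c big1 ?mul0r// => i /eqP is_.
    by move: sP; rewrite -is_ enum_valP.
  rewrite big_enum_val/=; apply: eq_bigr => i _.
  by rewrite cE mxE.
Qed.

(** * Orthonormal families and finite-dimensional summands *)

Section Orthonormal.
Variables (R : realType) (H : hilbertType R).
Local Open Scope complex_scope.

Definition orthonormal_family n (e : 'I_n -> H) :=
  forall a b, hdot (e a) (e b) = (a == b)%:R.

Definition orthonormal_basis n (e : 'I_n -> H) :=
  orthonormal_family e /\ forall w, w = \sum_a hdot w (e a) *: e a.

Lemma orthonormal_norm n (e : 'I_n -> H) a : orthonormal_family e -> rnorm (e a) = 1.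
Proof.
move=> oe; have := hdotxx (e a); rewrite oe eqxx => /(@complexI R) /esym /eqP.
by rewrite sqrf_eq1 => /orP[/eqP//|/eqP h]; have := rnorm_ge0 (e a); rewrite h; lra.
Qed.

Lemma orthonormal_free n (e : 'I_n -> H) (c : 'I_n -> R[i]) a :
  orthonormal_family e -> hdot (\sum_b c b *: e b) (e a) = c a.
Proof.
move=> oe; rewrite hdot_suml (bigD1 a)//= hdotZl oe eqxx mulr1 big1 ?addr0// => b ba.
by rewrite hdotZl oe (negbTE ba) mulr0.
Qed.

(** One Gram-Schmidt step: an orthonormal family that is not a basis leaves a nonzero residual [r]
    for some vector, and normalizing [r] extends the family. Finite families of every length are
    enough, so no infinite sequence is chosen. *)
Lemma orthonormal_dichotomy :
  (exists n (e : 'I_n -> H), orthonormal_basis e) \/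
  (forall n, exists e : 'I_n -> H, orthonormal_family e).
Proof.
have [h|h] := pselect (exists n (e : 'I_n -> H), orthonormal_basis e); [by left|right].
elim=> [|n [e oe]].
  by exists (fun=> 0) => -[].
have [w w0] : exists w, w - \sum_a hdot w (e a) *: e a != 0.
  apply: contrapT => hn; apply: h; exists n, e; split => // w.
  apply/eqP; rewrite -subr_eq0; apply/negPn/negP => hw; apply: hn; by exists w.
set r := w - _ in w0.
have re a : hdot r (e a) = 0 by rewrite /r hdotBl orthonormal_free// subrr.
have nr : 0 < rnorm r by rewrite rnorm_gt0.
pose r' := ((rnorm r)^-1)%:C *: r.
have r're a : hdot r' (e a) = 0 by rewrite hdotZl re mulr0.
have er' a : hdot (e a) r' = 0 by rewrite hdot_conj r're conjc0.
have r'1 : hdot r' r' = 1.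
  by rewrite hdotxx rnormZE cabs_ge0_real ?invr_ge0 ?rnorm_ge0// mulVf ?gt_eqF// expr1n.
exists (fun i => if unlift ord_max i is Some j then e j else r') => a b.
case: unliftP => [a' ->|->]; case: unliftP => [b' ->|->]; rewrite ?oe ?er' ?r're ?r'1 ?eqxx//.
- by rewrite (inj_eq lift_inj).
- by rewrite eq_sym (negbTE (neq_lift _ _)).
- by rewrite (negbTE (neq_lift _ _)).
Qed.

Lemma orthonormal_linear_le n (e : 'I_n -> H) (H' : hilbertType R)
    (T : {linear H -> H'}) (d : R) :
  orthonormal_basis e -> 0 <= d -> (forall a, rnorm (T (e a)) <= d) ->
  forall w, rnorm (T w) <= n%:R * d * rnorm w.
Proof.
move=> [oe eb] d0 hT w; rewrite {1}(eb w) linear_sum.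
apply: (le_trans (ler_rnorm_sum _ _ _)).
rewrite -mulrA mulr_natl -[X in _ *+ X]card_ord -sumr_const.
apply: ler_sum => a _; rewrite linearZ rnormZE mulrC; apply: ler_pM => //.
- exact: rnorm_ge0.
- exact: cabs_ge0.
- by apply: (le_trans (CauchySchwarz _ _)); rewrite (orthonormal_norm a oe) mulr1.
Qed.

Lemma orthonormal_entries_le n (e : 'I_n -> H) (w : H) (d : R) :
  orthonormal_basis e -> (forall a, cabs (hdot w (e a)) <= d) ->
  rnorm w <= n%:R * d.
Proof.
move=> [oe eb] hw; rewrite (eb w).
apply: (le_trans (ler_rnorm_sum _ _ _)).
rewrite mulr_natl -[X in _ *+ X]card_ord -sumr_const.
by apply: ler_sum => a _; rewrite rnormZE (orthonormal_norm a oe) mulr1.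
Qed.

(** An element is recovered from its matrix entries as a combination of the matrix units [E a b]. *)
Lemma compact_operator_algebra_finite_dimensional (X : cstarAlgType R) n (e : 'I_n -> H) :
  is_compact_operator_algebra H X -> orthonormal_basis e -> finite_dimensional X.
Proof.
move=> [th [[thL thM thS] thN thC thE]] [oe eb].
have E0 a b : exists x, forall w, th x w = hdot w (e b) *: e a.
  by have [T cT TE] := rank_one_operator (e a) (e b); have [x xE] := thE T cT;
    exists x => w; rewrite xE TE.
pose E a b := projT1 (cid (E0 a b)).
have EE a b w : th (E a b) w = hdot w (e b) *: e a by exact: (projT2 (cid (E0 a b))).
have th0 w : th 0 w = 0.
  by apply: (linear_at0 (f := fun a => th a w)) => l a b; exact: thL.
have thD x y w : th (x + y) w = th x w + th y w.
  by have := thL 1 x y w; rewrite !scale1r.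
have thZ l x w : th (l *: x) w = l *: th x w.
  by have := thL l x 0 w; rewrite th0 !addr0.
exists #|{: 'I_n * 'I_n}|, (fun i => E (enum_val i).1 (enum_val i).2) => x.
exists (fun i => hdot (th x (e (enum_val i).2)) (e (enum_val i).1)).
apply/eqP; rewrite -subr_eq0; apply/eqP/rnorm0_eq0; apply/eqP.
rewrite eq_le rnorm_ge0 andbT thN; apply: operator_norm_le => // w.
rewrite mul0r -scaleN1r addrC thL.
have -> : th (\sum_(i < #|{: 'I_n * 'I_n}|) hdot (th x (e (enum_val i).2)) (e (enum_val i).1)
   *: E (enum_val i).1 (enum_val i).2) w =
   \sum_(p : 'I_n * 'I_n) (hdot (th x (e p.2)) (e p.1) * hdot w (e p.2)) *: e p.1.
  rewrite (big_morph (fun y => th y w) (fun y z => thD y z w) (th0 w)).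
  rewrite -(big_enum_val (fun p => th (hdot (th x (e p.2)) (e p.1) *: E p.1 p.2) w))/=.
  by apply: eq_bigr => p _; rewrite thZ EE scalerA.
rewrite -(pair_bigA _ (fun a b => (hdot (th x (e b)) (e a) * hdot w (e b)) *: e a))/=.
have -> : th x w = \sum_a \sum_b (hdot (th x (e b)) (e a) * hdot w (e b)) *: e a.
  rewrite exchange_big/= {1}(eb w) linear_sum; apply: eq_bigr => b _.
  rewrite linearZ/= {1}(eb (th x (e b))) scaler_sumr; apply: eq_bigr => a _.
  by rewrite scalerA mulrC.
by rewrite scaleN1r addNr rnorm0.
Qed.

End Orthonormal.

Section SpatialFacts.
Variables (R : realType) (A : cstarAlgType R) (I : choiceType).
Variables (H : I -> hilbertType R) (rho : forall i, A -> {linear H i -> H i}).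
Hypothesis S : spatial rho.
Local Open Scope complex_scope.

Lemma spatial0 i w : rho i 0 w = 0.
Proof.
by apply: (linear_at0 (f := fun a => rho i a w)) => l a b; exact: (spatialL S).
Qed.

Lemma spatialD i a b w : rho i (a + b) w = rho i a w + rho i b w.
Proof. by have := spatialL S 1 a b w; rewrite !scale1r. Qed.

Lemma spatialZ i l a w : rho i (l *: a) w = l *: rho i a w.
Proof. by have := spatialL S l a 0 w; rewrite spatial0 !addr0. Qed.

Lemma spatialB i a b w : rho i (a - b) w = rho i a w - rho i b w.
Proof. by rewrite spatialD -scaleN1r spatialZ scaleN1r. Qed.

Lemma spatial_sum i (J : Type) (s : seq J) (P : pred J) (F : J -> A) w :
  rho i (\sum_(j <- s | P j) F j) w = \sum_(j <- s | P j) rho i (F j) w.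
Proof.
apply: (big_morph (fun a => rho i a w)); last exact: spatial0.
by move=> a b; exact: spatialD.
Qed.

Lemma spatial_inj a b : (forall i w, rho i a w = rho i b w) -> a = b.
Proof.
move=> h; apply/eqP; rewrite -subr_eq0; apply/eqP/rnorm0_eq0/eqP.
rewrite eq_le rnorm_ge0 andbT; apply: (spatial_norm S) => // i w.
by rewrite spatialB h subrr rnorm0 mul0r.
Qed.

Lemma spatial_rank1_norm i (u v : H i) a :
  (forall w, rho i a w = hdot w v *: u) ->
  (forall j, j != i -> forall w, rho j a w = 0) ->
  rnorm a <= rnorm u * rnorm v.
Proof.
move=> ai aj; have uv : 0 <= rnorm u * rnorm v by rewrite mulr_ge0 ?rnorm_ge0.
apply: (spatial_norm S) => // j w.
have [E|ji] := eqVneq j i; last by rewrite aj// rnorm0 mulr_ge0 ?rnorm_ge0.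
case: _ / (esym E) w => w; rewrite ai rnormZE mulrC -mulrA ler_wpM2l ?rnorm_ge0//.
by rewrite mulrC; exact: CauchySchwarz.
Qed.

(* The summand [K(H i)] embeds in any summand of another decomposition of [A]
   in which one of its rank one projections does not vanish. *)
Lemma finite_dimensional_orthonormal_basis : c0_sum_of_finite_dimensional A ->
  forall i, exists n (e : 'I_n -> H i), orthonormal_basis e.
Proof.
move=> [I' [Y [fY [pi [[piL piM piS] pi_norm pi_range]]]]] i.
case: (orthonormal_dichotomy (H i)) => // hinf; exfalso.
have pi0 j : pi 0 j = 0.
  by apply: (linear_at0 (f := fun a => pi a j)) => l a b; exact: piL.
have piD a b j : pi (a + b) j = pi a j + pi b j.
  by have := piL 1 a b j; rewrite !scale1r.
have piZ l a j : pi (l *: a) j = l *: pi a j.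
  by have := piL l a 0 j; rewrite pi0 !addr0.
have [e1 oe1] := hinf 1%N; set e := e1 ord0.
have ee : hdot e e = 1 by rewrite oe1.
have [p [pE pE0]] := spatial_rank1 S e e.
have [j pj] : exists j, pi p j != 0.
  apply: contrapT => hn; have p0 : p = 0.
    apply/rnorm0_eq0/eqP; rewrite eq_le rnorm_ge0 andbT.
    rewrite pi_norm; have [E|/set0P ne] := eqVneq (range (fun i => rnorm (pi p i))) set0.
      by rewrite E sup0.
    apply: ge_sup => // _ [k _ <-].
    suff -> : pi p k = 0 by rewrite rnorm0.
    by apply/eqP/negPn/negP => h; apply: hn; exists k.
  have := pE e; rewrite p0 spatial0 ee scale1r => e0.
  by move: ee; rewrite -e0 hdot0l => /esym/eqP; rewrite oner_eq0.
have [n [v vspan]] := fY j.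
have [u ou] := hinf n.+1.
have ha s : exists a, (forall w, rho i a w = hdot w e *: u s) /\
    (forall j, j != i -> forall w, rho j a w = 0).
  exact: (spatial_rank1 S).
pose a s := projT1 (cid (ha s)).
have aE s w : rho i (a s) w = hdot w e *: u s by have [] := projT2 (cid (ha s)).
have aE0 s k : k != i -> forall w, rho k (a s) w = 0.
  by have [_] := projT2 (cid (ha s)); exact.
pose V s := projT1 (cid (vspan (pi (a s) j))).
have VE s : pi (a s) j = \sum_l V s l *: v l by exact: (projT2 (cid (vspan _))).
(* The [n.+1] rank one operators [a s], with orthonormal ranges, become dependent in [X]-coordinate
   [j], spanned by [n] vectors: a nontrivial combination [b] of them vanishes there. *)
have [|c [[s0 cs0] _ cV]] := @linear_dependence _ 'I_n.+1 [set: 'I_n.+1] n V.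
  by rewrite cardsT card_ord.
pose b := \sum_s c s *: a s.
have bj : pi b j = 0.
  rewrite /b (big_morph (fun y => pi y j) (fun y z => piD y z j) (pi0 j)).
  under eq_bigr do rewrite piZ VE scaler_sumr.
  rewrite exchange_big/= big1// => l _.
  under eq_bigr do rewrite scalerA.
  by rewrite -scaler_suml cV scale0r.
pose w := \sum_s c s *: u s.
have bE z : rho i b z = hdot z e *: w.
  rewrite spatial_sum /w scaler_sumr; apply: eq_bigr => s _.
  by rewrite spatialZ aE !scalerA mulrC.
have bE0 k : k != i -> forall z, rho k b z = 0.
  by move=> ki z; rewrite spatial_sum big1// => s _; rewrite spatialZ aE0// scaler0.
have w0 : hdot w w != 0.
  rewrite hdotxx; apply/negP => /eqP/(@complexI R)/eqP; rewrite sqrf_eq0 => /eqP/rnorm0_eq0 w0.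
  by move: cs0; rewrite -(orthonormal_free c s0 ou) -/w w0 hdot0l eqxx.
(* [cmul q b] is a nonzero multiple of [p], so [pi b j = 0] forces [pi p j = 0], against the choice
   of [j]. *)
have [q [qE qE0]] := spatial_rank1 S e w.
have qb : cmul q b = hdot w w *: p.
  apply: spatial_inj => k z; rewrite (spatialM S) spatialZ.
  have [E|ki] := eqVneq k i; last by rewrite bE0// linear0 pE0// scaler0.
  case: _ / (esym E) z => z; by rewrite bE linearZ/= qE pE !scalerA mulrC.
have := piM q b j; rewrite qb piZ bj => /eqP.
have -> : cmul (pi q j) 0 = 0.
  by have := cmulZr 0 (pi q j) 0; rewrite !scale0r.
by rewrite scaler_eq0 (negbTE w0) (negbTE pj).
Qed.

End SpatialFacts.

(** * Functionals on [C0 K A] for [K] scattered *)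

(** If [Q L] failed, the sets whose complement in [L] satisfies [Q] would form a proper filter; a
    cluster point of it in [L] has a neighbourhood satisfying [Q], whose complement belongs to the
    filter. *)
Lemma compact_induction (T : topologicalType) (L : set T) (Q : set T -> Prop) :
  compact L -> Q set0 -> (forall A B, A `<=` B -> Q B -> Q A) ->
  (forall A B, Q A -> Q B -> Q (A `|` B)) ->
  (forall x, L x -> exists2 V, nbhs x V & Q V) -> Q L.
Proof.
move=> cL Q0 Qsub QU Qloc; apply: contrapT => nQL.
pose F : set_system T := [set A | Q (L `\` A)].
have FF : ProperFilter F.
  apply: Build_ProperFilter_ex.
    move=> A FA; apply: contrapT => /forallNP nA; apply: nQL.
    by apply: Qsub FA => x Lx; split => //; exact: nA.
  split.
  - by rewrite /F/= setDT.
  - move=> A B FA FB; rewrite /F/= setDIr; exact: QU.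
  - by move=> A B AB FA; apply: Qsub FA; exact: setDS.
have FL : F L by rewrite /F/= setDv.
have [x [Lx clx]] := cL F FF FL.
have [V Vx QV] := Qloc x Lx.
have FV : F (~` V) by apply: Qsub QV => y [_ /contrapT].
by have [y []] := clx _ _ FV Vx.
Qed.

(** * Compactly supported bump functions *)

Section Urysohn.
Variables (R : realType) (K : topologicalType).
Hypothesis hK : hausdorff_space K.
Hypothesis lcK : locally_compact [set: K].

Lemma locally_compact_nbhs (x : K) : exists2 N, nbhs x N & compact N /\ closed N.
Proof.
have [N Nx cN] := lcK (x := x) I.
exists N => //; have := Nx; rewrite /within/=; apply: (@filterS _ (nbhs x)) => y; exact.
Qed.

Lemma compact_nbhs (L : set K) : compact L -> exists2 N, compact N /\ closed N & L `<=` interior N.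
Proof.
move=> cL; apply: (@compact_induction K L
  (fun S => exists2 N, compact N /\ closed N & S `<=` interior N)) => //.
- by exists set0 => //; split; [exact: compact0|exact: closed0].
- by move=> A B AB [N cN BN]; exists N => // x /AB /BN.
- move=> A B [N [cN clN] AN] [M [cM clM] BM]; exists (N `|` M).
    by split; [exact: compactU|exact: closedU].
  move=> x [/AN|/BM]; apply: filterS => y; by [left|right].
- move=> x _; have [N Nx cN] := locally_compact_nbhs x.
  by exists (interior N); [exact: nbhs_interior|exists N].
Qed.

(** Urysohn's lemma in the one-point compactification, which is compact Hausdorff and hence normal.
    Intersecting [U] with the interior of a compact neighbourhood of [L] confines the function to a
    compact set. *)
Lemma bump_function (L U : set K) : compact L -> open U -> L `<=` U ->
  exists phi : K -> R, [/\ continuous phi, forall k, 0 <= phi k <= 1,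
    forall k, L k -> phi k = 1, forall k, ~ U k -> phi k = 0 &
    exists2 M, compact M & forall k, phi k != 0 -> M k].
Proof.
move=> cL oU LU; have [N [cN clN] LN] := compact_nbhs cL.
pose U' := U `&` interior N.
have oU' : open U' by apply: openI => //; exact: open_interior.
pose opc := one_point_compactification K.
have hopc : hausdorff_space opc by exact: one_point_compactification_hausdorff.
have nopc : @normal_space opc.
  by apply: compact_normal => //; exact: one_point_compactification_compact.
pose A : set opc := ~` (Some @` U').
pose B : set opc := Some @` L.
have cB : closed B.
  apply: compact_closed => //; apply: continuous_compact cL.
  apply: continuous_subspaceT; exact: one_point_compactification_some_continuous.
have cA : closed A by apply: open_closedC; exact: one_point_compactification_open_some.
have AB0 : A `&` B = set0.
  rewrite -subset0 => y [/= Ay [x Lx xy]]; apply: Ay; exists x => //.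
  by split; [exact: LU|exact: LN].
have /(@uniform_separatorP _ R)[f [cf f01 f0 f1]] :=
  proj1 (@normal_separatorP R opc) nopc A B cA cB AB0.
pose phi k := Num.max 0 (2 * f (Some k) - 1).
have f_le1 o : f o <= 1.
  have /= := f01 (f o); rewrite in_itv/= => /(_ (ex_intro2 _ _ o I erefl)).
  by case/andP.
have phiU k : ~ U' k -> phi k = 0.
  move=> nU; have -> : phi k = Num.max 0 (2 * 0 - 1).
    congr (Num.max _ (_ * _ - _)); apply: f0; exists (Some k) => //= -[x Ux [xk]].
    by apply: nU; rewrite -xk.
  by rewrite mulr0 sub0r max_l// lerNl oppr0.
exists phi; split.
- move=> k; apply: (@continuous_max _ _ (cst 0 : K -> R^o) (fun k => 2 * f (Some k) - 1)).
    exact: cvg_cst.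
  apply: cvgB; last exact: cvg_cst.
  apply: cvgM; first exact: cvg_cst.
  apply: (@continuous_comp _ _ _ (Some : K -> opc) f); last exact: cf.
  exact: one_point_compactification_some_continuous.
- move=> k; rewrite le_max lexx/= ge_max ler01/=.
  have := f_le1 (Some k); lra.
- move=> k Lk; have -> : phi k = Num.max 0 (2 * 1 - 1).
    by congr (Num.max _ (_ * _ - _)); apply: f1; exists (Some k) => //; exists k.
  by rewrite max_r; lra.
- by move=> k nU; apply: phiU => -[].
- exists N => // k; apply: contraNP => nN; apply/eqP; apply: phiU => -[_ /interior_subset].
  exact: nN.
Qed.

End Urysohn.

Section C0Facts.
Variables (R : realType) (K : topologicalType) (A : completeNormedModType R[i]).
Implicit Types (x y : C0 K A) (phi : K -> R).
Local Open Scope complex_scope.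

Lemma C0D x y k : (x + y) k = x k + y k. Proof. by []. Qed.
Lemma C0Z (l : R[i]) x k : (l *: x) k = l *: x k. Proof. by []. Qed.
Lemma C0B x y k : (x - y) k = x k - y k. Proof. by []. Qed.
Lemma C00 k : (0 : C0 K A) k = 0. Proof. by []. Qed.

Lemma C0_sum (J : Type) (s : seq J) (P : pred J) (F : J -> C0 K A) k :
  (\sum_(j <- s | P j) F j) k = \sum_(j <- s | P j) F j k.
Proof. by apply: (big_morph (fun z : C0 K A => z k)). Qed.

Lemma C0_eval_le x k : rnorm (x k) <= rnorm x.
Proof. exact: C0_sup_norm_ub. Qed.

Lemma C0_rnorm_le x M : 0 <= M -> (forall k, rnorm (x k) <= M) -> rnorm x <= M.
Proof. exact: C0_sup_norm_le. Qed.

Lemma C0_ext x y : (forall k, x k = y k) -> x = y.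
Proof. by move=> h; apply/val_inj/funext. Qed.

Lemma mk_C0 (f : K -> A) : continuous f ->
  (forall e : R, 0 < e -> exists2 M, compact M & forall k, e <= rnorm (f k) -> M k) ->
  exists x : C0 K A, forall k, x k = f k.
Proof.
move=> cf vf; have fP : f \in @C0_pred R K A.
  apply/C0_predP; split => // e e0; have [M cM fM] := vf e e0.
  by apply: subclosed_compact cM _ => //; exact: closed_rnorm_ge.
by exists (MkC0 fP).
Qed.

Lemma continuous_scale phi (f : K -> A) : continuous phi -> continuous f ->
  continuous (fun k => (phi k)%:C *: f k).
Proof.
move=> cphi cf k; apply: cvgZ; last exact: cf.
have : (fun j => (phi j)%:C : R[i]^o) @ k --> ((phi k)%:C : R[i]^o).
  apply/near_rdist => e e0; have : \forall j \near k, `|phi k - phi j| < e.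
    exact: (cvgr_dist_lt _ _ (cphi k)).
  by apply: filterS => j; rewrite -[rnorm _]/(cabs _) -rmorphB cabs_real.
exact.
Qed.

Lemma C0_scale phi x : continuous phi -> (forall k, 0 <= phi k <= 1) ->
  exists y, forall k, y k = (phi k)%:C *: x k.
Proof.
move=> cphi phi01; apply: mk_C0.
  by apply: continuous_scale => //; exact: C0_continuous.
move=> e e0; exists [set k | e <= rnorm (x k)]; first exact: C0_vanishing.
move=> k /= /le_trans; apply; case/andP: (phi01 k) => h0 h1.
by rewrite rnormZE cabs_ge0_real// ler_piMl ?rnorm_ge0.
Qed.

Lemma C0_bump phi (f : K -> A) : continuous phi -> continuous f ->
  (exists2 M, compact M & forall k, phi k != 0 -> M k) ->
  exists y : C0 K A, forall k, y k = (phi k)%:C *: f k.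
Proof.
move=> cphi cf [M cM phiM]; apply: mk_C0; first exact: continuous_scale.
move=> e e0; exists M => // k; have [->|/phiM//] := eqVneq (phi k) 0.
by rewrite scale0r rnorm0 => /(lt_le_trans e0); rewrite ltxx.
Qed.

Lemma rnorm_scale01 (r : R) (a : A) : 0 <= r <= 1 -> rnorm (r%:C *: a) <= rnorm a.
Proof.
by move=> /andP[r0 r1]; rewrite rnormZE cabs_ge0_real// ler_piMl ?rnorm_ge0.
Qed.

End C0Facts.

Section Exhaustion.
Variables (R : realType) (X : completeNormedModType R[i]) (f : dual X).
Variables (T : Type) (supp van : T -> X -> Prop) (t0 : T).
Local Open Scope complex_scope.

(* Vectors with successively disjoint supports can be added up inside the unit
   ball, so that a bounded functional cannot exceed [e] on infinitely many. *)
Lemma exhaustion : supp t0 0 ->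
  (forall t (l : R[i]) x, van t x -> van t (l *: x)) ->
  (forall t x (e : R), van t x -> rnorm x <= 1 -> 0 < e ->
    exists t' x', rnorm (x - x') <= e /\
      forall z, supp t z -> rnorm z <= 1 -> supp t' (z + x') /\ rnorm (z + x') <= 1) ->
  forall e : R, 0 < e -> exists t, forall x, van t x -> cabs (f x) <= e * rnorm x.
Proof.
move=> s0 vanZ step e e0; apply: contrapT => /forallNP H.
have [M M0 fM] := dual_bounded f.
have H1 t : exists t' x', e / 2 <= complex.Re (f x') /\
    forall z, supp t z -> rnorm z <= 1 -> supp t' (z + x') /\ rnorm (z + x') <= 1.
  have /existsNP[x /not_implyP[vx /negP]] := H t; rewrite -ltNge => fx.
  have x0 : x != 0 by apply: contraTneq fx => ->; rewrite linear0 cabs0 rnorm0 mulr0 ltxx.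
  have nx : 0 < rnorm x by rewrite rnorm_gt0.
  have [w w1 wf] := rotate_cabs (f x).
  (* Normalizing and rotating makes [f x1] real and at least [e]; replacing [x1] by [x'] loses at
     most [e / 2]. *)
  pose x1 := ((rnorm x)^-1)%:C *: (w *: x).
  have x11 : rnorm x1 = 1.
    by rewrite !rnormZE w1 mul1r cabs_ge0_real ?invr_ge0 ?rnorm_ge0// mulVf// gt_eqF.
  have fx1 : e <= complex.Re (f x1).
    by rewrite !dualZ wf ReMr/= mulrC ler_pdivlMr// ltW.
  have eM : 0 < e / 2 / M by rewrite !divr_gt0.
  have [|t' [x' [xx' hx']]] := step t x1 (e / 2 / M) (vanZ _ _ _ (vanZ _ _ _ vx)) _ eM.
    by rewrite x11.
  exists t', x'; split => //.
  have : complex.Re (f (x1 - x')) <= e / 2.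
    apply: (le_trans (Re_le_cabs _)); apply: (le_trans (fM _)).
    by rewrite mulrC -ler_pdivlMr.
  by rewrite dualB ReB; lra.
have H2 n : exists t z, [/\ supp t z, rnorm z <= 1 & n%:R * (e / 2) <= complex.Re (f z)].
  elim: n => [|n [t [z [sz z1 fz]]]].
    by exists t0, 0; rewrite mul0r linear0 rnorm0 ler01 lexx.
  have [t' [x' [fx' hx']]] := H1 t; have [s1 n1] := hx' z sz z1.
  exists t', (z + x'); split => //.
  by rewrite dualD ReD -natr1 mulrDl mul1r lerD.
have [n hn] : exists n : nat, M / (e / 2) < n%:R.
  by exists (Num.truncn (M / (e / 2))).+1; apply: truncnS_gt.
have [t [z [_ z1 fz]]] := H2 n.
have : complex.Re (f z) <= M.
  apply: (le_trans (Re_le_cabs _)); apply: (le_trans (fM _)).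
  by rewrite ler_piMr// ltW.
by move: hn; rewrite ltr_pdivrMr ?divr_gt0//; lra.
Qed.

End Exhaustion.

Section Localization.
Variables (R : realType) (K : topologicalType) (A : completeNormedModType R[i]).
Hypothesis hK : hausdorff_space K.
Hypothesis lcK : locally_compact [set: K].
Implicit Types (x y : C0 K A).
Local Open Scope complex_scope.

(** The set where [x] does not vanish is open and rarely compact; up to an error [e] it is replaced
    by the compact set where the norm is at least [e / 2]. *)
Lemma C0_cutoff x (e : R) : 0 < e -> exists y M,
  [/\ compact M, forall k, M k -> x k != 0, forall k, y k != 0 -> M k,
      rnorm (x - y) <= e & forall k, rnorm (y k) <= rnorm (x k)].
Proof.
move=> e0; have e20 : 0 < e / 2 by rewrite divr_gt0.
have cn : continuous (fun k => rnorm (x k)).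
  move=> k; apply: (@continuous_comp _ _ _ x (@rnorm R A)).
    exact: C0_continuous.
  exact: rnorm_continuous.
have oU : open [set k | e / 2 < rnorm (x k)].
  exact: (open_comp (fun k _ => cn k) (@open_gt _ (e / 2))).
have [|phi [cphi phi01 phi1 phi0 _]] := bump_function R hK lcK (C0_vanishing (f := x) e0) oU.
  by move=> k /=; apply: lt_le_trans; lra.
have [y yE] := C0_scale x cphi phi01.
exists y, [set k | e / 2 <= rnorm (x k)]; split.
- exact: C0_vanishing.
- by move=> k /= h; rewrite -rnorm_gt0; exact: lt_le_trans h.
- move=> k; rewrite yE /= => h; rewrite leNgt; apply/negP => h2; move/eqP: h; apply.
  rewrite phi0 ?scale0r//= => /lt_trans/(_ h2); by rewrite ltxx.
- apply: C0_rnorm_le => [|k]; first exact: ltW.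
  rewrite C0B yE; have [ek|/ltW ke] := leP e (rnorm (x k)).
    by rewrite phi1// scale1r subrr rnorm0 ltW.
  apply: le_trans ke; case/andP: (phi01 k) => h0 h1.
  have -> : x k - (phi k)%:C *: x k = (1 - phi k)%:C *: x k.
    by rewrite rmorphB rmorph1 scalerBl scale1r.
  by apply: rnorm_scale01; rewrite subr_ge0 h1 lerBlDr lerDl.
- by move=> k; rewrite yE; exact: rnorm_scale01.
Qed.

Variable f : dual (C0 K A).

(** The measure of [f] on [U] is purely atomic, expressed through the action on functions so that no
    representing vector measure has to be built. *)
Definition concentrated (U : set K) := forall e : R, 0 < e ->
  exists2 F, finite_set F & forall x, (forall k, x k != 0 -> U k) ->
    (forall k, F k -> x k = 0) -> cabs (f x) <= e * rnorm x.

(** This is [exhaustion] with the compact subsets of [V] as states; [C0_cutoff] makes a function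
    living on [V] off the current compact set live on a compact set there. *)
Lemma inner_regular (V : set K) (e : R) : open V -> 0 < e ->
  exists L, [/\ compact L, L `<=` V & forall x, (forall k, x k != 0 -> V k /\ ~ L k) ->
    cabs (f x) <= e * rnorm x].
Proof.
move=> oV e0; pose T := {L : set K | compact L /\ L `<=` V}.
pose supp (t : T) x := forall k, x k != 0 -> sval t k.
pose van (t : T) x := forall k, x k != 0 -> V k /\ ~ sval t k.
have t0P : compact (set0 : set K) /\ set0 `<=` V by split => //; exact: compact0.
have [|||[L [cL LV]] hL] := @exhaustion R _ f T supp van
  (exist (fun L : set K => compact L /\ L `<=` V) set0 t0P) _ _ _ e e0.
- by move=> k; rewrite C00 eqxx.
- move=> t l x vx k; rewrite C0Z scaler_eq0 negb_or => /andP[_]; exact: vx.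
- move=> t x d vx x1 d0; have [y [M [cM Mx yM xy yx]]] := C0_cutoff x d0.
  have MV : compact (sval t `|` M) /\ (sval t `|` M) `<=` V.
    case: (svalP t) => ct tV; split; first exact: compactU.
    by rewrite subUset; split => // k /Mx /vx[].
  exists (exist (fun L : set K => compact L /\ L `<=` V) _ MV), y; split => // z sz z1.
  have disj k : z k = 0 \/ y k = 0.
    have [->|/sz tk] := eqVneq (z k) 0; [by left|right].
    by apply/eqP/negPn/negP => /yM /Mx /vx[].
  split.
    move=> k; rewrite C0D; case: (disj k) => ->; rewrite ?add0r ?addr0.
      by move/yM; right.
    by move/sz; left.
  apply: C0_rnorm_le => // k; rewrite C0D; case: (disj k) => ->; rewrite ?add0r ?addr0.
    apply: (le_trans (yx k)); apply: le_trans x1; exact: C0_eval_le.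
  by apply: le_trans z1; exact: C0_eval_le.
- by exists L; split.
Qed.

Lemma concentratedU (U V : set K) : open U -> open V ->
  concentrated U -> concentrated V -> concentrated (U `|` V).
Proof.
move=> oU oV cU cV e e0; have e3 : 0 < e / 3 by rewrite divr_gt0.
have [F fF hF] := cU _ e3; have [G fG hG] := cV _ e3.
exists (F `|` G); first by rewrite finite_setU.
move=> x xUV xFG; have [->|x0] := eqVneq x 0.
  by rewrite linear0 cabs0 rnorm0 mulr0.
have nx : 0 < rnorm x by rewrite rnorm_gt0.
have [C C_gt0 fC] := dual_bounded f.
have d0 : 0 < e / 3 * rnorm x / C by rewrite divr_gt0// mulr_gt0.
have [y [M [cM Mx yM xy yx]]] := C0_cutoff x d0.
have cMU : compact (M `\` U).
  apply: (subclosed_compact _ cM); last by move=> k [].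
  by apply: closedI; [exact: compact_closed|exact: open_closedC].
(* [phi] splits [y]: [y1] lives on [V], and [y - y1] on [U], since [phi] is [1] on the part of [M]
   outside [U]. *)
have [|phi [cphi phi01 phi1 phi0 _]] := bump_function R hK lcK cMU oV.
  by move=> k [/Mx /xUV[]].
have [y1 y1E] := C0_scale y cphi phi01.
have yE k : (y - y1) k = (1 - phi k)%:C *: y k.
  by rewrite C0B y1E rmorphB rmorph1 scalerBl scale1r.
have y0 k : x k = 0 -> y k = 0.
  move=> xk; apply: rnorm0_eq0; apply/eqP; rewrite eq_le rnorm_ge0 andbT.
  by rewrite (le_trans (yx k))// xk rnorm0.
have h1 : cabs (f (x - y)) <= e / 3 * rnorm x.
  by apply: (le_trans (fC _)); rewrite mulrC -ler_pdivlMr.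
have b1 : rnorm y1 <= rnorm x.
  apply: C0_rnorm_le => [|k]; first exact: rnorm_ge0.
  rewrite y1E; apply: (le_trans (rnorm_scale01 _ (phi01 k))).
  by apply: (le_trans (yx k)); exact: C0_eval_le.
have b2 : rnorm (y - y1) <= rnorm x.
  apply: C0_rnorm_le => [|k]; first exact: rnorm_ge0.
  rewrite yE; apply: (@le_trans _ _ (rnorm (y k))).
    by apply: rnorm_scale01; case/andP: (phi01 k) => p0 p1; rewrite subr_ge0 p1 lerBlDr lerDl.
  by apply: (le_trans (yx k)); exact: C0_eval_le.
have h2 : cabs (f y1) <= e / 3 * rnorm x.
  apply: (@le_trans _ _ (e / 3 * rnorm y1)); last by rewrite ler_wpM2l// ltW.
  apply: hG => k; last by move=> Gk; rewrite y1E y0 ?scaler0//; apply: xFG; right.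
  by rewrite y1E => h; apply: contrapT => nV; move/eqP: h; apply; rewrite phi0// scale0r.
have h3 : cabs (f (y - y1)) <= e / 3 * rnorm x.
  apply: (@le_trans _ _ (e / 3 * rnorm (y - y1))); last by rewrite ler_wpM2l// ltW.
  apply: hF => k; last by move=> Fk; rewrite yE y0 ?scaler0//; apply: xFG; left.
  rewrite yE => h; apply: contrapT => nU; move/eqP: h; apply.
  have [->|/yM Mk] := eqVneq (y k) 0; first by rewrite scaler0.
  by rewrite phi1// subrr scale0r.
have xE : x = (x - y) + (y1 + (y - y1)) by rewrite (addrC y1) subrK subrK.
rewrite [in leLHS]xE dualD (dualD f y1); apply: (le_trans (ler_cabsD _ _)).
have := ler_cabsD (f y1) (f (y - y1)); lra.
Qed.

Definition locally_concentrated (k : K) := exists U, [/\ open U, U k & concentrated U].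

(** Inner regularity reduces [V] minus [E] to a compact set, covered by finitely many concentrated
    open sets. The points of [E] join the exceptional finite set, which is how an isolated bad point
    gets absorbed. *)
Lemma concentrated_diff (V E : set K) : open V -> finite_set E ->
  (forall k, V k -> ~ E k -> locally_concentrated k) -> concentrated V.
Proof.
move=> oV fE hV e e0; have e2 : 0 < e / 2 by rewrite divr_gt0.
have oVE : open (V `\` E).
  apply: openI => //; apply: closed_openC.
  exact: (proj1 accessible_finite_set_closed (hausdorff_accessible hK)).
have [L [cL LV hL]] := inner_regular oVE e2.
have [U [oU LU cU]] : exists U, [/\ open U, L `<=` U & concentrated U].
  apply: (@compact_induction K L (fun S => exists U, [/\ open U, S `<=` U & concentrated U])) => //.
  - exists set0; split => //; first exact: open0.
    move=> d d0; exists set0 => // x x0 _; suff -> : x = 0 by rewrite linear0 cabs0 rnorm0 mulr0.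
    by apply: C0_ext => k; apply/eqP/negPn/negP => /x0.
  - by move=> S S' SS' [U [oU S'U cU]]; exists U; split => //; exact: subset_trans S'U.
  - move=> S S' [U [oU SU cU]] [U' [oU' SU' cU']]; exists (U `|` U'); split.
    + exact: openU.
    + exact: setUSS.
    + exact: concentratedU.
  - move=> k /LV[Vk Ek]; have [U [oU Uk cU]] := hV k Vk Ek.
    by exists U; [exact: open_nbhs_nbhs|exists U; split].
have [phi [cphi phi01 phi1 phi0 _]] := bump_function R hK lcK cL oU LU.
have [F fF hF] := cU _ e2.
exists (F `|` E); first by rewrite finite_setU.
move=> x xV xFE; have [x1 x1E] := C0_scale x cphi phi01.
have xE k : (x - x1) k = (1 - phi k)%:C *: x k.
  by rewrite C0B x1E rmorphB rmorph1 scalerBl scale1r.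
have b1 : rnorm x1 <= rnorm x.
  apply: C0_rnorm_le => [|k]; first exact: rnorm_ge0.
  by rewrite x1E; apply: (le_trans (rnorm_scale01 _ (phi01 k))); exact: C0_eval_le.
have b2 : rnorm (x - x1) <= rnorm x.
  apply: C0_rnorm_le => [|k]; first exact: rnorm_ge0.
  rewrite xE; apply: (@le_trans _ _ (rnorm (x k))); last exact: C0_eval_le.
  by apply: rnorm_scale01; case/andP: (phi01 k) => p0 p1; rewrite subr_ge0 p1 lerBlDr lerDl.
have h1 : cabs (f x1) <= e / 2 * rnorm x.
  apply: (@le_trans _ _ (e / 2 * rnorm x1)); last by rewrite ler_wpM2l// ltW.
  apply: hF => k; last by move=> Fk; rewrite x1E xFE ?scaler0//; left.
  by rewrite x1E => h; apply: contrapT => nU; move/eqP: h; apply; rewrite phi0// scale0r.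
have h2 : cabs (f (x - x1)) <= e / 2 * rnorm x.
  apply: (@le_trans _ _ (e / 2 * rnorm (x - x1))); last by rewrite ler_wpM2l// ltW.
  apply: hL => k; rewrite xE => h; split.
    split; last by move=> Ek; move/eqP: h; apply; rewrite xFE ?scaler0//; right.
    by apply: xV; apply: contraNneq h => ->; rewrite scaler0.
  by move=> Lk; move/eqP: h; apply; rewrite phi1// subrr scale0r.
have xx1 : x = x1 + (x - x1) by rewrite addrC subrK.
rewrite [in leLHS]xx1 dualD; apply: (le_trans (ler_cabsD _ _)).
lra.
Qed.

(** The points without a concentrated neighbourhood form a closed set. If it had an isolated point
    [j], [concentrated_diff] with [E] reduced to [j] would make a neighbourhood of [j] concentrated.
    So it is empty, and the case of empty [E] globalizes. *)
Lemma scattered_concentrated : scattered K -> concentrated setT.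
Proof.
move=> sK; apply: (@concentrated_diff setT set0) => //; first exact: openT.
move=> k _ _; apply: contrapT => nk.
pose C := [set j | ~ locally_concentrated j].
have cC : closed C.
  have -> : C = ~` [set j | locally_concentrated j] by [].
  apply: open_closedC; rewrite openE => j [U [oU Uj cU]].
  apply: filterS (open_nbhs_nbhs (conj oU Uj)) => i Ui.
  by exists U.
have [j [/set_mem Cj [V Vj VC]]] := sK C cC (ex_intro _ k nk).
apply: Cj; exists (interior V); split; [exact: open_interior|exact: Vj|].
apply: (@concentrated_diff _ [set j]); [exact: open_interior|exact: finite_set1|].
move=> i Vi ij; apply: contrapT => ni; apply: ij.
have : (V `&` C) i by split => //; exact: interior_subset.
by rewrite VC.
Qed.

End Localization.

(** * Splitting elements of the ball *)

Section ConvexDefect.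
Variables (R : realType) (H : hilbertType R).
Local Open Scope complex_scope.

(** The variance identity [\sum_i lam_i |u_i - u0|^2 = \sum_i lam_i |u_i|^2 - |u0|^2], of whose
    left-hand side one term is kept. *)
Lemma convex_defect n (lam : 'I_n -> R) (u : 'I_n -> H) (u0 : H) (M : R) l :
  (forall i, 0 <= lam i) -> \sum_i lam i = 1 -> u0 = \sum_i (lam i)%:C *: u i ->
  0 <= M -> (forall i, rnorm (u i) <= M) ->
  lam l * rnorm (u l - u0) ^+ 2 <= M ^+ 2 - rnorm u0 ^+ 2.
Proof.
move=> lam0 lam1 u0E M0 uM.
have rd : \sum_i lam i * rdot (u i) u0 = rnorm u0 ^+ 2.
  rewrite -rdotxx {2}u0E /rdot hdot_suml Re_sum; apply: eq_bigr => i _.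
  by rewrite hdotZl ReMr.
have E : \sum_i lam i * rnorm (u i - u0) ^+ 2 = \sum_i lam i * rnorm (u i) ^+ 2 - rnorm u0 ^+ 2.
  under eq_bigr do rewrite sqr_rnormB mulrDr mulrBr.
  rewrite big_split sumrB/= -mulr_suml lam1 mul1r.
  under [X in _ - X + _]eq_bigr do rewrite mulrCA.
  by rewrite -mulr_sumr rd; ring.
apply: (@le_trans _ _ (\sum_i lam i * rnorm (u i - u0) ^+ 2)).
  rewrite (bigD1 l)//= lerDl; apply: sumr_ge0 => i _.
  by rewrite mulr_ge0// sqr_ge0.
rewrite E lerD2r -[leRHS]mul1r -lam1 mulr_suml; apply: ler_sum => i _.
by rewrite ler_wpM2l// ler_pXn2r ?nnegrE ?rnorm_ge0.
Qed.

End ConvexDefect.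

(** * Stability of the cut-off correction *)

Section CutEstimates.
Variables (R : realType) (H : hilbertType R) (x xs : {linear H -> H}).
Hypothesis adj : forall u v, rdot (x u) v = rdot u (xs v).
Hypothesis cx : forall u, rnorm (x u) <= rnorm u.
Hypothesis cxs : forall u, rnorm (xs u) <= rnorm u.
Local Open Scope complex_scope.

Lemma near_unit_cut0 m : near_unit_cut x xs m 0 = 0.
Proof.
have := iter_tB x xs m 0 0; rewrite !subrr => h.
by rewrite /near_unit_cut h subr0.
Qed.

Lemma near_unit_cutB m u v :
  near_unit_cut x xs m (u - v) = near_unit_cut x xs m u - near_unit_cut x xs m v.
Proof. by rewrite /near_unit_cut iter_tB !opprD !opprK addrACA. Qed.

Let adj' v w : rdot (xs v) w = rdot v (x w).
Proof. exact: adjC. Qed.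

Lemma defect_iter_le (d : H -> H) (lam kappa : R) m u : 0 < lam -> 0 <= kappa ->
  (forall v, lam * rnorm (d v) ^+ 2 <= rnorm v ^+ 2 - rnorm (x v) ^+ 2) ->
  1 <= lam * (m + m).+1%:R * kappa ^+ 2 ->
  rnorm (d (iter m (fun v => xs (x v)) u)) <= kappa * rnorm u.
Proof.
move=> lam0 k0 hd hk; have h := defect_iter adj m u (ltW lam0) hd.
rewrite -(@ler_pXn2r _ 2) ?nnegrE ?rnorm_ge0// ?mulr_ge0 ?rnorm_ge0//.
set c := lam * _ in h hk; have c0 : 0 < c by rewrite mulr_gt0.
rewrite exprMn -(ler_pM2l c0); apply: (le_trans h).
by rewrite mulrA ler_peMl ?sqr_ge0.
Qed.

(** The difference is [- q - D t^m u], with [q] the part removed by the outer cut-off. The second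
    term is small by [defect_iter]; so is [q] by duality, [|q|^2] being the pairing of [u1] with
    [Ds] applied to an iterate of [q]. *)
Lemma near_unit_cut_approx (D Ds : {linear H -> H}) (lam kappa : R) m u :
  0 < lam -> 0 <= kappa -> (forall v w, rdot (D v) w = rdot v (Ds w)) ->
  (forall v, lam * rnorm (D v) ^+ 2 <= rnorm v ^+ 2 - rnorm (x v) ^+ 2) ->
  (forall v, lam * rnorm (Ds v) ^+ 2 <= rnorm v ^+ 2 - rnorm (xs v) ^+ 2) ->
  1 <= lam * (m + m).+1%:R * kappa ^+ 2 ->
  rnorm (near_unit_cut xs x m (D (near_unit_cut x xs m u)) - D u) <= 2 * kappa * rnorm u.
Proof.
move=> lam0 k0 DDs hD hDs hk.
set u1 := near_unit_cut x xs m u.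
have h1 : rnorm (D (iter m (fun v => xs (x v)) u)) <= kappa * rnorm u.
  exact: defect_iter_le hD hk.
pose q := iter m (fun v => x (xs v)) (D u1).
have h2 : rnorm q <= kappa * rnorm u1.
  have [->|q0] := eqVneq q 0; first by rewrite rnorm0 mulr_ge0 ?rnorm_ge0.
  have nq : 0 < rnorm q by rewrite rnorm_gt0.
  rewrite -(ler_pM2r nq) -expr2 -rdotxx {1}/q (iter_t_adj adj') DDs.
  apply: (le_trans (rdot_le _ _)); rewrite [leRHS]mulrAC mulrC ler_wpM2r ?rnorm_ge0//.
  have := defect_iter adj' m q (ltW lam0) hDs => h.
  rewrite -(@ler_pXn2r _ 2) ?nnegrE ?rnorm_ge0// ?mulr_ge0 ?rnorm_ge0//.
  set c := lam * _ in h hk; have c0 : 0 < c by rewrite mulr_gt0.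
  rewrite exprMn -(ler_pM2l c0); apply: (le_trans h).
  by rewrite mulrA ler_peMl ?sqr_ge0.
have -> : near_unit_cut xs x m (D u1) - D u = - q - D (iter m (fun v => xs (x v)) u).
  rewrite /near_unit_cut -/q {1}/u1 /near_unit_cut linearB.
  by rewrite addrAC [_ - D u]addrAC subrr sub0r addrC.
apply: (le_trans (ler_rnormB _ _)); rewrite rnormN.
have := near_unit_cut_le adj cx cxs m u; rewrite -/u1 => hu1.
have : kappa * rnorm u1 <= kappa * rnorm u by rewrite ler_wpM2l.
lra.
Qed.

Section Lipschitz.
Variables (y ys : {linear H -> H}) (delta : R).
Hypothesis adjy : forall u v, rdot (y u) v = rdot u (ys v).
Hypothesis cy : forall u, rnorm (y u) <= rnorm u.
Hypothesis cys : forall u, rnorm (ys u) <= rnorm u.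
Hypothesis delta0 : 0 <= delta.
Hypothesis xy : forall u, rnorm (x u - y u) <= delta * rnorm u.
Hypothesis xsys : forall u, rnorm (xs u - ys u) <= delta * rnorm u.

(** Telescoping: among contractions, replacing one factor [x^* x] by [y^* y] costs [2 delta]. *)
Lemma near_unit_cut_lipschitz m u :
  rnorm (near_unit_cut x xs m u - near_unit_cut y ys m u) <= 2 * m%:R * delta * rnorm u.
Proof.
rewrite /near_unit_cut opprB addrC addrA subrK rdistC.
have iter_le (z zs : {linear H -> H}) k : (forall v, rnorm (z v) <= rnorm v) ->
    (forall v, rnorm (zs v) <= rnorm v) ->
    rnorm (iter k (fun v => zs (z v)) u) <= rnorm u.
  move=> hz hzs; elim: k => //= k IH; apply: le_trans IH.
  by apply: le_trans (hzs _) (hz _).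
elim: m => [|m IH]; first by rewrite /= subrr rnorm0 mulr0 !mul0r.
rewrite !iterS; set a := iter m _ _ in IH *; set b := iter m _ _ in IH *.
have hb : rnorm b <= rnorm u by exact: iter_le.
have -> : xs (x a) - ys (y b) =
    xs (x (a - b)) + (xs (x b - y b) + (xs (y b) - ys (y b))).
  by rewrite !linearB subrKA subrKA.
apply: (le_trans (ler_rnormD _ _)).
have e1 : rnorm (xs (x (a - b))) <= 2 * m%:R * delta * rnorm u.
  by apply: le_trans IH; apply: le_trans (cxs _) (cx _).
have db : delta * rnorm b <= delta * rnorm u by rewrite ler_wpM2l.
have e2 : rnorm (xs (x b - y b)) <= delta * rnorm u.
  by apply: le_trans (cxs _) _; apply: le_trans (xy _) db.
have e3 : rnorm (xs (y b) - ys (y b)) <= delta * rnorm u.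
  apply: (le_trans (xsys _)); rewrite ler_wpM2l//; exact: le_trans (cy b) hb.
have := ler_rnormD (xs (x b - y b)) (xs (y b) - ys (y b)).
rewrite -(natr1 m); lra.
Qed.

End Lipschitz.
End CutEstimates.

Section CutLipschitz.
Variables (R : realType) (H : hilbertType R) (x xs y ys : {linear H -> H}) (delta : R).
Hypothesis adj : forall u v, rdot (x u) v = rdot u (xs v).
Hypothesis cx : forall u, rnorm (x u) <= rnorm u.
Hypothesis cxs : forall u, rnorm (xs u) <= rnorm u.
Hypothesis adjy : forall u v, rdot (y u) v = rdot u (ys v).
Hypothesis cy : forall u, rnorm (y u) <= rnorm u.
Hypothesis cys : forall u, rnorm (ys u) <= rnorm u.
Hypothesis delta0 : 0 <= delta.
Hypothesis xy : forall u, rnorm (x u - y u) <= delta * rnorm u.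
Hypothesis xsys : forall u, rnorm (xs u - ys u) <= delta * rnorm u.

(** Two cut-offs, each contributing [2 m delta] times the bound [2] on [D]. *)
Lemma near_unit_cut2_lipschitz (D : {linear H -> H}) m u :
  (forall v, rnorm (D v) <= 2 * rnorm v) ->
  rnorm (near_unit_cut xs x m (D (near_unit_cut x xs m u)) -
         near_unit_cut ys y m (D (near_unit_cut y ys m u)))
  <= 8 * m%:R * delta * rnorm u.
Proof.
move=> D2; set a := near_unit_cut x xs m u; set b := near_unit_cut y ys m u.
have adj' v w : rdot (xs v) w = rdot v (x w) by exact: adjC.
have ab : rnorm (a - b) <= 2 * m%:R * delta * rnorm u by exact: near_unit_cut_lipschitz.
have bu : rnorm b <= rnorm u by exact: near_unit_cut_le.
have -> : near_unit_cut xs x m (D a) - near_unit_cut ys y m (D b) =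
   near_unit_cut xs x m (D (a - b)) + (near_unit_cut xs x m (D b) - near_unit_cut ys y m (D b)).
  by rewrite (linearB D a b) (near_unit_cutB xs x m (D a)) subrKA.
apply: (le_trans (ler_rnormD _ _)).
have e1 : rnorm (near_unit_cut xs x m (D (a - b))) <= 2 * rnorm (a - b).
  by apply: le_trans (D2 _); exact: near_unit_cut_le.
have e2 : rnorm (near_unit_cut xs x m (D b) - near_unit_cut ys y m (D b))
   <= 2 * m%:R * delta * rnorm (D b) by exact: near_unit_cut_lipschitz.
have e3 : 2 * m%:R * delta * rnorm (D b) <= 2 * m%:R * delta * (2 * rnorm u).
  rewrite ler_wpM2l ?mulr_ge0//; apply: (le_trans (D2 _)).
  by rewrite ler_wpM2l.
lra.
Qed.

End CutLipschitz.

Lemma iter_linear (R : nzRingType) (V : lmodType R) (F : V -> V) m :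
  (forall (l : R) u v, F (l *: u + v) = l *: F u + F v) ->
  forall (l : R) u v, iter m F (l *: u + v) = l *: iter m F u + iter m F v.
Proof. by move=> hF l u v; elim: m => //= m ->. Qed.

Lemma near_all_seq (T : Type) (F : set_system T) (FF : Filter F) (I : eqType)
    (s : seq I) (P : I -> T -> Prop) :
  (forall i, i \in s -> \forall t \near F, P i t) ->
  \forall t \near F, forall i, i \in s -> P i t.
Proof.
elim: s => [|i s IH] h; first by near=> t.
have hi : \forall t \near F, P i t by apply: h; rewrite mem_head.
have hs : \forall t \near F, forall j, j \in s -> P j t.
  by apply: IH => j js; apply: h; rewrite inE js orbT.
near=> t => j; rewrite inE => /predU1P[->|]; first by near: t.
by move: j; near: t.
Unshelve. all: by end_near. Qed.

(** * The cut-off correction inside the algebra *)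

Section CutMul.
Variables (R : realType) (A : cstarAlgType R) (I : choiceType).
Variables (H : I -> hilbertType R) (rho : forall i, A -> {linear H i -> H i}).
Hypothesis S : spatial rho.
Local Open Scope complex_scope.

Lemma spatial_rdot i a v w : rdot (rho i a v) w = rdot v (rho i (cstar a) w).
Proof. by rewrite /rdot (spatial_adj S). Qed.

(** Needed in a single representation, where the norm of [a] in [A] may be too large a bound; it
    follows from [|v|^2 = <rho i a v, w>]. *)
Lemma spatial_cstar_bound i a (M : R) : 0 <= M ->
  (forall w, rnorm (rho i a w) <= M * rnorm w) ->
  forall w, rnorm (rho i (cstar a) w) <= M * rnorm w.
Proof.
move=> M0 hM w; set v := rho i (cstar a) w.
have [->|v0] := eqVneq v 0; first by rewrite rnorm0 mulr_ge0 ?rnorm_ge0.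
have nv : 0 < rnorm v by rewrite rnorm_gt0.
rewrite -(ler_pM2r nv) -expr2 -rdotxx {2}/v -spatial_rdot.
apply: (le_trans (rdot_le _ _)); rewrite [leRHS]mulrAC.
by rewrite ler_wpM2r ?rnorm_ge0.
Qed.

Lemma rnorm_cstar_le (a : A) : rnorm (cstar a) <= rnorm a.
Proof.
apply: (spatial_norm S) => [|i w]; first exact: rnorm_ge0.
apply: spatial_cstar_bound; first exact: rnorm_ge0.
by move=> v; exact: (spatial_bound S).
Qed.

Lemma spatial_contraction i a w : rnorm a <= 1 -> rnorm (rho i a w) <= rnorm w.
Proof.
move=> a1; apply: (le_trans (spatial_bound S _ _)).
by rewrite ler_piMl ?rnorm_ge0.
Qed.

Lemma cmulBl (a b c : A) : cmul (a - b) c = cmul a c - cmul b c.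
Proof. by rewrite cmulDl -scaleN1r cmulZl scaleN1r. Qed.

Lemma cmulBr (a b c : A) : cmul c (a - b) = cmul c a - cmul c b.
Proof. by rewrite cmulDr -scaleN1r cmulZr scaleN1r. Qed.

Lemma cstarB (a b : A) : cstar (a - b) = cstar a - cstar b.
Proof.
rewrite cstarD -scaleN1r cstarZ; congr (_ + _).
by rewrite -[RHS]scaleN1r; congr (_ *: _); rewrite rmorphN rmorph1.
Qed.

Lemma rnorm_cmul (a b : A) : rnorm (cmul a b) <= rnorm a * rnorm b.
Proof. by rewrite -lecR realCM !rnormE ler_norm_cmul. Qed.

Lemma continuous_cmul (T : topologicalType) (f g : T -> A) :
  continuous f -> continuous g -> continuous (fun t => cmul (f t) (g t)).
Proof.
move=> cf cg t; apply/near_rdist => e e0.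
pose M := rnorm (f t) + rnorm (g t) + 1.
have M0 : 0 < M by have := rnorm_ge0 (f t); have := rnorm_ge0 (g t); rewrite /M; lra.
pose d := Num.min 1 (e / 2 / M).
have d0 : 0 < d by rewrite lt_min ltr01 !divr_gt0.
have hf : \forall u \near t, rnorm (f t - f u) < d by exact: (proj2 (near_rdist f t) (cf t)).
have hg : \forall u \near t, rnorm (g t - g u) < d by exact: (proj2 (near_rdist g t) (cg t)).
near=> u.
have hfu : rnorm (f t - f u) < d by near: u.
have hgu : rnorm (g t - g u) < d by near: u.
have -> : cmul (f t) (g t) - cmul (f u) (g u) =
    cmul (f t - f u) (g t) + cmul (f u) (g t - g u).
  by rewrite cmulBl cmulBr addrA subrK.
apply: (le_lt_trans (ler_rnormD _ _)).
have h1 := rnorm_cmul (f t - f u) (g t).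
have h2 := rnorm_cmul (f u) (g t - g u).
have d1 : d <= 1 by rewrite ge_min lexx.
have dM : d * M <= e / 2 by rewrite -ler_pdivlMr// ge_min lexx orbT.
have fu : rnorm (f u) <= rnorm (f t) + 1.
  by apply: (le_trans (ler_rnorm_sub _ (f t))); rewrite rdistC; lra.
have n1 := rnorm_ge0 (f t - f u); have n2 := rnorm_ge0 (g t - g u).
have n3 := rnorm_ge0 (f u); have n4 := rnorm_ge0 (g t); have n5 := rnorm_ge0 (f t).
have a1 : rnorm (f t - f u) * rnorm (g t) <= d * rnorm (g t) by rewrite ler_wpM2r// ltW.
have a2 : rnorm (f u) * rnorm (g t - g u) <= (rnorm (f t) + 1) * d.
  by apply: ler_pM => //; exact: ltW.
apply: (@le_lt_trans _ _ (d * M)); last lra.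
rewrite /M; lra.
Unshelve. all: by end_near. Qed.

Lemma continuous_cstar (T : topologicalType) (f : T -> A) :
  continuous f -> continuous (fun t => cstar (f t)).
Proof.
move=> cf t; apply/near_rdist => e e0.
have hf : \forall u \near t, rnorm (f t - f u) < e by exact: (proj2 (near_rdist f t) (cf t)).
apply: filterS hf => u; apply: le_lt_trans.
by rewrite -cstarB; exact: rnorm_cstar_le.
Qed.

(* [(1 - (a a^* )^m) D (1 - (a^* a)^m)], written without a unit. *)
Definition cut_mul m (a D : A) : A :=
  let D1 := D - iter m (fun v => cmul a (cmul (cstar a) v)) D in
  D1 - iter m (fun v => cmul v (cmul (cstar a) a)) D1.

Lemma spatial_cut_mul j m a D w :
  rho j (cut_mul m a D) w =
  near_unit_cut (rho j (cstar a)) (rho j a) m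
    (rho j D (near_unit_cut (rho j a) (rho j (cstar a)) m w)).
Proof.
have hl v : rho j (iter m (fun v => cmul a (cmul (cstar a) v)) D) v =
    iter m (fun u => rho j a (rho j (cstar a) u)) (rho j D v).
  by elim: m => //= m IH; rewrite !(spatialM S) IH.
have hr E v : rho j (iter m (fun v => cmul v (cmul (cstar a) a)) E) v =
    rho j E (iter m (fun u => rho j (cstar a) (rho j a u)) v).
  by elim: m {hl} v => //= m IH v; rewrite !(spatialM S) IH -iterSr.
by rewrite /cut_mul !(spatialB S) hr !(spatialB S) !hl /near_unit_cut !linearB !iter_tB
  !opprD !opprK addrACA.
Qed.

(** Linearity in [D] is what makes the corrections of the [y l] average to zero in [split_near]. *)
Lemma cut_mulL m a (l : R[i]) D E :
  cut_mul m a (l *: D + E) = l *: cut_mul m a D + cut_mul m a E.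
Proof.
have L F (hF : forall (l : R[i]) (u v : A), F (l *: u + v) = l *: F u + F v) u v :
    (l *: u + v) - iter m F (l *: u + v) = l *: (u - iter m F u) + (v - iter m F v).
  by rewrite iter_linear// opprD addrACA scalerBr.
rewrite /cut_mul /= L => [|k u v]; last by rewrite !cmulDr !cmulZr.
by rewrite L// => k u v; rewrite !cmulDl !cmulZl.
Qed.

Lemma cut_mul0 m a : cut_mul m a 0 = 0.
Proof. exact: (linear_at0 (cut_mulL m a)). Qed.

Lemma cut_mul_sum m a n (c : 'I_n -> R[i]) (D : 'I_n -> A) :
  cut_mul m a (\sum_i c i *: D i) = \sum_i c i *: cut_mul m a (D i).
Proof.
elim/big_rec2: _ => [|i u v _ <-]; first exact: cut_mul0.
exact: cut_mulL.
Qed.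

Lemma continuous_cut_mul (T : topologicalType) (f : T -> A) m D :
  continuous f -> continuous (fun t => cut_mul m (f t) D).
Proof.
move=> cf; have cfs := continuous_cstar cf.
have cl k (F : T -> A) : continuous F ->
    continuous (fun t => iter k (fun v => cmul (f t) (cmul (cstar (f t)) v)) (F t)).
  move=> cF; elim: k => //= k IH.
  by apply: continuous_cmul => //; exact: continuous_cmul.
have cr k (F : T -> A) : continuous F ->
    continuous (fun t => iter k (fun v => cmul v (cmul (cstar (f t)) (f t))) (F t)).
  move=> cF; elim: k => //= k IH.
  by apply: continuous_cmul => //; exact: continuous_cmul.
have cB (F G : T -> A) : continuous F -> continuous G -> continuous (fun t => F t - G t).
  by move=> cF cG t; apply: cvgB; [exact: cF|exact: cG].
have cD : continuous (fun _ : T => D) by move=> t; exact: cvg_cst.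
have c1 := cB _ _ cD (cl m _ cD).
exact: cB c1 (cr m _ c1).
Qed.

(** This is [exhaustion] with finite sets of summands as states, the approximation being a
    truncation. *)
Lemma spatial_concentrated (g : dual A) (e : R) : 0 < e ->
  exists2 J : set I, finite_set J &
    forall a, (forall j, J j -> forall w, rho j a w = 0) -> cabs (g a) <= e * rnorm a.
Proof.
move=> e0; pose T := {J : set I | finite_set J}.
pose supp (t : T) a := forall i, ~ sval t i -> forall w, rho i a w = 0.
pose van (t : T) a := forall i, sval t i -> forall w, rho i a w = 0.
have [|||[J fJ] hJ] := @exhaustion R A g T supp van (exist _ set0 (@finite_set0 I)) _ _ _ e e0.
- by move=> i _ w; rewrite (spatial0 S).
- by move=> t l x vx i ti w; rewrite (spatialZ S) vx// scaler0.
- move=> t x d vx x1 d0.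
  have [J' fJ' hJ'] := spatial_c0 S x d0.
  have [x' [x'J x'nJ]] := spatial_trunc S x J'.
  have fU : finite_set (sval t `|` J') by rewrite finite_setU; split => //; exact: (svalP t).
  exists (exist _ _ fU), x'; split.
    apply: (spatial_norm S) => [|i w]; first exact: ltW.
    rewrite (spatialB S); have [Ji|nJi] := pselect (J' i).
      by rewrite x'J// subrr rnorm0 mulr_ge0 ?rnorm_ge0// ltW.
    by rewrite x'nJ// subr0; exact: hJ'.
  move=> z sz z1; split.
    move=> i /= /not_orP[nt nJ] w; rewrite (spatialD S) sz// x'nJ// addr0//.
  apply: (spatial_norm S) => // i w; rewrite (spatialD S) mul1r.
  have [ti|nti] := pselect (sval t i).
    have -> : rho i x' w = 0.
      by have [Ji|nJi] := pselect (J' i); [rewrite x'J// vx|rewrite x'nJ].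
    by rewrite addr0 spatial_contraction.
  rewrite sz// add0r; have [Ji|nJi] := pselect (J' i).
    by rewrite x'J// spatial_contraction.
  by rewrite x'nJ// rnorm0 rnorm_ge0.
- by exists J.
Qed.

End CutMul.

Section BumpFamily.
Variables (R : realType) (K : topologicalType).
Hypothesis hK : hausdorff_space K.
Hypothesis lcK : locally_compact [set: K].

(** By induction: the new bump [b] vanishes at the other points, and the earlier functions are
    multiplied by [1 - b]. This keeps their values at those points and bounds the sum by
    [b + (1 - b) = 1]. *)
Lemma bump_family (s : seq K) (O : K -> set K) : uniq s ->
  (forall k, k \in s -> open (O k) /\ O k k) ->
  exists phi : K -> K -> R, [/\
    forall k, k \in s -> continuous (phi k) /\
      exists2 M, compact M & forall t, phi k t != 0 -> M t,
    forall k t, k \in s -> 0 <= phi k t /\ (phi k t != 0 -> O k t),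
    forall t, \sum_(k <- s) phi k t <= 1 &
    forall k k', k \in s -> k' \in s -> phi k k' = (k == k')%:R].
Proof.
elim: s => [|j s IH] /=.
  move=> _ _; exists (fun _ _ => 0); split => // t; by rewrite big_nil.
move=> /andP[js us] hO; have [|phi [c1 c2 c3 c4]] := IH us.
  by move=> k ks; apply: hO; rewrite inE ks orbT.
have [oj Ojj] := hO j (mem_head _ _).
have oO : open (O j `\` [set` s]).
  apply: openI => //; apply: closed_openC.
  by apply: (proj1 accessible_finite_set_closed (hausdorff_accessible hK)); exact: finite_seq.
have [|b [cb b01 b1 b0 [M cM bM]]] := bump_function R hK lcK (@compact_set1 _ j) oO.
  by move=> k ->; split => //=; exact/negP.
have bj : b j = 1 by exact: b1.
have bs k : k \in s -> b k = 0 by move=> ks; apply: b0 => -[_ /=]; rewrite ks.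
pose psi k t := if k == j then b t else (1 - b t) * phi k t.
have psis k t : k \in s -> psi k t = (1 - b t) * phi k t.
  by move=> ks; rewrite /psi; case: eqP => // kj; rewrite -kj ks in js.
have psij t : psi j t = b t by rewrite /psi eqxx.
exists psi; split.
- move=> k; rewrite inE => /predU1P[->|ks].
    rewrite (_ : psi j = b); last by apply/funext => t; exact: psij.
    by split => //; exists M.
  have [cphi [N cN phiN]] := c1 k ks.
  rewrite (_ : psi k = fun t => (1 - b t) * phi k t); last by apply/funext => t; exact: psis.
  split.
    move=> t; apply: cvgM; last exact: cphi.
    by apply: cvgB; [exact: cvg_cst|exact: cb].
  by exists N => // t; rewrite mulf_eq0 negb_or => /andP[_ /phiN].
- move=> k t; rewrite inE => /predU1P[->|ks].
    rewrite psij; split; first by case/andP: (b01 t).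
    by apply: contraNP => nO; apply/eqP; apply: b0 => -[].
  rewrite psis//; have [p0 pO] := c2 k t ks; case/andP: (b01 t) => b0t b1t.
  split; first by rewrite mulr_ge0// subr_ge0.
  by rewrite mulf_eq0 negb_or => /andP[_ /pO].
- move=> t; rewrite big_cons psij.
  rewrite (eq_big_seq (fun k => (1 - b t) * phi k t)); last by move=> k ks; exact: psis.
  rewrite -mulr_sumr; case/andP: (b01 t) => b0t b1t.
  have : (1 - b t) * (\sum_(k <- s) phi k t) <= 1 - b t.
    by rewrite ler_piMr ?subr_ge0.
  lra.
- move=> k k'; rewrite !inE => /predU1P[->|ks] /predU1P[->|k's].
  + by rewrite psij bj eqxx.
  + by rewrite psij bs//; case: eqP => // jk; rewrite jk k's in js.
  + by rewrite psis// bj subrr mul0r; case: eqP => // kj; rewrite -kj ks in js.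
  + by rewrite psis// bs// subr0 mul1r c4.
Qed.

End BumpFamily.

(** The inverse of [1 + \sum_l 1 / t l] replaces a minimum and also makes sense for [n = 0]. *)
Lemma positive_lower_bound (R : realType) n (t : 'I_n -> R) : (forall l, 0 < t l) ->
  exists2 r, 0 < r & forall l, r <= t l.
Proof.
move=> t0; have S0 : 0 <= \sum_l (t l)^-1.
  by apply: sumr_ge0 => l _; rewrite invr_ge0 ltW.
exists (1 + \sum_l (t l)^-1)^-1; first by rewrite invr_gt0; lra.
move=> l; rewrite -[leRHS]invrK lef_pV2 ?posrE ?invr_gt0//; last by lra.
apply: (@le_trans _ _ (\sum_l (t l)^-1)); last by rewrite lerDr.
by rewrite (bigD1 l)//= lerDl; apply: sumr_ge0 => i _; rewrite invr_ge0 ltW.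
Qed.

(** * Control at finitely many points and summands *)

Section Sufficiency.
Variables (R : realType) (K : topologicalType) (A : cstarAlgType R) (I : choiceType).
Variables (H : I -> hilbertType R) (rho : forall i, A -> {linear H i -> H i}).
Hypothesis hK : hausdorff_space K.
Hypothesis lcK : locally_compact [set: K].
Hypothesis S : spatial rho.
Local Open Scope complex_scope.

(** On the finite set [F] carrying [f] up to a small error, [z] agrees with
    [z1 = \sum_k phi_k z(k)], and each functional [a |-> f (phi_k a)] on [A] is localized to
    finitely many summands. The bound [2] fits differences of elements of the ball. *)
Lemma C0_localized (f : dual (C0 K A)) (e : R) : scattered K -> 0 < e ->
  exists (F : seq K) (J : seq I) (tau : R), 0 < tau /\
    forall z : C0 K A, rnorm z <= 2 ->
      (forall k j, k \in F -> j \in J -> forall w, rnorm (rho j (z k) w) <= tau * rnorm w) ->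
      cabs (f z) <= e.
Proof.
move=> sK e0; have e12 : 0 < e / 12 by rewrite divr_gt0.
have [F0 /finite_seqP[F1 ->] hF] := scattered_concentrated hK lcK f sK e12.
pose F := undup F1.
have [|phi [c1 c2 c3 c4]] := @bump_family R K hK lcK F (fun=> setT) (undup_uniq _).
  by move=> k _; split => //; exact: openT.
have [C C_gt0 fC] := dual_bounded f.
pose N : R := (size F).+1%:R; have N0 : 0 < N by rewrite ltr0n.
pose e2 := e / 2 / N; have e20 : 0 < e2 by rewrite !divr_gt0.
pose tau := e2 / 2 / C; have tau0 : 0 < tau by rewrite !divr_gt0.
have claim k : exists p : (A -> C0 K A) * seq I, k \in F ->
    (forall a t, p.1 a t = (phi k t)%:C *: a) /\
    (forall a, rnorm a <= 2 ->
      (forall j, j \in p.2 -> forall w, rnorm (rho j a w) <= tau * rnorm w) ->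
      cabs (f (p.1 a)) <= e2).
  have [kF|] := boolP (k \in F); last by exists (fun=> 0, [::]).
  have [cphi supp_phi] := c1 k kF.
  have /choice[Y YE] (a : A) : exists y : C0 K A, forall t, y t = (phi k t)%:C *: a.
    by apply: (@C0_bump R K A (phi k) (fun=> a)) => // t; exact: cvg_cst.
  have phi01 t : 0 <= phi k t <= 1.
    have [p0 _] := c2 k t kF; rewrite p0/=; apply: le_trans (c3 t).
    rewrite (big_rem k)//= lerDl big_seq; apply: sumr_ge0 => i iF.
    by have [] := c2 i t (mem_rem iF).
  have Yle a : rnorm (Y a) <= rnorm a.
    apply: C0_rnorm_le => [|t]; first exact: rnorm_ge0.
    by rewrite YE; exact: rnorm_scale01.
  have YL l a b : Y (l *: a + b) = l *: Y a + Y b.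
    apply: C0_ext => t; rewrite C0D C0Z !YE scalerDr !scalerA.
    by congr (_ *: _ + _); rewrite mulrC.
  have [||g gE] := @dual_of R A (fun a => f (Y a)) C.
  - by move=> l a b; rewrite YL dualD dualZ.
  - by move=> a; apply: (le_trans (fC _)); rewrite ler_wpM2l// ltW.
  have e4 : 0 < e2 / 4 by rewrite divr_gt0.
  have [J0 /finite_seqP[J ->] hJ] := spatial_concentrated S g e4.
  exists (Y, J) => _; split => // a a2 /= aJ.
  (* The part [a'] on [J] has norm at most [tau] and the rest is negligible for [g]; each
     contributes [e2 / 2]. *)
  have [a' [a'J a'nJ]] := spatial_trunc S a [set` J].
  have h1 : rnorm a' <= tau.
    apply: (spatial_norm S) => [|i w]; first exact: ltW.
    have [Ji|nJi] := pselect ([set` J] i); first by rewrite a'J// aJ.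
    by rewrite a'nJ// rnorm0 mulr_ge0 ?rnorm_ge0// ltW.
  have h2 : rnorm (a - a') <= 2.
    apply: (spatial_norm S) => // i w; rewrite (spatialB S).
    have [Ji|nJi] := pselect ([set` J] i).
      by rewrite a'J// subrr rnorm0 mulr_ge0 ?rnorm_ge0.
    rewrite a'nJ// subr0; apply: (le_trans (spatial_bound S _ _)).
    by rewrite ler_wpM2r ?rnorm_ge0.
  have h3 : cabs (g (a - a')) <= e2 / 4 * 2.
    apply: (@le_trans _ _ (e2 / 4 * rnorm (a - a'))); last by rewrite ler_wpM2l// ltW.
    by apply: hJ => j Jj w; rewrite (spatialB S) a'J// subrr.
  have h4 : cabs (g a') <= e2 / 2.
    rewrite gE; apply: (le_trans (fC _)); rewrite mulrC -ler_pdivlMr//.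
    exact: le_trans (Yle _) h1.
  have := ler_cabsD (g (a - a')) (g a'); rewrite -dualD subrK gE.
  move: h3 h4; rewrite /=; lra.
have [p hp] := choice claim.
exists F, (flatten [seq (p k).2 | k <- F]), tau; split => // z z2 hz.
have Yp k : k \in F -> cabs (f ((p k).1 (z k))) <= e2.
  move=> kF; have [_] := hp k kF; apply.
    by apply: le_trans z2; exact: C0_eval_le.
  move=> j jk w; apply: hz => //; apply/flatten_mapP; by exists k.
pose z1 := \sum_(k <- F) (p k).1 (z k).
have z1E t : z1 t = \sum_(k <- F) (phi k t)%:C *: z k.
  rewrite C0_sum; apply: eq_big_seq => k kF.
  by have [-> _] := hp k kF.
have n1 : rnorm z1 <= 2.
  apply: C0_rnorm_le => // t; rewrite z1E; apply: (le_trans (ler_rnorm_sum _ _ _)).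
  apply: (@le_trans _ _ (\sum_(k <- F) phi k t * 2)); last first.
    by rewrite -mulr_suml ler_piMl.
  rewrite big_seq [leRHS]big_seq; apply: ler_sum => k kF.
  have [p0 _] := c2 k t kF.
  rewrite rnormZE cabs_ge0_real// ler_wpM2l//; apply: le_trans z2; exact: C0_eval_le.
(* [z - z1] vanishes on [F] and has norm at most [4], hence the choice of [e / 12]: the errors
   [e / 3] and [e / 2] add up to less than [e]. *)
have b1 : cabs (f (z - z1)) <= e / 12 * 4.
  apply: (@le_trans _ _ (e / 12 * rnorm (z - z1))).
    apply: hF => // k kF1; have kF : k \in F by rewrite mem_undup.
    rewrite C0B z1E (bigD1_seq k)//= ?undup_uniq// big1_seq ?addr0.
      by rewrite c4// eqxx scale1r subrr.
    by move=> i /andP[ik iF]; rewrite c4// (negbTE ik) scale0r.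
  rewrite ler_wpM2l//; first exact: ltW.
  by apply: (le_trans (ler_rnormB _ _)); lra.
have b2 : cabs (f z1) <= e / 2.
  have -> : f z1 = \sum_(k <- F) f ((p k).1 (z k)) by rewrite /z1 linear_sum.
  rewrite cabs_rnorm; apply: (le_trans (ler_rnorm_sum _ _ _)).
  apply: (@le_trans _ _ (\sum_(k <- F) e2)).
    by rewrite big_seq [leRHS]big_seq; apply: ler_sum => k kF; exact: Yp.
  rewrite big_const_seq count_predT iter_addr_0 -[e2 *+ _]mulr_natr.
  rewrite /e2 mulrAC ler_pdivrMr// ler_wpM2l//; first by rewrite ltW// divr_gt0.
  by rewrite ler_nat.
have := ler_cabsD (f (z - z1)) (f z1); rewrite -dualD subrK; lra.
Qed.

(** Finite dimension enters here: the finitely many matrix entries of [y k] are continuous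
    functionals of [y] and together control the operator norm. *)
Lemma weak_near_entry (x0 : C0 K A) k j (d : R) : 0 < d ->
  (exists n (e : 'I_n -> H j), orthonormal_basis e) ->
  \forall y \near (x0 : weak_topology (C0 K A)),
    forall w, rnorm (rho j ((y : C0 K A) k - x0 k) w) <= d * rnorm w.
Proof.
move=> d0 [n [e be]]; have [oe eb] := be.
have hg (p : 'I_n * 'I_n) : exists g : dual (C0 K A),
    forall x, g x = hdot (rho j (x k) (e p.1)) (e p.2).
  apply: (@dual_of _ _ (fun x : C0 K A => hdot (rho j (x k) (e p.1)) (e p.2)) 1).
    by move=> l x y; rewrite C0D C0Z (spatialL S) hdotDl hdotZl.
  move=> x; apply: (le_trans (CauchySchwarz _ _)).
  rewrite (orthonormal_norm _ oe) mulr1; apply: (le_trans (spatial_bound S _ _)).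
  by rewrite (orthonormal_norm _ oe) mulr1 mul1r; exact: C0_eval_le.
have [g gE] := choice hg.
(* The successor keeps the denominator positive when [n = 0]. *)
pose d' := d / (n * n).+1%:R; have d'0 : 0 < d' by rewrite divr_gt0// ltr0n.
apply: filterS (@near_weak _ _ x0 _ g _ d'0) => y hy w.
have -> : rho j (y k - x0 k) w = rho j ((y - x0 : C0 K A) k) w by [].
apply: (@le_trans _ _ (n%:R * (n%:R * d') * rnorm w)).
  apply: (orthonormal_linear_le be); first by rewrite mulr_ge0// ltW.
  move=> a; apply: (orthonormal_entries_le be) => b.
  by have := hy (a, b); rewrite gE => /ltW.
rewrite ler_wpM2r ?rnorm_ge0// mulrA -natrM /d' mulrCA ger_pMr//.
by rewrite ler_pdivrMr ?ltr0n// mul1r ler_nat.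
Qed.

(** The four error terms come from [a] versus [a0], from the cut-offs of [a] versus those of [a0],
    from the cut-offs of [a0] versus none, and from the factor [1 - s]. *)
Lemma cut_mul_close j m (a a0 al D : A) (s delta kappa lam : R) :
  rnorm a <= 1 -> rnorm a0 <= 1 -> rnorm al <= 1 ->
  0 <= s -> s <= 1 -> 0 <= delta -> 0 < lam -> 0 <= kappa ->
  (forall w, rho j D w = (1 - s)%:C *: (rho j al w - rho j a0 w)) ->
  (forall w, lam * rnorm (rho j al w - rho j a0 w) ^+ 2
     <= rnorm w ^+ 2 - rnorm (rho j a0 w) ^+ 2) ->
  (forall w, lam * rnorm (rho j (cstar al) w - rho j (cstar a0) w) ^+ 2
     <= rnorm w ^+ 2 - rnorm (rho j (cstar a0) w) ^+ 2) ->
  (forall w, rnorm (rho j (a - a0) w) <= delta * rnorm w) ->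
  1 <= lam * (m + m).+1%:R * kappa ^+ 2 ->
  forall w, rnorm (rho j (a + cut_mul m a D - al) w)
    <= (delta + 8 * m%:R * delta + 2 * kappa + 2 * s) * rnorm w.
Proof.
move=> a1 a01 al1 s0 s1 d0 lam0 k0 hD hd hds ha hk w.
have as1 (b : A) : rnorm b <= 1 -> rnorm (cstar b) <= 1.
  by move=> b1; apply: le_trans (rnorm_cstar_le S b) b1.
have cb (b : A) : rnorm b <= 1 -> forall v, rnorm (rho j b v) <= rnorm v.
  by move=> b1 v; exact: (spatial_contraction S).
have adj (b : A) u v : rdot (rho j b u) v = rdot u (rho j (cstar b) v) by exact: (spatial_rdot S).
pose E := (1 - s)%:C *: (cstar al - cstar a0).
have EE v : rho j E v = (1 - s)%:C *: (rho j (cstar al) v - rho j (cstar a0) v).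
  by rewrite (spatialZ S) (spatialB S).
have DE u v : rdot (rho j D u) v = rdot u (rho j E v).
  by rewrite hD EE rdotZl rdotZr !rdotE !adj.
have s1' : 0 <= 1 - s by rewrite subr_ge0.
have sq1 (u : H j) : rnorm ((1 - s)%:C *: u) ^+ 2 <= rnorm u ^+ 2.
  rewrite ler_pXn2r ?nnegrE ?rnorm_ge0//; apply: rnorm_scale01.
  by rewrite s1' lerBlDr lerDl.
have dD v : lam * rnorm (rho j D v) ^+ 2 <= rnorm v ^+ 2 - rnorm (rho j a0 v) ^+ 2.
  by apply: le_trans (hd v); rewrite hD ler_wpM2l ?sq1// ltW.
have dE v : lam * rnorm (rho j E v) ^+ 2 <= rnorm v ^+ 2 - rnorm (rho j (cstar a0) v) ^+ 2.
  by apply: le_trans (hds v); rewrite EE ler_wpM2l ?sq1// ltW.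
have D2 v : rnorm (rho j D v) <= 2 * rnorm v.
  rewrite hD; apply: (@le_trans _ _ (rnorm (rho j al v - rho j a0 v))).
    by apply: rnorm_scale01; rewrite s1' lerBlDr lerDl.
  apply: (le_trans (ler_rnormB _ _)); have := cb al al1 v; have := cb a0 a01 v; lra.
have ha' v : rnorm (rho j a v - rho j a0 v) <= delta * rnorm v.
  by rewrite -(spatialB S).
have has v : rnorm (rho j (cstar a) v - rho j (cstar a0) v) <= delta * rnorm v.
  by rewrite -(spatialB S) -cstarB; apply: (spatial_cstar_bound S).
have e1 := near_unit_cut2_lipschitz (adj a) (cb a a1) (cb _ (as1 a a1))
  (adj a0) (cb a0 a01) (cb _ (as1 a0 a01)) d0 ha' has m w D2.
have e2 := near_unit_cut_approx (adj a0) (cb a0 a01) (cb _ (as1 a0 a01)) w lam0 k0 DE dD dE hk.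
set P := near_unit_cut _ _ _ _ in e1; set Q := near_unit_cut _ _ _ _ in e1 e2.
have e3 : rnorm (rho j a0 w + rho j D w - rho j al w) <= 2 * s * rnorm w.
  have -> : rho j a0 w + rho j D w - rho j al w = s%:C *: (rho j a0 w - rho j al w).
    rewrite hD rmorphB rmorph1 scalerBl scale1r scalerBr [in RHS]scalerBr.
    by rewrite addrA [rho j a0 w + _]addrC subrK addrAC subrr sub0r opprB.
  rewrite rnormZE cabs_ge0_real//.
  have hh : rnorm (rho j a0 w - rho j al w) <= 2 * rnorm w.
    have := ler_rnormB (rho j a0 w) (rho j al w).
    have := cb al al1 w; have := cb a0 a01 w; lra.
  by have := ler_wpM2l s0 hh; lra.
have -> : rho j (a + cut_mul m a D - al) w =
   (rho j a w - rho j a0 w) + ((P - Q) + ((Q - rho j D w) + (rho j a0 w + rho j D w - rho j al w))).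
  rewrite (spatialB S) (spatialD S) (spatial_cut_mul S) -/P.
  rewrite -[in LHS]addrA [rho j a0 w + rho j D w]addrC -(addrA (rho j D w)).
  by rewrite subrKA subrKA [in RHS]addrCA subrKA [in RHS]addrCA.
apply: (le_trans (ler_rnormD _ _)).
have t1 := ler_rnormD (P - Q) ((Q - rho j D w) + (rho j a0 w + rho j D w - rho j al w)).
have t2 := ler_rnormD (Q - rho j D w) (rho j a0 w + rho j D w - rho j al w).
have t3 := ha' w.
rewrite !mulrDl; lra.
Qed.

End Sufficiency.

Section SufficiencyMain.
Variables (R : realType) (K : topologicalType) (A : cstarAlgType R) (I : choiceType).
Variables (H : I -> hilbertType R) (rho : forall i, A -> {linear H i -> H i}).
Hypothesis hK : hausdorff_space K.
Hypothesis lcK : locally_compact [set: K].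
Hypothesis S : spatial rho.
Local Open Scope complex_scope.

(* Near [x0 = \sum_l lam l x l], the ball element [X] splits as
   [\sum_l lam l y l], with [y l] given near each point [k] of [F] by
   [X + cut_mul m X (D k l)]. *)
Lemma split_near n (lam : 'I_n -> R) (x : 'I_n -> C0 K A) (x0 : C0 K A)
    (F : seq K) (J : seq I) (tau : R) :
  (forall l, 0 < lam l) -> \sum_l lam l = 1 -> (forall l, rnorm (x l) <= 1) ->
  x0 = \sum_l (lam l)%:C *: x l -> 0 < tau ->
  exists2 delta : R, 0 < delta & forall X : C0 K A, rnorm X <= 1 ->
    (forall k j, k \in F -> j \in J -> forall w,
       rnorm (rho j (X k - x0 k) w) <= delta * rnorm w) ->
    exists y : 'I_n -> C0 K A, [/\ forall l, rnorm (y l) <= 1,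
      X = \sum_l (lam l)%:C *: y l &
      forall l k j, k \in F -> j \in J -> forall w,
        rnorm (rho j (y l k - x l k) w) <= tau * rnorm w].
Proof.
move=> lam0 lam1 x1 x0E tau0.
have [lm lm0 lmle] := positive_lower_bound lam0.
(* The order of choice matters: [s] and [kappa] from [tau], then [m] large enough for every [lam l],
   then [delta] small against [s / m]. *)
pose s := Num.min 1 (tau / 8).
have s0 : 0 < s by rewrite lt_min ltr01 divr_gt0.
have s1 : s <= 1 by rewrite ge_min lexx.
have st : s <= tau / 8 by rewrite ge_min lexx orbT.
pose kappa := tau / 8; have k0 : 0 < kappa by rewrite divr_gt0.
have lk0 : 0 < lm * kappa ^+ 2 by rewrite mulr_gt0// exprn_gt0.
pose m := (Num.truncn (1 / (lm * kappa ^+ 2))).+1.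
have hm : 1 <= lm * (m + m).+1%:R * kappa ^+ 2.
  have : 1 / (lm * kappa ^+ 2) < m%:R by exact: truncnS_gt.
  rewrite ltr_pdivrMr// => /ltW /le_trans; apply.
  rewrite [leRHS]mulrAC [leLHS]mulrC ler_wpM2l//; first exact: ltW.
  by rewrite ler_nat -addnS leq_addr.
pose delta := s / (16 * m.+1%:R).
have m0 : 0 < 16 * m.+1%:R :> R by rewrite mulr_gt0// ltr0n.
have d0 : 0 < delta by rewrite divr_gt0.
have dm : delta * (16 * m.+1%:R) = s by rewrite /delta divfK// gt_eqF.
have dm' : 16 * (delta * m%:R) + 16 * delta = s by rewrite -dm -(natr1 m); ring.
have dm0 : 0 <= delta * m%:R by rewrite mulr_ge0// ltW.
exists delta => // X X1 hX.
pose F' := undup F.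
have s1' : 0 <= 1 - s by rewrite subr_ge0.
have x01 : rnorm x0 <= 1.
  rewrite x0E; apply: (le_trans (ler_rnorm_sum _ _ _)); rewrite -[leRHS]lam1.
  apply: ler_sum => l _; rewrite rnormZE cabs_ge0_real; last exact: ltW.
  by rewrite ler_piMr// ltW.
have x0k k : x0 k = \sum_l (lam l)%:C *: x l k by rewrite x0E C0_sum.
have ev (z : C0 K A) k : rnorm z <= 1 -> rnorm (z k) <= 1 by apply: le_trans; exact: C0_eval_le.
(* Truncation to [J] removes the correction on the summands where nothing is known about
   [X - x0]. *)
have Dex (kl : K * 'I_n) : exists D : A,
    (forall j, [set` J] j -> forall w,
       rho j D w = (1 - s)%:C *: (rho j (x kl.2 kl.1) w - rho j (x0 kl.1) w)) /\
    (forall j, ~ [set` J] j -> forall w, rho j D w = 0).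
  have [D [DJ DnJ]] := spatial_trunc S ((1 - s)%:C *: (x kl.2 kl.1 - x0 kl.1)) [set` J].
  by exists D; split => // j Jj w; rewrite DJ// (spatialZ S) (spatialB S).
have [D hD] := choice Dex.
have DJ k l j w : j \in J -> rho j (D (k, l)) w = (1 - s)%:C *: (rho j (x l k) w - rho j (x0 k) w).
  by move=> jJ; have [h _] := hD (k, l); exact: h.
have DnJ k l j w : j \notin J -> rho j (D (k, l)) w = 0.
  by move=> jJ; have [_ h] := hD (k, l); apply: h; exact/negP.
have D0 k : \sum_l (lam l)%:C *: D (k, l) = 0.
  apply: (spatial_inj S) => j w; rewrite (spatial_sum S) (spatial0 S).
  have [jJ|jJ] := boolP (j \in J); last first.
    by rewrite big1// => l _; rewrite (spatialZ S) DnJ// scaler0.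
  under eq_bigr do rewrite (spatialZ S) DJ// scalerA mulrC -scalerA scalerBr.
  rewrite -scaler_sumr sumrB -scaler_suml x0k (spatial_sum S).
  have -> : \sum_l (lam l)%:C = 1 :> R[i] by rewrite -rmorph_sum/= lam1.
  rewrite scale1r.
  under [X in _ *: (_ - X)]eq_bigr do rewrite (spatialZ S).
  by rewrite subrr scaler0.
pose O k := [set t | rnorm (X k - X t) < delta].
have oO k : open (O k).
  have cn : continuous (fun t => rnorm (X k - X t)).
    move=> t; apply: (@continuous_comp _ _ _ (fun t => X k - X t) (@rnorm R A)).
      by apply: cvgB; [exact: cvg_cst|exact: C0_continuous].
    exact: rnorm_continuous.
  exact: (open_comp (fun t _ => cn t) (@open_lt _ delta)).
have [|phi [c1 c2 c3 c4]] := @bump_family R K hK lcK F' O (undup_uniq _).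
  by move=> k _; split => //; rewrite /O/= subrr rnorm0.
have Pex (kl : K * 'I_n) : exists P : C0 K A, kl.1 \in F' ->
    forall t, P t = (phi kl.1 t)%:C *: cut_mul m (X t) (D kl).
  have [kF|_] := boolP (kl.1 \in F'); last by exists 0.
  have [cphi hphi] := c1 _ kF.
  have [P PE] := @C0_bump R K A (phi kl.1) (fun t => cut_mul m (X t) (D kl)) cphi
     (@continuous_cut_mul _ _ _ _ _ S K X m (D kl) (@C0_continuous _ _ _ X)) hphi.
  by exists P => _.
have [P hP] := choice Pex.
have PE k l t : k \in F' -> P (k, l) t = (phi k t)%:C *: cut_mul m (X t) (D (k, l)).
  by move=> kF; rewrite hP.
pose y l := X + \sum_(k <- F') P (k, l).
have yE l t : y l t = X t + \sum_(k <- F') (phi k t)%:C *: cut_mul m (X t) (D (k, l)).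
  by rewrite /y C0D C0_sum; congr (_ + _); apply: eq_big_seq => k kF; exact: PE.
have as1 (b : A) : rnorm b <= 1 -> rnorm (cstar b) <= 1.
  by move=> b1; apply: le_trans (rnorm_cstar_le S b) b1.
have cb (b : A) j : rnorm b <= 1 -> forall v, rnorm (rho j b v) <= rnorm v.
  by move=> b1 v; exact: (spatial_contraction S).
have adj (b : A) j u v : rdot (rho j b u) v = rdot u (rho j (cstar b) v).
  exact: (spatial_rdot S).
(* On the summands of [J], [X t] is within [delta] of [X k], itself within [delta] of [x0 k]: hence
   [2 * delta] below. *)
have near_t k l t : k \in F' -> O k t -> rnorm (X t + cut_mul m (X t) (D (k, l))) <= 1.
  move=> kF Okt; apply: (spatial_norm S) => // j w; rewrite mul1r.
  rewrite (spatialD S) (spatial_cut_mul S).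
  have Xt := ev X t X1.
  have [jJ|jJ] := boolP (j \in J); last first.
    by rewrite DnJ// near_unit_cut0 addr0; exact: cb.
  apply: (@cut_perturbation_contraction _ _ _ _ (adj (X t) j) (cb _ j Xt) (cb _ j (as1 _ Xt))
    (rho j (x0 k)) (rho j (x l k)) (rho j (D (k, l))) s (2 * delta)) => //.
  - exact: ltW.
  - by rewrite mulr_ge0// ltW.
  - lra.
  - lra.
  - by apply: cb; exact: ev.
  - by apply: cb; exact: ev.
  - move=> v; rewrite -(spatialB S).
    have -> : X t - x0 k = (X t - X k) + (X k - x0 k) by rewrite subrKA.
    rewrite (spatialD S); apply: (le_trans (ler_rnormD _ _)).
    have h1 : rnorm (rho j (X k - x0 k) v) <= delta * rnorm v.
      by apply: hX => //; rewrite -mem_undup.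
    have h2 : rnorm (rho j (X t - X k) v) <= delta * rnorm v.
      apply: (le_trans (spatial_bound S _ _)).
      by rewrite ler_wpM2r ?rnorm_ge0// rdistC ltW.
    lra.
  - by move=> v; exact: DJ.
exists y; split.
- move=> l; apply: C0_rnorm_le => // t; rewrite yE.
  pose c := \sum_(k <- F') phi k t.
  (* [y l t] is a convex combination of [X t] and of the contractions provided by [near_t]. *)
  have -> : X t + \sum_(k <- F') (phi k t)%:C *: cut_mul m (X t) (D (k, l)) =
     (1 - c)%:C *: X t + \sum_(k <- F') (phi k t)%:C *: (X t + cut_mul m (X t) (D (k, l))).
    under [in RHS]eq_bigr do rewrite scalerDr.
    rewrite big_split/= -scaler_suml -rmorph_sum/= -/c addrA; congr (_ + _).
    by rewrite -scalerDl -rmorphD subrK rmorph1 scale1r.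
  apply: (le_trans (ler_rnormD _ _)).
  have c_le1 : c <= 1 by exact: c3.
  have h1 : rnorm ((1 - c)%:C *: X t) <= 1 - c.
    rewrite rnormZE cabs_ge0_real ?subr_ge0// ler_piMr ?subr_ge0//; exact: ev.
  have h2 : rnorm (\sum_(k <- F') (phi k t)%:C *: (X t + cut_mul m (X t) (D (k, l)))) <= c.
    apply: (le_trans (ler_rnorm_sum _ _ _)); rewrite /c big_seq [leRHS]big_seq.
    apply: ler_sum => k kF; have [p0 pO] := c2 k t kF.
    rewrite rnormZE cabs_ge0_real//; have [->|/pO Okt] := eqVneq (phi k t) 0.
      by rewrite mul0r.
    by rewrite ler_piMr//; exact: near_t.
  lra.
- apply: C0_ext => t; rewrite C0_sum.
  under eq_bigr do rewrite C0Z yE scalerDr.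
  rewrite big_split/= -scaler_suml.
  have -> : \sum_l (lam l)%:C = 1 :> R[i] by rewrite -rmorph_sum/= lam1.
  rewrite scale1r -[LHS]addr0; congr (_ + _).
  under eq_bigr do rewrite scaler_sumr.
  rewrite exchange_big/= big1// => k _.
  under eq_bigr do rewrite scalerA mulrC -scalerA.
  by rewrite -scaler_sumr -cut_mul_sum D0 cut_mul0 scaler0.
- move=> l k j kF jJ w.
  have kF' : k \in F' by rewrite mem_undup.
  have -> : y l k = X k + cut_mul m (X k) (D (k, l)).
    rewrite yE (bigD1_seq k)//= ?undup_uniq// c4// eqxx scale1r big1_seq ?addr0//.
    by move=> i /andP[ik iF]; rewrite c4// (negbTE ik) scale0r.
  have hd v : lam l * rnorm (rho j (x l k) v - rho j (x0 k) v) ^+ 2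
      <= rnorm v ^+ 2 - rnorm (rho j (x0 k) v) ^+ 2.
    apply: (@convex_defect _ _ n lam (fun i => rho j (x i k) v)) => //.
    - by move=> i; exact: ltW.
    - by rewrite x0k (spatial_sum S); apply: eq_bigr => i _; rewrite (spatialZ S).
    - exact: rnorm_ge0.
    - by move=> i; apply: cb; exact: ev.
  have cs0 : cstar (x0 k) = \sum_l (lam l)%:C *: cstar (x l k).
    have c0 : cstar (0 : A) = 0 by rewrite -{1}(subrr (0 : A)) cstarB subrr.
    rewrite x0k (big_morph _ (@cstarD _ A) c0); apply: eq_bigr => i _.
    by rewrite cstarZ; congr (_ *: _); exact: conjc_real.
  have hds v : lam l * rnorm (rho j (cstar (x l k)) v - rho j (cstar (x0 k)) v) ^+ 2
      <= rnorm v ^+ 2 - rnorm (rho j (cstar (x0 k)) v) ^+ 2.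
    apply: (@convex_defect _ _ n lam (fun i => rho j (cstar (x i k)) v)) => //.
    - by move=> i; exact: ltW.
    - by rewrite cs0 (spatial_sum S); apply: eq_bigr => i _; rewrite (spatialZ S).
    - exact: rnorm_ge0.
    - by move=> i; apply: cb; apply: as1; exact: ev.
  have hml : 1 <= lam l * (m + m).+1%:R * kappa ^+ 2.
    by apply: (le_trans hm); rewrite -!mulrA ler_wpM2r// mulr_ge0// sqr_ge0.
  have := @cut_mul_close R A I H rho S j m (X k) (x0 k) (x l k) (D (k, l)) s delta kappa (lam l)
    (ev _ k X1) (ev _ k x01) (ev _ k (x1 l)) (ltW s0) s1 (ltW d0) (lam0 l) (ltW k0)
    (fun w => @DJ k l j w jJ) hd hds (fun w => hX k j kF jJ w) hml w.
  move=> /le_trans; apply; rewrite ler_wpM2r ?rnorm_ge0//.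
  move: dm' dm0 st k0 s0; rewrite /kappa; lra.
Qed.

Lemma scattered_P1 : scattered K ->
  (forall i, exists n (e : 'I_n -> H i), orthonormal_basis e) -> P1 (C0 K A).
Proof.
move=> sK onb; apply: P1_of_weak_nbhs => C [n [lam [f [e [lam0 lam1 f1 e0 ->]]]]] x0.
move=> [x hx x0E].
have x1 l : rnorm (x l) <= 1 by have [/ball_rnorm] := hx l.
(* Half the margin of [x l] in its slice, so that a non-strict bound on [f l (y l - x l)] leaves a
   strict inequality. *)
pose eta l := (complex.Re (f l (x l)) - (dual_norm (f l) - e l)) / 2.
have eta0 l : 0 < eta l by rewrite divr_gt0// subr_gt0; have [] := hx l.
have loc l : exists p : seq K * seq I * R, 0 < p.2 /\ forall z : C0 K A, rnorm z <= 2 ->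
   (forall k j, k \in p.1.1 -> j \in p.1.2 -> forall w, rnorm (rho j (z k) w) <= p.2 * rnorm w) ->
   cabs (f l z) <= eta l.
  have [F [J [tau [tau0 h]]]] := C0_localized hK lcK S (f l) sK (eta0 l).
  by exists (F, J, tau).
have [p hp] := choice loc.
have [tau tau0 htau] := positive_lower_bound (fun l => proj1 (hp l)).
pose F := flatten [seq (p l).1.1 | l <- enum 'I_n].
pose J := flatten [seq (p l).1.2 | l <- enum 'I_n].
have [delta d0 hdelta] := @split_near n lam x x0 F J tau lam0 lam1 x1 (esym x0E) tau0.
have near_x0 : \forall X \near (x0 : weak_topology (C0 K A)), forall k, k \in F ->
    forall j, j \in J -> forall w, rnorm (rho j ((X : C0 K A) k - x0 k) w) <= delta * rnorm w.
  have FF : Filter (nbhs (x0 : weak_topology (C0 K A))) by exact: nbhs_filter.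
  apply: (near_all_seq FF) => k _; apply: (near_all_seq FF) => j _.
  exact: (weak_near_entry S x0 k d0 (onb j)).
apply: filterS near_x0 => X hX X1.
have [y [y1 XE yx]] := hdelta X X1 (fun k j kF jJ w => hX k kF j jJ w).
exists y; last by rewrite XE.
move=> l; split; first exact/ball_rnorm.
have : cabs (f l (y l - x l)) <= eta l.
  have [_ h] := hp l; apply: h.
    by apply: (le_trans (ler_rnormB _ _)); have := y1 l; have := x1 l; lra.
  move=> k j kF jJ w; rewrite C0B.
  apply: (@le_trans _ _ (tau * rnorm w)); last by rewrite ler_wpM2r ?rnorm_ge0.
  by apply: yx; apply/flatten_mapP; exists l => //; rewrite mem_enum.
have := Re_le_cabs (- f l (y l - x l)); rewrite cabsN dualB ReN ReB /eta.
have := eta0 l; rewrite /eta; lra.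
Qed.

End SufficiencyMain.

(** * Necessity *)

(** An affine bound replaces a square root because it can be averaged in [P1bar_scattered]; it is
    [(z - 1/4)^2 >= 0] rearranged. *)
Lemma sqr_le_affine (R : realType) (z w : R) : z ^+ 2 <= 2 * w -> z <= 1 / 8 + 4 * w.
Proof. have : 0 <= (z - 1 / 4) ^+ 2 by exact: sqr_ge0. by rewrite sqrrB; lra. Qed.

Section InfiniteDimensional.
Variables (R : realType) (K : topologicalType) (A : cstarAlgType R) (I : choiceType).
Variables (H : I -> hilbertType R) (rho : forall i, A -> {linear H i -> H i}).
Hypothesis hK : hausdorff_space K.
Hypothesis lcK : locally_compact [set: K].
Hypothesis S : spatial rho.
Local Open Scope complex_scope.

(* With [k0] isolated, the slices of [f = <rho i (x k0) e, e>] force [x k0] to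
   almost fix [e], whereas [(xi (x) e) 1_{k0}] may lie in any weak
   neighbourhood of [0]. *)
Lemma P1bar_orthonormal_basis (k0 : K) i : open [set k0] -> P1bar (C0 K A) ->
  exists n (e : 'I_n -> H i), orthonormal_basis e.
Proof.
move=> ok0 HP; case: (orthonormal_dichotomy (H i)) => // hinf; exfalso.
have [e1 oe1] := hinf 1%N; set e := e1 ord0.
have ee : hdot e e = 1 by rewrite oe1.
have ne : rnorm e = 1 by exact: orthonormal_norm.
have /choice[a aP] (u : H i) : exists a, (forall w, rho i a w = hdot w e *: u) /\
   (forall j, j != i -> forall w, rho j a w = 0) by exact: (spatial_rank1 S).
have aE u w : rho i (a u) w = hdot w e *: u by have [] := aP u.
have aE0 u j w : j != i -> rho j (a u) w = 0 by move=> ji; have [_] := aP u; exact.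
have aL l u v : a (l *: u + v) = l *: a u + a v.
  apply: (spatial_inj S) => j w; rewrite (spatialL S).
  have [E|ji] := eqVneq j i; last by rewrite !aE0// scaler0 addr0.
  case: _ / (esym E) w => w; rewrite !aE scalerDr !scalerA.
  by congr (_ *: _ + _); rewrite mulrC.
have [|chi [cchi chi01 chi1 _ schi]] := bump_function R hK lcK (@compact_set1 _ k0) ok0 => //.
have /choice[Y YE] (u : H i) : exists y : C0 K A, forall t, y t = (chi t)%:C *: a u.
  by apply: (@C0_bump R K A chi (fun=> a u)) => // t; exact: cvg_cst.
have Yk0 u : Y u k0 = a u by rewrite YE chi1// scale1r.
have YL l u v : Y (l *: u + v) = l *: Y u + Y v.
  apply: C0_ext => t; rewrite C0D C0Z !YE aL scalerDr !scalerA.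
  by congr (_ *: _ + _); rewrite mulrC.
have Y0 : Y 0 = 0 by exact: linear_at0 YL.
have Yn u : rnorm (Y u) <= rnorm u.
  apply: C0_rnorm_le => [|t]; first exact: rnorm_ge0.
  rewrite YE; apply: (le_trans (rnorm_scale01 _ (chi01 t))).
  have [h1 h2] := aP u; have := spatial_rank1_norm S h1 h2.
  by rewrite ne mulr1.
have [||f fE] := @dual_of R (C0 K A) (fun x => hdot (rho i (x k0) e) e) 1.
- by move=> l x y; rewrite C0D C0Z (spatialL S) hdotDl hdotZl.
- move=> x; rewrite mul1r; apply: (le_trans (CauchySchwarz _ _)).
  rewrite ne mulr1; apply: (le_trans (spatial_bound S _ _)); rewrite ne mulr1.
  exact: C0_eval_le.
pose N (x : C0 K A) := rnorm (rho i (x k0) e).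
apply: (@not_P1bar R (C0 K A) f (Y e) N) HP.
- apply: dual_norm_le => x x1; rewrite fE; apply: (le_trans (CauchySchwarz _ _)).
  rewrite ne mulr1; apply: (le_trans (spatial_bound S _ _)); rewrite ne mulr1.
  exact: le_trans (C0_eval_le _ _) x1.
- by apply: (le_trans (Yn e)); rewrite ne.
- by rewrite fE Yk0 aE ee scale1r.
- by move=> x y; rewrite /N C0D (spatialD S); exact: ler_rnormD.
- by move=> r x; rewrite /N C0Z (spatialZ S) rnormZE cabs_real.
- move=> x; apply: (le_trans (spatial_bound S _ _)); rewrite ne mulr1.
  exact: C0_eval_le.
(* For [|v| <= 1] one has [|v - e|^2 <= 2 (1 - Re <v, e>)], here with [v = rho i (u k0) e]. *)
- move=> u u1; apply: sqr_le_affine.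
  rewrite /N C0B (spatialB S) Yk0 aE ee scale1r sqr_rnormB ne fE /rdot.
  have : rnorm (rho i (u k0) e) <= 1.
    apply: (le_trans (spatial_bound S _ _)); rewrite ne mulr1.
    exact: le_trans (C0_eval_le _ _) u1.
  have := rnorm_ge0 (rho i (u k0) e); nra.
- move=> n g; have [u ou] := hinf n.+1.
  (* On the span of [n.+1] orthonormal vectors, [n] functionals have a nonzero common zero. *)
  have [|c [[s0 cs0] _ cV]] := @linear_dependence _ 'I_n.+1 [set: 'I_n.+1] n
      (fun s l => g l (Y (u s))).
    by rewrite cardsT card_ord.
  pose w := \sum_s c s *: u s.
  have Yw : Y w = \sum_s c s *: Y (u s).
    by rewrite /w; elim/big_rec2: _ => [//|s v v' _ <-]; rewrite YL.
  have w0 : 0 < rnorm w.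
    rewrite rnorm_gt0; apply: contraTneq cs0 => w0.
    by rewrite -(orthonormal_free c s0 ou) -/w w0 hdot0l eqxx.
  exists (((rnorm w)^-1)%:C *: Y w); split.
  + rewrite rnormZE cabs_ge0_real ?invr_ge0 ?rnorm_ge0// ler_pdivrMl// mulr1.
    exact: Yn.
  + move=> l; rewrite dualZ Yw linear_sum -[RHS](mulr0 ((rnorm w)^-1)%:C); congr (_ * _).
    by rewrite -[RHS](cV l); apply: eq_bigr => s _; rewrite dualZ.
  + rewrite /N C0Z (spatialZ S) Yk0 aE ee scale1r rnormZE.
    rewrite cabs_ge0_real ?invr_ge0 ?rnorm_ge0// mulVf ?gt_eqF//; lra.
Qed.

End InfiniteDimensional.

(** * Limits of bounded sequences along an ultrafilter *)

Section UltraLimit.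
Variables (R : realType) (G : set_system nat).
Hypothesis ultraG : UltraFilter G.
Implicit Types u v : nat -> R.

Lemma ultra_bounded_cvg u (M : R) : (forall n, `|u n| <= M) -> cvg (u @ G).
Proof.
move=> uM; have FG : ProperFilter (u @ G) by exact: fmap_proper_filter.
have uI : (u @ G) `[- M, M]%classic.
  rewrite /fmap; apply: (@filterE _ G) => n; rewrite /= in_itv/= -ler_norml; exact: uM.
have [p [_ clp]] := @segment_compact R (- M) M _ FG uI.
apply/cvg_ex; exists p => V Vp.
have [//|GnV] := in_ultra_setVsetC (u @^-1` V) ultraG.
by have [x [/= nVx Vx]] := clp (~` V) V GnV Vp.
Qed.

Definition ulim u : R := lim (u @ G).

Lemma ulimD u v (M N : R) : (forall n, `|u n| <= M) -> (forall n, `|v n| <= N) ->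
  ulim (fun n => u n + v n) = ulim u + ulim v.
Proof.
move=> uM vN; apply/cvg_lim => //.
by apply: cvgD; [exact: ultra_bounded_cvg uM|exact: ultra_bounded_cvg vN].
Qed.

Lemma ulimZ u (r M : R) : (forall n, `|u n| <= M) ->
  ulim (fun n => r * u n) = r * ulim u.
Proof.
move=> uM; apply/cvg_lim => //.
by apply: cvgM; [exact: cvg_cst|exact: ultra_bounded_cvg uM].
Qed.

Lemma ulim_cst u (c : R) : G [set n | u n = c] -> ulim u = c.
Proof.
move=> uc; apply/cvg_lim => // V /nbhs_singleton Vc.
by apply: (@filterS _ G _ _ (u @^-1` V) _ uc) => n /= ->.
Qed.

Lemma ler_ulim u v (M N : R) : (forall n, `|u n| <= M) -> (forall n, `|v n| <= N) ->
  (forall n, u n <= v n) -> ulim u <= ulim v.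
Proof.
move=> uM vN uv; apply: ler_lim.
- exact: ultra_bounded_cvg uM.
- exact: ultra_bounded_cvg vN.
- by apply: filterE.
Qed.

End UltraLimit.

(** * Almost unimodular vectors in the kernel of few functionals *)

Section Unimodular.
Variables (R : realType) (T : finType) (r : nat) (V : T -> 'I_r -> R[i]).
Local Open Scope complex_scope.

(** [|c + t k|^2 - 1] is a quadratic in [t] with positive leading coefficient and negative value at
    [0], so its larger root is positive. *)
Lemma reach_unit_circle (c k : R[i]) : cabs c < 1 -> k != 0 ->
  exists2 t : R, 0 < t & cabs (c + t%:C * k) = 1.
Proof.
move=> c1 k0.
pose a := cabs k ^+ 2; pose b := complex.Re c * complex.Re k + complex.Im c * complex.Im k.
pose g := cabs c ^+ 2 - 1.
have a0 : 0 < a by rewrite exprn_gt0// cabs_gt0.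
have g0 : g < 0.
  by rewrite /g subr_lt0 expr_lt1// cabs_ge0.
have D0 : b ^+ 2 < b ^+ 2 - a * g by rewrite ltrDl oppr_gt0 nmulr_llt0.
pose q := Num.sqrt (b ^+ 2 - a * g).
have D0' : 0 <= b ^+ 2 - a * g by apply: le_trans (ltW D0); exact: sqr_ge0.
have q2 : q ^+ 2 = b ^+ 2 - a * g by rewrite /q sqr_sqrtr.
have bq : b < q.
  apply: (le_lt_trans (ler_norm b)); rewrite -sqrtr_sqr ltr_sqrt//.
  by apply: le_lt_trans D0; exact: sqr_ge0.
pose t := (q - b) / a.
have t0 : 0 < t by rewrite divr_gt0// subr_gt0.
exists t => //.
have at_ : a * t = q - b by rewrite /t mulrC divfK// gt_eqF.
have E : a * t ^+ 2 + 2 * b * t + g = 0.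
  apply: (@mulfI _ a); first by rewrite gt_eqF.
  rewrite mulr0.
  have -> : a * (a * t ^+ 2 + 2 * b * t + g) = (a * t) ^+ 2 + 2 * b * (a * t) + a * g by ring.
  by rewrite at_ (_ : a * g = b ^+ 2 - q ^+ 2); [ring|rewrite q2; ring].
have : cabs (c + t%:C * k) ^+ 2 = 1.
  move: E; rewrite /a /b /g !sqr_cabs.
  case: (c) => c' c''; case: (k) => k' k'' /=.
  by rewrite !mul0r subr0 addr0 => E; lra.
move/eqP; rewrite sqrf_eq1 => /orP[/eqP//|/eqP h].
by have := cabs_ge0 (c + t%:C * k); rewrite h; lra.
Qed.

(* Moving along a kernel direction supported where [|c s| < 1] until some
   coordinate becomes unimodular. *)
Lemma almost_unimodular_kernel : exists c : T -> R[i], [/\ forall s, cabs (c s) <= 1,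
  forall l, \sum_s c s * V s l = 0 & \sum_s (1 - cabs (c s)) <= r%:R].
Proof.
have step k (c : T -> R[i]) : (forall s, cabs (c s) <= 1) ->
    (forall l, \sum_s c s * V s l = 0) -> (#|[set s | cabs (c s) != 1%R]%SET| <= k)%N ->
    exists c : T -> R[i], [/\ forall s, cabs (c s) <= 1,
      forall l, \sum_s c s * V s l = 0 & (#|[set s | cabs (c s) != 1%R]%SET| <= r)%N].
  elim: k c => [|k IH] c c1 cV ck.
    by exists c; split => //; apply: leq_trans ck _.
  have [cr|rc] := leqP #|[set s | cabs (c s) != 1%R]%SET| r; first by exists c.
  have [d [[s0 ds0] dP dV]] := linear_dependence V rc.
  have clt s : d s != 0 -> cabs (c s) < 1.
    move=> ds; rewrite lt_neqAle c1 andbT; apply: contraNneq ds => cs.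
    by rewrite dP// inE cs eqxx.
  have tex s : exists t : R, d s != 0 -> 0 < t /\ cabs (c s + t%:C * d s) = 1.
    have [->|ds] := eqVneq (d s) 0; first by exists 0.
    by have [t t0 ct] := reach_unit_circle (clt s ds) ds; exists t.
  have [t ht] := choice tex.
  (* With the smallest [t s], every moved coordinate stays on the segment from [c s] to a point of
     the circle, hence in the disc, and one more becomes unimodular. *)
  case: (@arg_minP _ _ T s0 (fun s => d s != 0) t ds0) => s1 ds1 tmin.
  have [t0 ct1] := ht s1 ds1.
  pose c' s := c s + (t s1)%:C * d s.
  apply: (IH c').
  - move=> s; rewrite /c'; have [->|ds] := eqVneq (d s) 0; first by rewrite mulr0 addr0.
    have [ts0 cts] := ht s ds; pose h := t s1 / t s.
    have h0 : 0 <= h by rewrite divr_ge0// ltW.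
    have h1 : h <= 1 by rewrite ler_pdivrMr// mul1r tmin.
    have -> : c s + (t s1)%:C * d s = (1 - h)%:C * c s + h%:C * (c s + (t s)%:C * d s).
      have -> : t s1 = h * t s by rewrite /h divfK// gt_eqF.
      by rewrite realCM rmorphB rmorph1; ring.
    apply: (le_trans (ler_cabsD _ _)); rewrite !cabsM cts !cabs_ge0_real ?subr_ge0//.
    have := c1 s; have := cabs_ge0 (c s); nra.
  - move=> l; under eq_bigr do rewrite /c' mulrDl -mulrA.
    by rewrite big_split/= cV -mulr_sumr dV mulr0 addr0.
  - rewrite -ltnS; apply: leq_trans ck; apply: proper_card; apply/properP; split.
      apply/fintype.subsetP => s; rewrite !inE; apply: contraNN => /eqP cs.
      have ds : d s = 0 by rewrite dP// inE cs eqxx.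
      by rewrite /c' ds mulr0 addr0 cs.
    exists s1; first by rewrite inE lt_eqF// clt.
    by rewrite inE /c' ct1 eqxx.
have [|l||c [c1 cV cr]] := @step #|T| (fun=> 0).
- by move=> s; rewrite cabs0.
- by rewrite big1// => s _; rewrite mul0r.
- exact: max_card.
exists c; split => //.
rewrite (bigID (fun s => cabs (c s) == 1))/= big1 ?add0r; last first.
  by move=> s /eqP ->; rewrite subrr.
apply: (@le_trans _ _ (\sum_(s | cabs (c s) != 1) 1)).
  by apply: ler_sum => s _; rewrite gerBl cabs_ge0.
rewrite sumr_const ler_nat; apply: leq_trans cr.
by rewrite cardsE.
Qed.

End Unimodular.

(** * Averages over the levels of a binary tree of sets *)

Section BinaryTree.
Variables (R : realType) (K T : Type) (U : T -> set K) (kid : bool -> T -> T).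
Variables (pt : T -> K) (phi : T -> K -> R).
Hypothesis kid_sub : forall b v, U (kid b v) `<=` U v.
Hypothesis kid_disj : forall v t, U (kid false v) t -> ~ U (kid true v) t.
Hypothesis pt_in : forall v, U v (pt v).
Hypothesis phi01 : forall v t, 0 <= phi v t <= 1.
Hypothesis phi1 : forall b v t, U (kid b v) t -> phi v t = 1.
Hypothesis phi0 : forall v t, ~ U v t -> phi v t = 0.

Fixpoint tree_avg n v (h : K -> R) : R :=
  if n is n'.+1 then (tree_avg n' (kid false v) h + tree_avg n' (kid true v) h) / 2
  else h (pt v).

Lemma tree_avg_le n v (h h' : K -> R) : (forall t, U v t -> h t <= h' t) ->
  tree_avg n v h <= tree_avg n v h'.
Proof.
elim: n v => [|n IH] v hh' /=; first by apply: hh'; exact: pt_in.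
rewrite ler_pM2r// lerD//; apply: IH => t /kid_sub; exact: hh'.
Qed.

Lemma tree_avg_cst n v (h : K -> R) c : (forall t, U v t -> h t = c) -> tree_avg n v h = c.
Proof.
elim: n v => [|n IH] v hc /=; first by apply: hc; exact: pt_in.
by rewrite !IH; [lra|move=> t /kid_sub; exact: hc|move=> t /kid_sub; exact: hc].
Qed.

Lemma tree_avgD n v (h h' : K -> R) :
  tree_avg n v (fun t => h t + h' t) = tree_avg n v h + tree_avg n v h'.
Proof. by elim: n v => [|n IH] v //=; rewrite !IH; lra. Qed.

Lemma tree_avgZ n v (r : R) (h : K -> R) :
  tree_avg n v (fun t => r * h t) = r * tree_avg n v h.
Proof. by elim: n v => [|n IH] v //=; rewrite !IH; lra. Qed.

Lemma tree_avg_bound n v (h : K -> R) M : (forall t, U v t -> `|h t| <= M) ->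
  `|tree_avg n v h| <= M.
Proof.
move=> hM; rewrite ler_norml -{1}(@tree_avg_cst n v (fun=> - M) (- M))//.
rewrite -{2}(@tree_avg_cst n v (fun=> M) M)//.
by apply/andP; split; apply: tree_avg_le => t /hM; rewrite ler_norml => /andP[].
Qed.

Fixpoint tree_index n : finType :=
  if n is n'.+1 then (tree_index n' + tree_index n')%type : finType else unit.

Lemma card_tree_index n : #|tree_index n| = (2 ^ n)%N.
Proof. by elim: n => [|n IH] /=; rewrite ?card_unit// card_sum IH addnn -mul2n expnS. Qed.

Fixpoint leaf n v : tree_index n -> T :=
  match n return tree_index n -> T with
  | 0 => fun=> v
  | n'.+1 => fun s => match s with
      | inl s' => leaf (kid false v) s'
      | inr s' => leaf (kid true v) s'
      end
  end.

Lemma leaf_sub n v (s : tree_index n) : U (leaf v s) `<=` U v.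
Proof.
elim: n v s => [|n IH] v; first by move=> s t.
by move=> [s|s] t /IH; exact: kid_sub.
Qed.

Lemma leaf_disj n v (s s' : tree_index n) t :
  U (leaf v s) t -> U (leaf v s') t -> s = s'.
Proof.
elim: n v s s' => [|n IH] v /=; first by case=> -[].
move=> [s|s] [s'|s'] h h'.
- by congr inl; exact: IH h h'.
- by have := kid_disj (leaf_sub h) (leaf_sub h').
- by have := kid_disj (leaf_sub h') (leaf_sub h).
- by congr inr; exact: IH h h'.
Qed.

(** At least one level below the leaves is required: [h] is known only on their children, where the
    bump functions equal [1]. *)
Lemma tree_avg_leaf n m v (h : K -> R) (c : tree_index n -> R) :
  (forall s b t, U (kid b (leaf v s)) t -> h t = c s) ->
  tree_avg (n + m.+1) v h = (2 ^+ n)^-1 * \sum_s c s.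
Proof.
elim: n v c => [|n IH] v c hc.
  rewrite add0n /= expr0 invr1 mul1r (big_pred1 tt); last by case.
  rewrite (tree_avg_cst m (hc tt false)) (tree_avg_cst m (hc tt true)); lra.
rewrite addSn /= (IH _ (fun s => c (inl s))); last by move=> s; exact: (hc (inl s)).
rewrite (IH _ (fun s => c (inr s))); last by move=> s; exact: (hc (inr s)).
have -> : \sum_s c s = \sum_s c (inl s) + \sum_s c (inr s) by rewrite big_sumType.
by rewrite exprS invfM -mulrDr mulrC mulrA.
Qed.

Lemma sum_phi_leaf n v t : \sum_(s : tree_index n) phi (leaf v s) t <= 1.
Proof.
have [[s us]|ns] := pselect (exists s : tree_index n, U (leaf v s) t).
  rewrite (bigD1 s)//= big1 ?addr0; first by case/andP: (phi01 (leaf v s) t).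
  move=> s' s's; apply: phi0 => us'; move/eqP: s's; apply.
  exact: leaf_disj us' us.
by rewrite big1// => s _; apply: phi0 => us; apply: ns; exists s.
Qed.

End BinaryTree.

(** * Growing the tree along a set without isolated points *)

Section PerfectTree.
Variables (R : realType) (K : topologicalType).
Hypothesis hK : hausdorff_space K.
Hypothesis lcK : locally_compact [set: K].
Variable F : set K.
Hypothesis F_perfect : forall x, ~ isolated F x.

Definition tree_node := {U : set K | open U /\ exists x, F x /\ U x}.

(** A node meets [F], which has no isolated point, so it contains two points of [F], and these have
    disjoint neighbourhoods. *)
Lemma tree_node_split (v : tree_node) : exists p : (tree_node * tree_node) * (K -> R),
  [/\ sval p.1.1 `<=` sval v, sval p.1.2 `<=` sval v,
      forall t, sval p.1.1 t -> ~ sval p.1.2 t & continuous p.2] /\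
  [/\ forall t, 0 <= p.2 t <= 1,
      forall t, sval p.1.1 t \/ sval p.1.2 t -> p.2 t = 1,
      forall t, ~ sval v t -> p.2 t = 0 &
      exists2 M, compact M & forall t, p.2 t != 0 -> M t].
Proof.
case: v => V [oV [x [Fx Vx]]] /=.
have [y [Fy Vy yx]] : exists y, [/\ F y, V y & y <> x].
  apply: contrapT => hn; apply: (F_perfect (x := x)); split; first exact/mem_set.
  exists V; first exact: open_nbhs_nbhs.
  apply/seteqP; split => [z [Vz Fz]|z ->//].
  by apply: contrapT => zx; apply: hn; exists z; split.
have xy : x != y by apply/eqP => xy; exact: yx.
have := hK; rewrite open_hausdorff => /(_ x y xy).
move=> [[A B] [/= /set_mem Ax /set_mem By] [oA oB AB0]].
have c2 : compact ([set x] `|` [set y]) by apply: compactU; exact: compact_set1.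
have [|b [cb b01 b1 b0 [M cM bM]]] := bump_function R hK lcK c2 oV; first by move=> z [] ->.
have oW : open [set t | 1 / 2 < b t].
  exact: (open_comp (fun t _ => cb t) (@open_gt _ (1 / 2))).
have nA : open (V `&` (A `&` [set t | 1 / 2 < b t])) /\
    exists z, F z /\ (V `&` (A `&` [set t | 1 / 2 < b t])) z.
  split; first by do 2?apply: openI.
  by exists x; do !split => //=; rewrite b1; [lra|left].
have nB : open (V `&` (B `&` [set t | 1 / 2 < b t])) /\
    exists z, F z /\ (V `&` (B `&` [set t | 1 / 2 < b t])) z.
  split; first by do 2?apply: openI.
  by exists y; do !split => //=; rewrite b1; [lra|right].
(* Restricting the children to [1 / 2 < b] makes [phi] equal to [1] on them, while it still vanishes
   off [V]. *)
pose phi t := Num.min 1 (2 * b t).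
exists ((exist (fun U => open U /\ exists x, F x /\ U x) _ nA,
         exist (fun U => open U /\ exists x, F x /\ U x) _ nB), phi) => /=; split; split.
- by move=> t [].
- by move=> t [].
- by move=> t [_ [At _]] [_ [Bt _]]; have : (A `&` B) t by []; rewrite (eqP AB0).
- move=> t; apply: (@continuous_min _ _ (cst 1 : K -> R^o) (fun t => 2 * b t)).
    exact: cvg_cst.
  by apply: cvgM; [exact: cvg_cst|exact: cb].
- move=> t; rewrite le_min ler01 ge_min lexx/= andbT.
  by case/andP: (b01 t) => h _; rewrite mulr_ge0.
- move=> t h; rewrite /phi min_l//.
  by case: h => -[_ [_ /=]]; lra.
- by move=> t nV; rewrite /phi b0// mulr0 min_r.
- exists M => // t h; apply: bM; apply: contraNneq h => bt.
  by rewrite /phi bt mulr0 min_r.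
Qed.

End PerfectTree.

Section NotScattered.
Variables (R : realType) (K : topologicalType) (A : cstarAlgType R) (I : choiceType).
Variables (H : I -> hilbertType R) (rho : forall i, A -> {linear H i -> H i}).
Hypothesis hK : hausdorff_space K.
Hypothesis lcK : locally_compact [set: K].
Hypothesis S : spatial rho.
Local Open Scope complex_scope.

Lemma sqr_cabs_sub1 (z : R[i]) : cabs z <= 1 -> cabs (z - 1) ^+ 2 <= 2 * (1 - complex.Re z).
Proof.
move=> z1; have : cabs z ^+ 2 <= 1 by rewrite expr_le1// cabs_ge0.
by rewrite !sqr_cabs; case: z {z1} => a b /=; rewrite subr0; lra.
Qed.

(* A perfect set carries a diffuse mean [f] (an ultralimit of averages over the
   levels of a binary tree of open sets); functions that are unimodular on most
   cells of a deep level lie in any given weak neighbourhood of [0]. *)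
Lemma P1bar_scattered i (e : H i) : rnorm e = 1 -> P1bar (C0 K A) -> scattered K.
Proof.
move=> ne HP F cF [x0 Fx0]; apply: contrapT => noiso.
have F_perfect x : ~ isolated F x by move=> ix; apply: noiso; exists x.
have [split hsplit] := choice (tree_node_split R hK lcK F_perfect).
pose U (v : tree_node F) := sval v.
pose kid (b : bool) v := if b then (split v).1.2 else (split v).1.1.
pose phi v := (split v).2.
have /choice[pt pt_in] (v : tree_node F) : exists t, U v t.
  by case: (svalP v) => _ [t [_ Ut]]; exists t.
have kid_sub b v : U (kid b v) `<=` U v by case: (hsplit v) => -[h1 h2 _ _] _; case: b.
have kid_disj v t : U (kid false v) t -> ~ U (kid true v) t.
  by case: (hsplit v) => -[_ _ h _] _; exact: h.
have cphi v : continuous (phi v) by case: (hsplit v) => -[].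
have phi01 v t : 0 <= phi v t <= 1 by case: (hsplit v) => _ [h _ _ _]; exact: h.
have phi1 b v t : U (kid b v) t -> phi v t = 1.
  by case: (hsplit v) => _ [_ h _ _]; case: b => ?; apply: h; [right|left].
have phi0 v t : ~ U v t -> phi v t = 0 by case: (hsplit v) => _ [_ _ h _]; exact: h.
have phiM v : exists2 M, compact M & forall t, phi v t != 0 -> M t.
  by case: (hsplit v) => _ [_ _ _].
have rootP : open [set: K] /\ exists x, F x /\ [set: K] x.
  by split; [exact: openT|exists x0].
pose root0 : tree_node F := exist _ [set: K] rootP.
(* The mean lives below a child of [root0], where the bump function [Y root0] equals [1]; the
   constant [1] on [K] need not vanish at infinity. *)
pose root := kid false root0.
have [G [uG ooG]] := @ultraFilterLemma nat \oo _.
pose avg n (h : K -> R) := tree_avg kid pt n root h.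
(* The averages need not converge; the ultralimit keeps linearity and monotonicity. Values outside
   [U root] do not affect [L]. *)
pose L (h : K -> R) := ulim G (fun n => avg n h).
have avgB n h M : (forall t, `|h t| <= M) -> `|avg n h| <= M.
  by move=> hM; apply: (tree_avg_bound kid_sub pt_in).
have Llin a h h' M M' : (forall t, `|h t| <= M) -> (forall t, `|h' t| <= M') ->
    L (fun t => a * h t + h' t) = a * L h + L h'.
  move=> hM hM'; rewrite /L.
  rewrite -(ulimZ uG a (fun n => avgB n _ _ hM)).
  rewrite -(ulimD uG (M := `|a| * M) (N := M')) => [|n|n]; last exact: avgB.
    by congr ulim; apply/funext => n; rewrite /avg tree_avgD tree_avgZ.
  by rewrite normrM ler_wpM2l//; exact: avgB.
have Lle h h' M M' : (forall t, `|h t| <= M) -> (forall t, `|h' t| <= M') ->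
    (forall t, U root t -> h t <= h' t) -> L h <= L h'.
  move=> hM hM' hh'; apply: (ler_ulim uG (fun n => avgB n _ _ hM) (fun n => avgB n _ _ hM')).
  by move=> n; apply: (tree_avg_le kid_sub pt_in).
have Lcst c : L (fun=> c) = c.
  by apply: ulim_cst => //; apply: filterE => n; apply: (tree_avg_cst kid_sub pt_in).
have Leq h c : (forall t, U root t -> h t = c) -> L h = c.
  by move=> hc; apply: ulim_cst => //; apply: filterE => n; apply: (tree_avg_cst kid_sub pt_in).
have Lub h M c : (forall t, `|h t| <= M) -> (forall t, U root t -> h t <= c) -> L h <= c.
  move=> hM hc; rewrite -[leRHS](Lcst c).
  by apply: (Lle _ _ M `|c|) => // t; exact: hc.
pose psi (x : C0 K A) t := hdot (rho i (x t) e) e.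
have psi_le x t : cabs (psi x t) <= rnorm x.
  apply: (le_trans (CauchySchwarz _ _)); rewrite ne mulr1.
  apply: (le_trans (spatial_bound S _ _)); rewrite ne mulr1; exact: C0_eval_le.
have psiL l x y t : psi (l *: x + y) t = l * psi x t + psi y t.
  by rewrite /psi C0D C0Z (spatialL S) hdotDl hdotZl.
have psiD x y t : psi (x + y) t = psi x t + psi y t.
  by have := psiL 1 x y t; rewrite scale1r mul1r.
have Re_le x t : `|complex.Re (psi x t)| <= rnorm x.
  exact: le_trans (normRe_le_cabs _) (psi_le x t).
have Im_le x t : `|complex.Im (psi x t)| <= rnorm x.
  exact: le_trans (normIm_le_cabs _) (psi_le x t).
have cabs_le x t : `|cabs (psi x t)| <= rnorm x by rewrite ger0_norm ?cabs_ge0.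
pose f0 x := (L (fun t => complex.Re (psi x t)) +i* L (fun t => complex.Im (psi x t))).
have f0L l x y : f0 (l *: x + y) = l * f0 x + f0 y.
  case: l => a b; apply/eqP; rewrite eq_complex /=; apply/andP; split; apply/eqP.
  - have -> : (fun t => complex.Re (psi ((a +i* b) *: x + y) t)) =
       (fun t => a * complex.Re (psi x t) + (- b * complex.Im (psi x t) + complex.Re (psi y t))).
      apply/funext => t; rewrite psiL ReD; case: (psi x t) => u v /=; ring.
    rewrite (Llin _ _ _ _ (`|b| * rnorm x + rnorm y) (Re_le x)).
      by rewrite (Llin _ _ _ _ _ (Im_le x) (Re_le y)); ring.
    move=> t; apply: (le_trans (ler_normD _ _)); apply: lerD => //.
    by rewrite normrM normrN ler_wpM2l.
  - have -> : (fun t => complex.Im (psi ((a +i* b) *: x + y) t)) =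
       (fun t => a * complex.Im (psi x t) + (b * complex.Re (psi x t) + complex.Im (psi y t))).
      apply/funext => t; rewrite psiL raddfD/=; case: (psi x t) => u v /=; ring.
    rewrite (Llin _ _ _ _ (`|b| * rnorm x + rnorm y) (Im_le x)).
      by rewrite (Llin _ _ _ _ _ (Re_le x) (Im_le y)); ring.
    move=> t; apply: (le_trans (ler_normD _ _)); apply: lerD => //.
    by rewrite normrM ler_wpM2l.
have f0_le x : cabs (f0 x) <= 1 * rnorm x.
  have f00 : f0 0 = 0 by exact: (@linear_at0 _ _ R[i]^o f0 f0L).
  have [w w1 wf] := rotate_cabs (f0 x).
  have -> : cabs (f0 x) = L (fun t => complex.Re (psi (w *: x) t)).
    have := f0L w x 0; rewrite addr0 f00 addr0 wf => /(congr1 (@complex.Re R))/= <-.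
    by [].
  apply: (Lub _ _ _ (Re_le _)) => t _.
  apply: (le_trans (ler_norm _)); apply: (le_trans (Re_le _ _)).
  by rewrite rnormZE w1.
have [f fE] := dual_of f0L f0_le.
have [P [PE PE0]] := spatial_rank1 S e e.
have P1 : rnorm P <= 1.
  by have := spatial_rank1_norm S PE PE0; rewrite ne mulr1.
have ee : hdot e e = 1 by rewrite hdotxx ne expr1n.
have psiP (x : C0 K A) c t : x t = c *: P -> psi x t = c.
  by move=> xt; rewrite /psi xt (spatialZ S) PE ee scale1r hdotZl ee mulr1.
have /choice[Y YE] (v : tree_node F) : exists y : C0 K A, forall t, y t = (phi v t)%:C *: P.
  by apply: (@C0_bump R K A (phi v) (fun=> P)) => // t; exact: cvg_cst.
have Y1 v : rnorm (Y v) <= 1.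
  apply: C0_rnorm_le => // t; rewrite YE; exact: le_trans (rnorm_scale01 _ (phi01 v t)) P1.
pose p := Y root0.
have psip t : U root t -> psi p t = 1.
  by move=> rt; apply: psiP; rewrite YE (phi1 false).
pose N x := L (fun t => cabs (psi x t)).
apply: (@not_P1bar R (C0 K A) f p N) HP.
- by apply: dual_norm_le => x x1; rewrite fE; apply: (le_trans (f0_le x)); rewrite mul1r.
- exact: Y1.
- rewrite fE; apply/eqP; rewrite eq_complex; apply/andP; split; apply/eqP => /=.
  + by apply: Leq => t rt; rewrite psip.
  + by apply: Leq => t rt; rewrite psip.
- move=> x y; rewrite /N.
  have -> : L (fun t => cabs (psi x t)) + L (fun t => cabs (psi y t)) =
      L (fun t => 1 * cabs (psi x t) + cabs (psi y t)).
    by rewrite (Llin _ _ _ _ _ (cabs_le x) (cabs_le y)) mul1r.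
  apply: (Lle _ _ _ (rnorm x + rnorm y) (cabs_le (x + y))).
    move=> t; rewrite mul1r; apply: (le_trans (ler_normD _ _)).
    by apply: lerD; exact: cabs_le.
  by move=> t _; rewrite psiD mul1r ler_cabsD.
- move=> r x; rewrite /N; have z0 : forall t : K, `|0 : R| <= 0 by move=> t; rewrite normr0.
  have := Llin `|r| _ _ _ _ (cabs_le x) z0; rewrite Lcst addr0 => <-.
  congr L; apply/funext => t; rewrite addr0 -(addr0 (r%:C *: x)) psiL.
  have -> : psi 0 t = 0 by rewrite /psi C00 (spatial0 S) hdot0l.
  by rewrite addr0 cabsM cabs_real.
- by move=> x; apply: (Lub _ _ _ (cabs_le x)) => t _; exact: psi_le.
- move=> u u1; rewrite fE /N.
  (* The bound is affine in [Re (psi u t)], hence passes through the mean [L]. *)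
  have -> : 1 / 8 + 4 * (1 - complex.Re (f0 u)) =
      L (fun t => - 4 * complex.Re (psi u t) + (1 / 8 + 4)).
    rewrite (Llin _ _ _ _ `|1 / 8 + 4 : R| (Re_le u)); last by [].
    by rewrite Lcst /f0 /=; lra.
  apply: (Lle _ _ _ (4 * rnorm u + (1 / 8 + 4)) (cabs_le (u - p))).
    move=> t; apply: (le_trans (ler_normD _ _)); apply: lerD.
      by rewrite normrM normrN (ger0_norm (ler0n _ 4)); apply: ler_wpM2l.
    by rewrite ger0_norm//; lra.
  move=> t rt; have -> : psi (u - p) t = psi u t - 1.
    rewrite psiD -scaleN1r -(addr0 (-1 *: p)) psiL psip// /psi C00 (spatial0 S).
    by rewrite hdot0l addr0 mulN1r.
  have := sqr_le_affine (sqr_cabs_sub1 (le_trans (psi_le u t) u1)); lra.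
(* There are [2 ^ d >= 2 n] cells, and the moduli of the coefficients miss [1] by at most [n] in
   total, so their mean is at least [1/2]. *)
- move=> n g; pose d := n.+1.
  pose Yl (s : tree_index d) := Y (leaf kid root s).
  have [c [c1 cV cn]] := almost_unimodular_kernel (fun s l => g l (Yl s)).
  pose y := \sum_s c s *: Yl s.
  have yE t : y t = \sum_s (c s * (phi (leaf kid root s) t)%:C) *: P.
    rewrite /y C0_sum; apply: eq_bigr => s _.
    by rewrite C0Z YE scalerA.
  exists y; split.
  + apply: C0_rnorm_le => // t; rewrite yE; apply: (le_trans (ler_rnorm_sum _ _ _)).
    apply: le_trans (sum_phi_leaf kid_sub kid_disj phi01 phi0 d root t).
    apply: ler_sum => s _; case/andP: (phi01 (leaf kid root s) t) => p0 _.
    rewrite rnormZE cabsM cabs_ge0_real// -[leRHS]mulr1.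
    apply: ler_pM => //; first by rewrite mulr_ge0 ?cabs_ge0.
      exact: rnorm_ge0.
    by rewrite ler_piMl.
  + move=> l; rewrite linear_sum -[RHS](cV l); apply: eq_bigr => s _.
    by rewrite dualZ.
  + have yleaf s b t : U (kid b (leaf kid root s)) t -> cabs (psi y t) = cabs (c s).
      move=> kt; congr cabs; apply: psiP; rewrite yE (bigD1 s)//= (phi1 b)// mulr1.
      rewrite big1 ?addr0// => s' s's; rewrite phi0 ?mulr0 ?scale0r//.
      move=> s't; move/eqP: s's; apply.
      exact: (@leaf_disj _ _ U kid kid_sub kid_disj d root s' s t s't (kid_sub _ _ _ kt)).
    have -> : N y = (2 ^+ d)^-1 * \sum_s cabs (c s).
      (* From level [d.+1] on the averages are constant, and [G] contains the tails of [nat]. *)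
      apply: ulim_cst => //; apply: ooG; exists d.+1 => // k /= dk.
      rewrite -(subnKC dk) addSn -addnS.
      exact: (tree_avg_leaf kid_sub pt_in _ yleaf).
    have : \sum_s cabs (c s) = 2 ^+ d - \sum_s (1 - cabs (c s)).
      rewrite sumrB sumr_const card_tree_index natrX opprB addrCA subrr addr0//.
    move=> ->.
    have d2 : 2 * n%:R <= 2 ^+ d :> R.
      by rewrite exprS ler_pM2l// -natrX ler_nat ltnW// ltn_expl.
    rewrite [ltRHS]mulrC ltr_pdivlMr ?exprn_gt0//.
    have : 0 < 2 ^+ d :> R by rewrite exprn_gt0.
    lra.
Qed.

End NotScattered.

Theorem theorem4p3 (R : realType) (K : topologicalType) (A : cstarAlgType R)
    (K_neq0 : [set: K] !=set0) (A_neq0 : exists a : A, a != 0)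
    (K_hausdorff : hausdorff_space K)
    (K_locally_compact : locally_compact [set: K])
    (A_compact : compact_cstar_algebra A) :
  [<-> P1 (C0 K A);
       P1bar (C0 K A);
       scattered K /\ c0_sum_of_finite_dimensional A].
Proof.
case: A_compact => I0 [H [X [XH AX]]]; pose I : choiceType := {classic I0}.
have [rho S] := @compact_spatial R A I H X XH AX.
tfae.
- move=> HP C ccC x Cx; have [W [oW Wx WC]] := HP C ccC x Cx.
  by exists W; split => //; apply: subset_trans WC _; exact: subset_closure.
- move=> HP; have sK : scattered K.
    (* A nonzero element acts nontrivially on some [H i], which therefore contains a unit vector. *)
    have [a a0] := A_neq0.
    have [i [w aw]] : exists i w, rho i a w != 0.
      apply: contrapT => hn; move/eqP: a0; apply.
      apply: (spatial_inj S) => i w; rewrite (spatial0 S).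
      by apply/eqP/negPn/negP => h; apply: hn; exists i, w.
    have w0 : w != 0 by apply: contraNneq aw => ->; rewrite linear0.
    have e1 : rnorm (((rnorm w)^-1)%:C%C *: w) = 1.
      rewrite rnormZE cabs_ge0_real ?invr_ge0 ?rnorm_ge0// mulVf//.
      by rewrite gt_eqF// rnorm_gt0.
    exact: (P1bar_scattered K_hausdorff K_locally_compact S e1 HP).
  split => //; exists I0, X; split => // i.
  (* As [K] is nonempty and scattered, it has an isolated point, at which every summand can be
     tested. *)
  have [k0 [_ [V Vk0]]] := sK setT closedT K_neq0.
  rewrite setIT => VE.
  have ok0 : open [set k0] by rewrite openE => k ->; rewrite -VE.
  have [n [e be]] := P1bar_orthonormal_basis K_hausdorff K_locally_compact S (i : I) ok0 HP.
  exact: compact_operator_algebra_finite_dimensional (XH i) be.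
- move=> [sK fA]; apply: (scattered_P1 K_hausdorff K_locally_compact S sK).
  exact: (finite_dimensional_orthonormal_basis S fA).
Qed.
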